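(* Let $n\in\mathbb{N}$, let $\alpha,N>0$, and let $D\subset\mathbb{C}^{n+1}$ be a smooth bounded pseudoconvex domain with $0\in bD$. Suppose that $0$ is an exponentially flat boundary point of $D$ and that $q$ is an $(\alpha,N)$-cone type curve approaching $0$. Then, for every $\xi\in\mathbb{C}^{n+1}\setminus\{0\}$, $$\lim_{t\to0^+}\frac{M_D^K(q(t);\xi)}{\max\left\{\dfrac{|\xi_{N,t}|}{2\,d(t)},\ \dfrac{|\xi_{T,t}|}{d^*(t)}\right\}}=1,$$ where $M_D^K$ is the Kobayashi metric of $D$.
   Context: Notation: $bD=\partial D$ is the boundary of $D$; $e_1,\dots,e_{n+1}$ is the standard basis of $\mathbb{C}^{n+1}$; $\mathbb{D}$ is the open unit disc in $\mathbb{C}$; $\mathcal{O}(\mathbb{D},D)$ is the set of holomorphic maps $\mathbb{D}\to D$. Kobayashi metric: $M_D^K(z;\xi)=\inf\{a>0:\exists f\in\mathcal{O}(\mathbb{D},D)\text{ with }f(0)=z,\ f'(0)=\xi/a\}$. Exponentially flat functions. A smooth function $\phi:\mathbb{R}\to\mathbb{R}$ is exponentially flat near the origin if: (1) $\phi(x)=0$ for $x\le0$; (2) $\phi^{(m)}(0)=0$ for all $m\in\mathbb{N}$; (3) there is $\epsilon_0>0$ such that $\phi''(x)>0$ for $0<x<\epsilon_0$; (4) the function $-1/\log\phi(x)$ extends to a smooth function on $[0,\infty)$ and vanishes to a finite order $m$ at $0$; (5) $\lim_{r\to0^+}\phi(rx)/\phi(r)$ equals $0$ if $0<x<1$ and $\infty$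 if $x>1$. Exponentially flat boundary points. For a bounded smooth domain $D\subset\mathbb{C}^{n+1}$ with $0\in bD$, the point $0$ is exponentially flat if there is a neighbourhood $U$ of $0$ with $D\cap U=\{z\in U:\rho(z)<0\}$, where $\rho(z)=\operatorname{Re}z_1+\phi(|z_2|^2+\dots+|z_{n+1}|^2)$ and $\phi$ is exponentially flat near the origin. Put $\Omega=\{z\in\mathbb{C}^{n+1}:\rho(z)<0\}$. Cone type curves. Put $C_{\alpha,N}=\{(z_1,z')\in\mathbb{C}\times\mathbb{C}^n:\operatorname{Re}z_1<-\alpha|z'|^N\}$. An $(\alpha,N)$-cone type curve approaching $0$ is a smooth curve $q:(0,\epsilon_0)\to D\cap C_{\alpha,N}$ (for some $\epsilon_0>0$) with $\lim_{t\to0^+}q(t)=0$. Normal and tangential components. Let $\pi$ be the normal projection onto $\partial D$ (nearest boundary point), defined for points of $\mathbb{C}^{n+1}$ close to $\partial D$. For small $t$ write $\xi=\xi_{N,t}+\xi_{T,t}$ with $\xi_{T,t}\in T^{\mathbb{C}}_{\pi(q(t))}(\partial D)$ (complex tangent space) and $\xi_{N,t}$ orthogonal to $T^{\mathbb{C}}_{\pi(q(t))}(\partial D)$. The distances $d(t)$ and $d^*(t)$ (Euclidean distances from $q(t)$ to $\partial D$ in the normal and tangential directions), for small $t>0$. Let $T^1_t(w)=(w_1-i\operatorname{Im}q_1(t),w_2,\dots,w_{n+1})$ and $r(t)=\|(0,q_2(t),\dots,q_{n+1}(t))\|$. Let $R^1_t$ be the identity if $r(t)=0$, and otherwise a unitary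 linear map of $\mathbb{C}^{n+1}$ with $R^1_t(e_1)=e_1$ and $R^1_t\big((0,q_2(t),\dots,q_{n+1}(t))/r(t)\big)=e_2$. Let $\tilde q(t)=R^1_t\circ T^1_t(q(t))=(\operatorname{Re}q_1(t),r(t),0,\dots,0)$. There is a unique $p(t)\in b\Omega$ with $d(t):=\operatorname{dist}(\tilde q(t),b\Omega)=|\tilde q(t)-p(t)|$, and $p_1(t)\in\mathbb{R}$, $p_2(t)\ge0$, $p_j(t)=0$ for $j\ge3$; $d(t)$ is also the Euclidean distance from $q(t)$ to $\partial D$. Let $\nabla\rho(p(t))=(1,2p_2(t)\phi'(p_2(t)^2),0,\dots,0)$, $T^2_t(w)=w-p(t)$, and let $R^2_t$ be the unitary linear map sending $\nabla\rho(p(t))/\|\nabla\rho(p(t))\|\mapsto e_1$, $(-2p_2(t)\phi'(p_2(t)^2),1,0,\dots,0)/\|\nabla\rho(p(t))\|\mapsto e_2$, and $e_j\mapsto e_j$ for $j\ge3$. Put $\gamma_t=R^2_t\circ T^2_t$. Then $\gamma_t(\tilde q(t))=(-d(t),0,\dots,0)$ and $d^*(t):=\min\{s>0:\ s e_2+(-d(t),0,\dots,0)\in b\gamma_t(\Omega)\}$. *)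

(* Defs.v *)
(* C is R[i] for an arbitrary R : realType, and C^{n+1} is 'rV[R[i]]_n.+1, whose
   coordinates z_1, z_2, ... are the entries of index 0, 1, ... *)
From HB Require Import structures.
From mathcomp Require Import all_boot all_order all_algebra.
From mathcomp Require Import all_classical all_reals all_analysis.
From mathcomp Require Import complex.

Set Implicit Arguments.
Unset Strict Implicit.
Unset Printing Implicit Defensive.
Import Order.TTheory GRing.Theory Num.Theory.
Import numFieldNormedType.Exports.
Local Open Scope classical_set_scope.
Local Open Scope ring_scope.
Local Open Scope complex_scope.

(* The library has no topology on R[i]; copy the one given by its norm, so that
   R[i] and 'rV[R[i]]_m become normed modules over R[i]. *)
#[warnings="-redundant-canonical-projection"]
HB.instance Definition _ (R : realType) :=
  PseudoPointedMetric.copy R[i] R[i]^o.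
#[warnings="-redundant-canonical-projection"]
HB.instance Definition _ (R : realType) := NormedModule.copy R[i] R[i]^o.

Definition bd {T : topologicalType} (A : set T) : set T :=
  closure A `\` interior A.

Section Euclidean.
Context {R : realType}.

Definition sqmod (z : R[i]) : R := complex.Re z ^+ 2 + complex.Im z ^+ 2.

(* The library norm on 'rV[R[i]]_m is the sup norm, valued in R[i]. *)
Definition enorm {m : nat} (z : 'rV[R[i]]_m) : R :=
  Num.sqrt (\sum_j sqmod (z 0 j)).

Definition edist {m : nat} (z : 'rV[R[i]]_m) (A : set 'rV[R[i]]_m) : R :=
  inf [set enorm (z - w) | w in A].

Definition nearest {m : nat} (A : set 'rV[R[i]]_m) (z p : 'rV[R[i]]_m) : Prop :=
  A p /\ forall w, A w -> enorm (z - p) <= enorm (z - w).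

(* Meaningful when the nearest point exists and is unique. *)
Definition nearest_pt {m : nat} (A : set 'rV[R[i]]_m) (z : 'rV[R[i]]_m) :
    'rV[R[i]]_m :=
  xget 0 [set p | nearest A z p].

Definition stdb {n : nat} (j : nat) : 'rV[R[i]]_n.+1 := delta_mx 0 (inord j).

End Euclidean.

Section Smoothness.
Context {R : realType} {m : nat}.
Implicit Types (z v : 'rV[R[i]]_m) (U : set 'rV[R[i]]_m).

(* For open A, this is C^oo on A. *)
Definition smooth1 (A : set R) (g : R -> R) : Prop :=
  forall k x, A x -> derivable (derive1n k g) x 1.

Definition rderiv v (f : 'rV[R[i]]_m -> R) z : R :=
  derive1 (fun t : R => f (z + t%:C *: v)) 0.

Definition rderivable v (f : 'rV[R[i]]_m -> R) z : Prop :=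
  derivable (fun t : R => f (z + t%:C *: v)) 0 1.

(* For open U, this is C^oo on U in the sense of the underlying real vector
   space: all iterated real directional derivatives exist and are continuous. *)
Definition smooth_on U (f : 'rV[R[i]]_m -> R) : Prop :=
  forall (vs : seq 'rV[R[i]]_m) z, U z ->
    {for z, continuous (foldr rderiv f vs)} /\
    forall v, rderivable v (foldr rderiv f vs) z.

Definition cderiv v (F : 'rV[R[i]]_m -> R[i]) z : R[i] :=
  rderiv v (fun w => complex.Re (F w)) z
    +i* rderiv v (fun w => complex.Im (F w)) z.

(* d/dz_j = (d/dx_j - i d/dy_j) / 2 and d/dzbar_j = (d/dx_j + i d/dy_j) / 2 *)
Definition dz (j : 'I_m) (F : 'rV[R[i]]_m -> R[i]) z : R[i] :=
  2^-1 * (cderiv (delta_mx 0 j) F z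
          - (0 +i* 1) * cderiv ((0 +i* 1) *: delta_mx 0 j) F z).

Definition dzbar (j : 'I_m) (F : 'rV[R[i]]_m -> R[i]) z : R[i] :=
  2^-1 * (cderiv (delta_mx 0 j) F z
          + (0 +i* 1) * cderiv ((0 +i* 1) *: delta_mx 0 j) F z).

Definition dform (r : 'rV[R[i]]_m -> R) z v : R[i] :=
  \sum_j dz j (fun w => (r w)%:C) z * v 0 j.

Definition levi (r : 'rV[R[i]]_m -> R) z v : R[i] :=
  \sum_j \sum_k
    dz j (dzbar k (fun w => (r w)%:C)) z * v 0 j * (v 0 k)^*.

End Smoothness.

Section Domains.
Context {R : realType} {m : nat}.
Implicit Types (D : set 'rV[R[i]]_m) (p xi : 'rV[R[i]]_m).

Definition local_defining D p (U : set 'rV[R[i]]_m) (r : 'rV[R[i]]_m -> R) :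
    Prop :=
  [/\ open U, U p, smooth_on U r,
      D `&` U = [set z | U z /\ r z < 0] &
      forall z, U z -> bd D z -> exists v, rderiv v r z != 0].

Definition smooth_bounded_domain D : Prop :=
  [/\ open D, D !=set0, connected D, bounded_set D &
      forall p, bd D p -> exists U r, local_defining D p U r].

(* Levi pseudoconvexity; the condition at p does not depend on the defining
   function.  The order of R[i] makes `0 <= levi r p v' include that the
   (Hermitian) Levi form is real. *)
Definition pseudoconvex D : Prop :=
  forall p, bd D p -> exists U r, local_defining D p U r /\
    forall v, dform r p v = 0 -> 0 <= levi r p v.

(* T^C_p(bD), which does not depend on the defining function either *)
Definition ctangent D p : set 'rV[R[i]]_m :=
  [set v | exists U r, local_defining D p U r /\ dform r p v = 0].

(* dotmx is the standard Hermitian product. *)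
Definition tan_part D p xi : 'rV[R[i]]_m :=
  xget 0 [set v | ctangent D p v /\
                  forall w, ctangent D p w -> dotmx (xi - v) w = 0].

Definition nor_part D p xi : 'rV[R[i]]_m := xi - tan_part D p xi.

Definition holo_disc D (f : R[i] -> 'rV[R[i]]_m) : Prop :=
  forall w : R[i], `|w| < 1 -> derivable f w 1 /\ D (f w).

Definition kobayashi D (z xi : 'rV[R[i]]_m) : R :=
  inf [set a : R | 0 < a /\ exists f,
         [/\ holo_disc D f, f 0 = z & derive1 f 0 = (a^-1)%:C *: xi]].

End Domains.

Section ExponentiallyFlat.
Context {R : realType}.

(* A smooth function on [0, +oo[ is the restriction of a smooth function on R.
   -1 / ln (phi x) is defined where 0 < phi x and phi x != 1, whereas ln and the
   inverse are total in the library. *)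
Definition inv_log_extends (phi : R -> R) : Prop :=
  exists (psi : R -> R) (m : nat),
    [/\ smooth1 setT psi,
        forall x, 0 < x -> 0 < phi x -> phi x != 1 -> psi x = - (ln (phi x))^-1,
        (0 < m)%N,
        forall k, (k < m)%N -> derive1n k psi 0 = 0 &
        derive1n m psi 0 != 0].

Record exp_flat (phi : R -> R) : Prop := ExpFlat {
  exp_flat_smooth : smooth1 setT phi ;
  exp_flat_zero : forall x, x <= 0 -> phi x = 0 ;
  exp_flat_derive0 : forall m : nat, derive1n m phi 0 = 0 ;
  exp_flat_convex : exists2 e0 : R, 0 < e0 &
    forall x, 0 < x < e0 -> 0 < derive1n 2 phi x ;
  exp_flat_log : inv_log_extends phi ;
  exp_flat_lim0 : forall x : R, 0 < x < 1 ->
    phi (r * x) / phi r @[r --> 0^'+] --> (0 : R) ;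
  exp_flat_limy : forall x : R, 1 < x ->
    phi (r * x) / phi r @[r --> 0^'+] --> +oo
}.

End ExponentiallyFlat.

Section FlatPoint.
Context {R : realType} {n : nat}.
Local Notation V := 'rV[R[i]]_n.+1.
Implicit Types (z : V) (D : set V) (phi : R -> R) (q : R -> V).

Definition sqtan z : R := \sum_(j < n.+1 | j != ord0) sqmod (z 0 j).

Definition rho phi z : R := complex.Re (z 0 ord0) + phi (sqtan z).

Definition Omega phi : set V := [set z : V | rho phi z < 0].

(* The origin is an exponentially flat boundary point of D, with flat function
   phi. *)
Definition exp_flat_point D phi : Prop :=
  exp_flat phi /\
  exists2 U : set V, nbhs (0 : V) U & D `&` U = [set z | U z /\ rho phi z < 0].

Definition cone (alpha N : R) : set V :=
  [set z : V | complex.Re (z 0 ord0) < - alpha * (Num.sqrt (sqtan z) `^ N)].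

Definition cone_curve D (alpha N : R) q : Prop :=
  (exists2 e0 : R, 0 < e0 &
     [/\ forall j, smooth1 `]0, e0[ (fun t => complex.Re (q t 0 j)),
         forall j, smooth1 `]0, e0[ (fun t => complex.Im (q t 0 j)) &
         forall t, 0 < t < e0 -> D (q t) /\ cone alpha N (q t)]) /\
  q t @[t --> 0^'+] --> (0 : V).

(* q~(t) = (Re q_1(t), r(t), 0, ..., 0), the image of q(t) under the translation
   by (-i Im q_1(t), 0, ..., 0) followed by any unitary map that fixes e_1 and
   rotates (0, q_2(t), ..., q_{n+1}(t)) to r(t) e_2.  Such maps preserve Omega. *)
Definition qtilde z : V :=
  (complex.Re (z 0 ord0))%:C *: stdb 0 + (Num.sqrt (sqtan z))%:C *: stdb 1.

Definition foot phi z : V := nearest_pt (bd (Omega phi)) (qtilde z).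

Definition dnor phi z : R := edist (qtilde z) (bd (Omega phi)).

(* 2 p_2 phi'(p_2^2), where p_2 is real *)
Definition slope phi (p : V) : R :=
  let p2 := complex.Re (p 0 (inord 1)) in 2 * p2 * derive1 phi (p2 ^+ 2).

Definition grad phi (p : V) : V := stdb 0 + (slope phi p)%:C *: stdb 1.

Definition grad_rot phi (p : V) : V := - (slope phi p)%:C *: stdb 0 + stdb 1.

(* Row vectors are multiplied on the right: e_j *m frame is the j-th row, so
   invmx frame sends the rows of frame to e_1, ..., e_{n+1}. *)
Definition frame phi (p : V) : 'M[R[i]]_n.+1 :=
  \matrix_(j < n.+1)
    match val j with
    | 0%N => ((enorm (grad phi p))^-1)%:C *: grad phi p
    | 1%N => ((enorm (grad phi p))^-1)%:C *: grad_rot phi p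
    | _ => delta_mx 0 j
    end.

Definition gamma phi z (w : V) : V :=
  (w - foot phi z) *m invmx (frame phi (foot phi z)).

(* The infimum is a minimum in the situation of the theorem. *)
Definition dtan phi z : R :=
  inf [set s : R | 0 < s /\
    bd (gamma phi z @` Omega phi) (s%:C *: stdb 1 + (- dnor phi z)%:C *: stdb 0)].

End FlatPoint.

(* Main.v *)
(* For a point z of the curve put x = - Re z_1, r = |z'| and let phi (Y^2) = x.
   Flatness makes r + 2 x negligible against Y, and makes phi negligible against x
   below ((1 - k) Y)^2 and large against x above ((1 + k) Y)^2.  Hence d ~ x and
   d^* ~ Y, the complex tangent space at the nearest point is almost orthogonal to
   e_1, and the denominator is asymptotic to
     X = max (|xi_1| / (2 x), |xi'| / Y).
   Upper bound for the Kobayashi metric: a disc whose first coordinate is a Moebius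
   map onto a large disc in a half plane and whose other coordinates are affine.
   Lower bound: a disc f of D centred near 0 maps |w| < s, for any fixed s < 1, near
   0, where Re f_1 + phi (|f'|^2) < 0.  Then Re f_1 < 0 bounds the derivative of f_1
   at 0 as for maps into a half plane.  Convexity puts phi above its tangent at Y^2,
   so f also stays in a paraboloid whose section at height f_1 (0) has radius Y,
   which bounds the derivative of f'.  Both bounds come from the mean value of the
   real part, over a circle, of a suitable function holomorphic outside the centre,
   which rests on Goursat's theorem. *)
Require Import Defs.
From HB Require Import structures.
From mathcomp Require Import all_boot all_order all_algebra.
From mathcomp Require Import all_classical all_reals all_analysis.
From mathcomp Require Import complex ring lra.
Set Implicit Arguments.
Unset Strict Implicit.
Unset Printing Implicit Defensive.
Import Order.TTheory GRing.Theory Num.Theory.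
Import numFieldNormedType.Exports.
Import ComplexField.Normc.
Local Open Scope classical_set_scope.
Local Open Scope ring_scope.
Local Open Scope complex_scope.

(** * Complex numbers and holomorphic functions *)

(** The factor 2 beside d, and its absence beside d^*, come from two sharp inequalities with one
    mechanism. A weight 1 + cos, or a square, is nonnegative on the circle, and the identity 1/w =
    w^*/r^2 there turns conjugates into pole terms, so that the mean can be read off at the centre.
    The slope of the tangent to phi cancels in the second inequality, so its size never enters. The
    obstacle is that phi is controlled only near 0 while D is merely bounded, so discs must be
    localized first. Near the boundary - Re f_1 (0) is small; a Harnack inequality along rays keeps
    f_1 small, and phi, bounded below away from 0, then confines f'. The cone condition serves to
    compare powers of r with x: phi and its derivatives are O(u^k) for every k, hence o(x) for u of
    order (r + x)^2. One error parameter e is carried through: d is known up to a factor 1 - e, d^*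
    up to 1 +- 8 e, the discs of the upper bound cost 1 + 10 e, and the quotient ends within 40 e of
    1. *)

Section ComplexBasics.
Context {R : realType}.
Local Notation C := R[i].
Implicit Types (w z h : C) (f g : C -> C).

Lemma cnormE z : `|z| = (normc z)%:C.
Proof. by case: z. Qed.

Lemma normc_ge0 z : 0 <= normc z.
Proof. by case: z => a b; exact: sqrtr_ge0. Qed.

Lemma normc_sqr z : normc z ^+ 2 = sqmod z.
Proof. by case: z => a b; rewrite /= sqr_sqrtr // addr_ge0 ?sqr_ge0. Qed.

Lemma normcB z w : normc (z - w) = normc (w - z).
Proof. by rewrite -(opprB w z) normcN. Qed.

Lemma normc_real (a : R) : normc a%:C = `|a|.
Proof. by rewrite /= expr0n addr0 sqrtr_sqr. Qed.

Lemma ler_normcD z w : normc (z + w) <= normc z + normc w.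
Proof. exact: le_normcD. Qed.

Lemma ler_normcB z w : normc (z - w) <= normc z + normc w.
Proof. by rewrite -(normcN w); exact: le_normcD. Qed.

Lemma normc_eq0 z : (normc z == 0) = (z == 0).
Proof.
apply/eqP/eqP => [/eq0_normc//|->]; exact: normc0.
Qed.

Lemma normc_gt0 z : (0 < normc z) = (z != 0).
Proof. by rewrite lt0r normc_ge0 andbT normc_eq0. Qed.

Lemma ler_Re_normc z : `|complex.Re z| <= normc z.
Proof.
case: z => a b /=.
by rewrite -sqrtr_sqr ler_wsqrtr // lerDl sqr_ge0.
Qed.

Lemma ler_Im_normc z : `|complex.Im z| <= normc z.
Proof.
case: z => a b /=.
by rewrite -sqrtr_sqr ler_wsqrtr // lerDr sqr_ge0.
Qed.

Lemma ler_normc_ReIm z : normc z <= `|complex.Re z| + `|complex.Im z|.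
Proof.
case: z => a b /=; rewrite -[X in _ <= X]ger0_norm ?addr_ge0 // -sqrtr_sqr.
rewrite ler_wsqrtr // -(real_normK (num_real a)) -(real_normK (num_real b)).
by have := normr_ge0 a; have := normr_ge0 b; nra.
Qed.

Lemma cReD z w : complex.Re (z + w) = complex.Re z + complex.Re w.
Proof. by case: z; case: w. Qed.

Lemma cReN z : complex.Re (- z) = - complex.Re z.
Proof. by case: z. Qed.

Lemma cReB z w : complex.Re (z - w) = complex.Re z - complex.Re w.
Proof. by rewrite cReD cReN. Qed.

Lemma cImD z w : complex.Im (z + w) = complex.Im z + complex.Im w.
Proof. by case: z; case: w. Qed.

Lemma cImN z : complex.Im (- z) = - complex.Im z.
Proof. by case: z. Qed.

Lemma cImB z w : complex.Im (z - w) = complex.Im z - complex.Im w.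
Proof. by rewrite cImD cImN. Qed.

Lemma cReM z w : complex.Re (z * w) =
  complex.Re z * complex.Re w - complex.Im z * complex.Im w.
Proof. by case: z; case: w. Qed.

Lemma cImM z w : complex.Im (z * w) =
  complex.Re z * complex.Im w + complex.Im z * complex.Re w.
Proof. by case: z => a b; case: w => c d /=; rewrite (mulrC b). Qed.

Lemma cRe_sum (I : Type) (r : seq I) (P : pred I) (F : I -> C) :
  complex.Re (\sum_(i <- r | P i) F i) = \sum_(i <- r | P i) complex.Re (F i).
Proof. by elim/big_rec2: _ => // i x y _ <-; rewrite cReD. Qed.

Lemma mulcc_sqmod z : z * z^*%C = (sqmod z)%:C.
Proof.
case: z => a b; rewrite /sqmod /=; apply/eqP; rewrite eq_complex /=.
by apply/andP; split; apply/eqP; ring.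
Qed.

Lemma realcM (x y : R) : (x * y)%:C = x%:C * y%:C :> C.
Proof. exact: rmorphM. Qed.

Lemma realc_eq0 (x : R) : (x%:C == 0 :> C) = (x == 0).
Proof. by rewrite eq_complex /= eqxx andbT. Qed.

Lemma cjM z w : (z * w)^*%C = z^*%C * w^*%C.
Proof. exact: rmorphM. Qed.

Lemma cRe_cj z : complex.Re z^*%C = complex.Re z.
Proof. by case: z. Qed.

Lemma cRe_realM (x : R) z : complex.Re (x%:C * z) = x * complex.Re z.
Proof. by rewrite cReM /= mul0r subr0. Qed.

Lemma sqmod_ge0 z : 0 <= sqmod z.
Proof. by rewrite addr_ge0 ?sqr_ge0. Qed.

Lemma sqmod_dist z w :
  `|sqmod z - sqmod w| <= normc (z - w) * (normc z + normc w).
Proof.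
rewrite -!normc_sqr subr_sqr normrM [X in _ * X]ger0_norm ?addr_ge0 ?normc_ge0 //.
rewrite ler_wpM2r ?addr_ge0 ?normc_ge0 // ler_norml; apply/andP; split.
  by have := ler_normcD (w - z) z; rewrite subrK (normcB w); lra.
by have := ler_normcD (z - w) w; rewrite subrK; lra.
Qed.

Lemma nbhs_normcP w (P : C -> Prop) : (\forall z \near w, P z) <->
  exists2 d : R, 0 < d & forall h, normc h < d -> P (w + h).
Proof.
split.
- move=> /nbhs_normP[d /= d0 H]; exists (complex.Re d).
    by move: d0; rewrite ltcE /= => /andP[].
  move=> h hd; apply: H => /=; rewrite opprD addNKr normrN cnormE.
  by rewrite ltcE /=; move: d0; rewrite ltcE /= => /andP[-> _].
- move=> [d d0 H]; apply/nbhs_normP; exists d%:C; rewrite /= ?ltcR //.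
  move=> z /=; rewrite distrC cnormE ltcR => zd.
  by rewrite -(subrK w z) addrC; exact: H.
Qed.

(** The norm of C takes its values in C; this form of differentiability is an inequality between
    real numbers, in which derivatives are produced and consumed below. *)
Lemma is_derive_normcP f w a : is_derive w 1 f a <->
  forall e : R, 0 < e -> exists2 d : R, 0 < d &
    forall h, normc h < d -> normc (f (w + h) - f w - a * h) <= e * normc h.
Proof.
split.
- move=> [df da] e e0.
  have : h^-1 *: (f (h *: 1 + w) - f w) @[h --> 0^'] --> a.
    by rewrite -da; exact: df.
  move=> /cvgrPdist_le /(_ e%:C); rewrite ltcR => /(_ e0).
  rewrite near_withinE => /nbhs_normcP[d d0 H].
  exists d => // h hd.
  have [->|h0] := eqVneq h 0.
    by rewrite addr0 subrr mulr0 subrr normc0 mulr0.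
  have := H h hd; rewrite add0r h0 => /(_ isT).
  rewrite [h *: 1]mulr1 [_ *: _]mulrC.
  rewrite -(@ler_pM2r _ `|h|) ?normr_gt0 // -normrM mulrBl mulfVK //.
  by rewrite distrC (addrC h w) !cnormE -rmorphM lecR.
- move=> H.
  have K : h^-1 *: (f (h *: 1 + w) - f w) @[h --> 0^'] --> a.
    apply/cvgrPdist_le => e e0.
    have e0' : 0 < complex.Re e by move: e0; rewrite ltcE => /andP[].
    have [d d0 {}H] := H _ e0'.
    rewrite near_withinE; apply/nbhs_normcP; exists d => // h hd.
    rewrite add0r => h0.
    rewrite -(@ler_pM2r _ `|h|) ?normr_gt0 // -normrM mulrBl.
    rewrite [h *: 1]mulr1 [h^-1 *: _]mulrC mulfVK //.
    have := H h hd; rewrite -lecR rmorphM (addrC w) distrC !cnormE.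
    have eE : (complex.Re e)%:C = e by apply: RRe_real; exact: gtr0_real.
    by rewrite -{2}eE.
  split; first by apply/cvg_ex; exists a.
  exact: cvg_lim.
Qed.

Lemma is_derive_mulc f g w a b : is_derive w 1 f a -> is_derive w 1 g b ->
  is_derive w 1 (fun z => f z * g z) (f w * b + g w * a).
Proof. by move=> fa gb; exact: is_deriveM. Qed.

Lemma is_derive_invc f w a : is_derive w 1 f a -> f w != 0 ->
  is_derive w 1 (fun z => (f z)^-1) (- (f w)^-2 * a).
Proof.
move=> [fd fa] fw; apply: DeriveDef; first exact: (@derivableV C C f w 1 fw fd).
by rewrite (@deriveV C C f w 1 fw fd) fa.
Qed.

Lemma is_derive_scalec f w a b : is_derive w 1 f a ->
  is_derive w 1 (fun z => b * f z) (b * a).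
Proof. by move=> fa; exact: (@is_deriveZ C C C f b w 1 a fa). Qed.

Lemma is_derive_idc w : is_derive w 1 (fun z => z) 1.
Proof. exact: is_derive_id. Qed.

Lemma is_derive_cstc w (c : C) : is_derive w 1 (fun z => c) 0.
Proof. exact: is_derive_cst. Qed.

Lemma is_derive_addc f g w a b : is_derive w 1 f a -> is_derive w 1 g b ->
  is_derive w 1 (fun z => f z + g z) (a + b).
Proof. by move=> fa gb; exact: is_deriveD. Qed.

Lemma is_derive_sumc (I : Type) (s : seq I) (P : pred I) (F : I -> C -> C)
    (a : I -> C) w : (forall i, P i -> is_derive w 1 (F i) (a i)) ->
  is_derive w 1 (fun z => \sum_(i <- s | P i) F i z) (\sum_(i <- s | P i) a i).
Proof.
move=> H; elim: s => [|i s IH].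
  rewrite big_nil; have -> : (fun z => \sum_(i <- [::] | P i) F i z) = (fun=> 0).
    by apply/funext => z; rewrite big_nil.
  exact: is_derive_cstc.
rewrite big_cons.
have -> : (fun z => \sum_(i <- i :: s | P i) F i z) =
   if P i then fun z => F i z + \sum_(i <- s | P i) F i z
   else fun z => \sum_(i <- s | P i) F i z.
  by apply/funext => z; rewrite big_cons; case: ifP.
by case: ifPn => // Pi; apply: is_derive_addc => //; exact: H.
Qed.

Lemma is_derive_affine f w c b a : is_derive (c + b * w) 1 f a ->
  is_derive w 1 (fun z => f (c + b * z)) (b * a).
Proof.
move=> /is_derive_normcP H; apply/is_derive_normcP => e e0.
have b0 := normc_ge0 b.
have B0 : 0 < normc b + 1 by rewrite ltr_wpDl.
have [d d0 {}H] := H (e / (normc b + 1)) (divr_gt0 e0 B0).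
exists (d / (normc b + 1)); first exact: divr_gt0.
move=> h; rewrite ltr_pdivlMr // => hd.
have bh : normc (b * h) < d.
  rewrite normcM; apply: le_lt_trans hd; rewrite mulrC ler_wpM2l ?normc_ge0 //.
  by rewrite lerDl.
rewrite mulrDr addrA (_ : b * a * h = a * (b * h)); last by rewrite mulrCA mulrA.
have := H _ bh => /le_trans; apply.
rewrite normcM mulrA ler_wpM2r ?normc_ge0 // -mulrA ger_pMr //.
by rewrite mulrC ler_pdivrMr // mul1r lerDl.
Qed.

End ComplexBasics.

(** * Cauchy theorem on rectangles *)

Section MeanValue.
Context {R : realType}.
Implicit Types (F f : R -> R) (a b m : R).

Lemma is_derive_continuous_within F f a b :
  (forall x, a <= x <= b -> is_derive x 1 F (f x)) ->
  {within `[a, b], continuous F}.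
Proof.
move=> H; apply: derivable_within_continuous => x; rewrite in_itv /= => xab.
by have [] := H x xab.
Qed.

Lemma mean_value_le F f a b m : a <= b ->
  (forall x, a <= x <= b -> is_derive x 1 F (f x)) ->
  (forall x, a <= x <= b -> f x <= m) -> F b - F a <= m * (b - a).
Proof.
move=> ab H fm.
have [|c cab ->] := @MVT_segment R F f a b ab _ (is_derive_continuous_within H).
  by move=> x; rewrite in_itv /= => /andP[/ltW ax /ltW xb]; apply: H; rewrite ax.
by rewrite ler_wpM2r ?subr_ge0 //; apply: fm; move: cab; rewrite in_itv.
Qed.

Lemma mean_value_ge F f a b m : a <= b ->
  (forall x, a <= x <= b -> is_derive x 1 F (f x)) ->
  (forall x, a <= x <= b -> m <= f x) -> m * (b - a) <= F b - F a.
Proof.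
move=> ab H fm.
have [|c cab ->] := @MVT_segment R F f a b ab _ (is_derive_continuous_within H).
  by move=> x; rewrite in_itv /= => /andP[/ltW ax /ltW xb]; apply: H; rewrite ax.
by rewrite ler_wpM2r ?subr_ge0 //; apply: fm; move: cab; rewrite in_itv.
Qed.

(** Replaces estimates of integrals: two primitives are compared through their derivatives only.
    With m = 0 it says that two primitives of one function have the same increments. *)
Lemma mean_value_approx F f G g a b m : a <= b ->
  (forall x, a <= x <= b -> is_derive x 1 F (f x)) ->
  (forall x, a <= x <= b -> is_derive x 1 G (g x)) ->
  (forall x, a <= x <= b -> `|f x - g x| <= m) ->
  `|(F b - F a) - (G b - G a)| <= m * (b - a).
Proof.
move=> ab HF HG fg.
have H x : a <= x <= b -> is_derive x 1 (F - G) (f x - g x).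
  by move=> /[dup] /HF ? /HG ?; exact: is_deriveB.
have -> : F b - F a - (G b - G a) = (F - G) b - (F - G) a.
  by rewrite !fctE; ring.
rewrite ler_norml; apply/andP; split.
  rewrite -mulNr; apply: (mean_value_ge _ H) => // x /fg.
  by rewrite ler_norml => /andP[].
by apply: (mean_value_le _ H) => // x /fg; rewrite ler_norml => /andP[].
Qed.

Lemma continuous_primitive f a b : continuous f ->
  exists F, forall x, a <= x <= b -> is_derive x 1 F (f x).
Proof.
move=> cf.
(* Starting at a - 1, and working inside [a - 1, b + 1], makes both ends of [a, b] interior points,
   where the derivative is two-sided. *)
exists (fun x => \int[lebesgue_measure]_(t in `[a - 1, x]) f t) => x /andP[ax xb].
have xb1 : x < b + 1 by rewrite (le_lt_trans xb) // ltrDl.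
have ax1 : a - 1 < x by rewrite (lt_le_trans _ ax) // ltrBlDr ltrDl.
have fi : lebesgue_measure.-integrable `[a - 1, b + 1] (EFin \o f).
  apply: continuous_compact_integrable; first exact: segment_compact.
  exact: continuous_subspaceT.
have [d1 d2] := continuous_FTC1_closed xb1 fi ax1 (cf x).
rewrite derive1E in d2; exact: (DeriveDef d1 d2).
Qed.

End MeanValue.

Section Nested.
Context {R : realType}.

(** Bisection in the plane: [P k s t] is meant for the rectangle with lower corner (s, t) and sides
    A / 2^k and B / 2^k; the limit point lies in all the rectangles chosen. *)
Lemma nested_quarters (A B : R) (P : nat -> R -> R -> Prop) (s0 t0 : R) :
  0 <= A -> 0 <= B -> P 0%N s0 t0 ->
  (forall k s t, P k s t -> exists i j : bool,
     P k.+1 (s + i%:R * (A / 2 ^+ k.+1)) (t + j%:R * (B / 2 ^+ k.+1))) ->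
  exists S T, forall k, exists s t, [/\ P k s t,
    s <= S <= s + A / 2 ^+ k, t <= T <= t + B / 2 ^+ k &
    s0 <= s /\ s + A / 2 ^+ k <= s0 + A /\
    t0 <= t /\ t + B / 2 ^+ k <= t0 + B].
Proof.
move=> A0 B0 P0 PS.
(* The choice has to be total; where [P k] fails, the implication is vacuous and any quarter will
   do. *)
have step k (x : R * R) : {ij : bool * bool | P k x.1 x.2 ->
    P k.+1 (x.1 + ij.1%:R * (A / 2 ^+ k.+1)) (x.2 + ij.2%:R * (B / 2 ^+ k.+1))}.
  apply: cid; have [/PS[i [j H]]|nP] := pselect (P k x.1 x.2).
    by exists (i, j).
  by exists (true, true).
pose x := fix x k : R * R := if k is k'.+1 then
  ((x k').1 + (sval (step k' (x k'))).1%:R * (A / 2 ^+ k),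
   (x k').2 + (sval (step k' (x k'))).2%:R * (B / 2 ^+ k)) else (s0, t0).
have Px k : P k (x k).1 (x k).2.
  by elim: k => //= k; case: (step k (x k)).
have half (Z : R) k : Z / 2 ^+ k = Z / 2 ^+ k.+1 + Z / 2 ^+ k.+1.
  by rewrite exprS; field; rewrite expf_neq0.
have bb (b : bool) (Z : R) : 0 <= Z -> 0 <= b%:R * Z <= Z.
  by case: b => Z0; rewrite ?mul1r ?mul0r ?Z0 ?lexx.
have pos (Z : R) k : 0 <= Z -> 0 <= Z / 2 ^+ k by move=> Z0; rewrite divr_ge0 ?exprn_ge0.
(* One coordinate at a time: the nested intervals [u k, u k + Z / 2^k] share the supremum of their
   left ends. *)
have key (Z : R) (u : nat -> R) : 0 <= Z ->
    (forall k, u k <= u k.+1 /\ u k.+1 + Z / 2 ^+ k.+1 <= u k + Z / 2 ^+ k) ->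
    (forall k, u k <= sup (range u) <= u k + Z / 2 ^+ k) /\
    (forall k, u 0%N <= u k /\ u k + Z / 2 ^+ k <= u 0%N + Z).
  move=> Z0 uS.
  have mono k m : u k <= u (k + m)%N /\
      u (k + m)%N + Z / 2 ^+ (k + m) <= u k + Z / 2 ^+ k.
    elim: m => [|m [IH1 IH2]]; first by rewrite addn0.
    rewrite addnS; have [H1 H2] := uS (k + m)%N.
    by split; [exact: le_trans H1|exact: le_trans IH2].
  have le2 j k : u j <= u k + Z / 2 ^+ k.
    have [/subnKC jk|/ltnW/subnKC kj] := leqP j k.
      have [] := mono j (k - j)%N; rewrite jk => H _; apply: le_trans H _.
      by rewrite lerDl pos.
    have [_] := mono k (j - k)%N; rewrite kj => H; apply: le_trans H.
    by rewrite lerDl pos.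
  split=> k; last first.
    by have [] := mono 0%N k; rewrite add0n expr0 divr1.
  apply/andP; split.
    apply: ub_le_sup; last by exists k.
    by exists (u 0%N + Z / 2 ^+ 0) => _ [j _ <-].
  apply: ge_sup; first by exists (u 0%N), 0%N.
  by move=> _ [j _ <-].
have [|xS x0] := key A (fun k => (x k).1) A0.
  move=> k /=; have /andP[b0 b1] := bb (sval (step k (x k))).1 _ (pos A k.+1 A0).
  by rewrite lerDl; split=> //; rewrite (half A k) addrA lerD2r lerD2l.
have [|yS y0] := key B (fun k => (x k).2) B0.
  move=> k /=; have /andP[b0 b1] := bb (sval (step k (x k))).2 _ (pos B k.+1 B0).
  by rewrite lerDl; split=> //; rewrite (half B k) addrA lerD2r lerD2l.
exists (sup (range (fun k => (x k).1))), (sup (range (fun k => (x k).2))) => k.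
exists (x k).1, (x k).2; split; [exact: Px|exact: xS|exact: yS|].
by have [? ?] := x0 k; have [? ?] := y0 k; split; [|split; [|split]].
Qed.

End Nested.

(* The form [U dt + V ds] is closed when [U + i V] is holomorphic in [s + i t]:
   both have the same coefficients [a], [b] in their linear approximations. *)
Section Goursat.
Context {R : realType}.
Variables (U V PU PV : R -> R -> R).

Definition cr_approx (S T : R) := exists a b : R, forall e : R, 0 < e ->
  exists2 d : R, 0 < d & forall s t, `|s - S| < d -> `|t - T| < d ->
    `|U s t - (U S T + a * (s - S) - b * (t - T))| <= e * (`|s - S| + `|t - T|) /\
    `|V s t - (V S T + b * (s - S) + a * (t - T))| <= e * (`|s - S| + `|t - T|).

(** The counterclockwise integral of U dt + V ds over the boundary of the rectangle, written with
    primitives: [PU s] in t along vertical sides, [PV t] in s along horizontal ones. *)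
Definition circulation (s0 s1 t0 t1 : R) :=
  (PU s1 t1 - PU s1 t0) - (PU s0 t1 - PU s0 t0)
  - ((PV t1 s1 - PV t1 s0) - (PV t0 s1 - PV t0 s0)).

(** The affine parts have circulation 0, as their explicit primitives Q and P show; each side then
    contributes at most m times its length. *)
Lemma circulation_approx (s0 s1 t0 t1 S T u v a b m : R) :
  s0 <= s1 -> t0 <= t1 ->
  (forall s t, s0 <= s <= s1 -> t0 <= t <= t1 -> is_derive t 1 (PU s) (U s t)) ->
  (forall s t, s0 <= s <= s1 -> t0 <= t <= t1 -> is_derive s 1 (PV t) (V s t)) ->
  (forall s t, s0 <= s <= s1 -> t0 <= t <= t1 ->
    `|U s t - (u + a * (s - S) - b * (t - T))| <= m /\
    `|V s t - (v + b * (s - S) + a * (t - T))| <= m) ->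
  `|circulation s0 s1 t0 t1| <= 2 * m * ((s1 - s0) + (t1 - t0)).
Proof.
move=> s01 t01 hU hV H.
pose Q s := fun t : R => (u + a * (s - S)) * t - b / 2 * (t - T) ^+ 2.
pose P t := fun s : R => (v + a * (t - T)) * s + b / 2 * (s - S) ^+ 2.
have dQ (s t : R) : is_derive t 1 (Q s) (u + a * (s - S) - b * (t - T)).
  rewrite /Q; apply: is_derive_eq.
  by rewrite /GRing.scale /=; field.
have dP (s t : R) : is_derive s 1 (P t) (v + b * (s - S) + a * (t - T)).
  rewrite /P; apply: is_derive_eq.
  by rewrite /GRing.scale /=; field.
have kU (s : R) : s0 <= s <= s1 ->
    `|(PU s t1 - PU s t0) - (Q s t1 - Q s t0)| <= m * (t1 - t0).
  move=> ss; apply: (mean_value_approx t01 (hU s ^~ ss) (fun x _ => dQ s x)) => x xt.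
  by have [] := H s x ss xt.
have kV (t : R) : t0 <= t <= t1 ->
    `|(PV t s1 - PV t s0) - (P t s1 - P t s0)| <= m * (s1 - s0).
  move=> tt; apply: (mean_value_approx s01 (fun s ss => hV s t ss tt)
    (fun x _ => dP x t)) => x xt.
  by have [] := H x t xt tt.
have s0s : s0 <= s0 <= s1 by rewrite lexx.
have s1s : s0 <= s1 <= s1 by rewrite lexx andbT.
have t0t : t0 <= t0 <= t1 by rewrite lexx.
have t1t : t0 <= t1 <= t1 by rewrite lexx andbT.
have := kU _ s0s; have := kU _ s1s; have := kV _ t0t; have := kV _ t1t.
rewrite /circulation /Q /P !ler_norml => /andP[? ?] /andP[? ?] /andP[? ?] /andP[? ?].
by apply/andP; split; nra.
Qed.

(** If the circulation had modulus c > 0, some rectangle of generation k would keep at least c /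
    4^k, whereas differentiability at the common point of these rectangles makes it o(1 / 4^k). *)
Lemma goursat (s0 t0 A B : R) : 0 <= A -> 0 <= B ->
  (forall s t, s0 <= s <= s0 + A -> t0 <= t <= t0 + B ->
     is_derive t 1 (PU s) (U s t)) ->
  (forall s t, s0 <= s <= s0 + A -> t0 <= t <= t0 + B ->
     is_derive s 1 (PV t) (V s t)) ->
  (forall S T, s0 <= S <= s0 + A -> t0 <= T <= t0 + B -> cr_approx S T) ->
  circulation s0 (s0 + A) t0 (t0 + B) = 0.
Proof.
move=> A0 B0 hU hV hcr; apply/eqP/negPn/negP => nz.
pose c : R := `|circulation s0 (s0 + A) t0 (t0 + B)|.
have c0 : 0 < c by rewrite normr_gt0.
pose P k s t :=
  c / 4 ^+ k <= `|circulation s (s + A / 2 ^+ k) t (t + B / 2 ^+ k)|.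
have := @nested_quarters R A B P s0 t0 A0 B0.
case; first by rewrite /P expr0 !divr1.
  move=> k s t; rewrite /P.
  have half (Z : R) : Z / 2 ^+ k = Z / 2 ^+ k.+1 + Z / 2 ^+ k.+1.
    by rewrite exprS; field; rewrite expf_neq0.
  have -> : c / 4 ^+ k = 4 * (c / 4 ^+ k.+1).
    by rewrite exprS; field; rewrite expf_neq0.
  rewrite (half A) (half B).
  set a := A / _; set b := B / _; set e := c / _ => H.
  apply: contrapT => /forallNP N.
  have {}N (i j : bool) : `|circulation (s + i%:R * a) (s + i%:R * a + a)
       (t + j%:R * b) (t + j%:R * b + b)| < e.
    by rewrite ltNge; apply/negP => ?; apply: (N i); exists j.
  have := N true true; have := N true false; have := N false true.
  have := N false false; move: H; rewrite !mul1r !mul0r !addr0 !addrA.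
  rewrite /circulation !ltr_norml.
  move=> H /andP[? ?] /andP[? ?] /andP[? ?] /andP[? ?].
  by move: H; rewrite leNgt => /negP; apply; rewrite ltr_norml; apply/andP; split; lra.
move=> S [T ST].
have [a [b ab]] : cr_approx S T.
  have [s [t [_ ? ? [? [? [? ?]]]]]] := ST 0%N.
  by apply: hcr; lra.
have AB0 : 0 <= A + B by exact: addr_ge0.
(* Twice this tolerance times (A + B)^2 is less than c; the added 1 covers A = B = 0. *)
have e0 : 0 < c / (4 * ((A + B) ^+ 2 + 1)).
  by rewrite divr_gt0 // mulr_gt0 // ltr_wpDl ?sqr_ge0.
have [d d0 {}ab] := ab _ e0.
have [k kd] : exists k : nat, (A + B) / 2 ^+ k < d.
  have := @cvg_geometric R (A + B) 2^-1.
  rewrite ger0_norm ?invr_ge0 // invf_lt1 ?ltr1n // => /(_ isT).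
  move=> /cvgrPdist_lt /(_ d d0) [k _ /(_ k (leqnn k))] /=.
  rewrite sub0r normrN exprVn => /(le_lt_trans (ler_norm _)) ?.
  by exists k.
have [s [t [Pst sS tT [ss [sA [tt tB]]]]]] := ST k.
set p := 2 ^+ k in kd Pst sS tT sA tB *.
have p0 : 0 < p by rewrite exprn_gt0.
have Ap : 0 <= A / p by rewrite divr_ge0 // ltW.
have Bp : 0 <= B / p by rewrite divr_ge0 // ltW.
have kd' : A / p + B / p < d by rewrite -mulrDl.
have sl : s <= s + A / p by rewrite lerDl.
have tl : t <= t + B / p by rewrite lerDl.
have hU' s' t' : s <= s' <= s + A / p -> t <= t' <= t + B / p ->
    is_derive t' 1 (PU s') (U s' t') by move=> ? ?; apply: hU; lra.
have hV' s' t' : s <= s' <= s + A / p -> t <= t' <= t + B / p ->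
    is_derive s' 1 (PV t') (V s' t') by move=> ? ?; apply: hV; lra.
pose m : R := c / (4 * ((A + B) ^+ 2 + 1)) * (A / p + B / p).
have hm s' t' : s <= s' <= s + A / p -> t <= t' <= t + B / p ->
    `|U s' t' - (U S T + a * (s' - S) - b * (t' - T))| <= m /\
    `|V s' t' - (V S T + b * (s' - S) + a * (t' - T))| <= m.
  move=> hs ht.
  have s1 : `|s' - S| <= A / p by rewrite ler_norml; lra.
  have t1 : `|t' - T| <= B / p by rewrite ler_norml; lra.
  have s2 : `|s' - S| < d by lra.
  have t2 : `|t' - T| < d by lra.
  have [H1 H2] := ab s' t' s2 t2.
  by split; [apply: le_trans H1 _|apply: le_trans H2 _];
     (apply: ler_wpM2l; [exact: ltW|exact: lerD]).
have := circulation_approx sl tl hU' hV' hm; rewrite {hm}/m.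
apply/negP; rewrite -ltNge; apply: lt_le_trans Pst.
have -> : s + A / p - s + (t + B / p - t) = (A + B) / p by rewrite mulrDl; ring.
rewrite -mulrDl (_ : 4 ^+ k = p ^+ 2 :> R); last first.
  by rewrite /p -exprM mulnC exprM expr2 -natrM.
have := sqr_ge0 (A + B); move: (A + B) => z q0.
have -> : 2 * (c / (4 * (z ^+ 2 + 1)) * (z / p)) * (z / p) =
   (c / p ^+ 2) * (z ^+ 2 / (2 * (z ^+ 2 + 1))).
  have q1 : z ^+ 2 + 1 != 0 by rewrite gt_eqF // ltr_wpDl.
  by field; rewrite ?q1 ?gt_eqF.
rewrite gtr_pMr ?divr_gt0 ?exprn_gt0 // ltr_pdivrMr; lra.
Qed.

End Goursat.

(** * Estimates for derivatives at the centre of a disc *)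

Section Polar.
Context {R : realType}.
Local Notation C := R[i].

Lemma is_derive_approx (f : R -> R) (x a e : R) : is_derive x 1 f a -> 0 < e ->
  exists2 d : R, 0 < d & forall h, `|h| < d ->
    `|f (x + h) - f x - a * h| <= e * `|h|.
Proof.
move=> [df da] e0.
have : h^-1 *: (f (h *: 1 + x) - f x) @[h --> 0^'] --> a.
  by rewrite -da; exact: df.
move=> /cvgrPdist_le /(_ e e0); rewrite near_withinE => /nbhs_normP[d /= d0 H].
exists d => // h hd.
have [->|h0] := eqVneq h 0.
  by rewrite addr0 subrr mulr0 subrr normr0 mulr0.
have := H h; rewrite /ball_ /= sub0r normrN => /(_ hd h0).
rewrite [h *: 1]mulr1 [_ *: _]mulrC.
rewrite -(@ler_pM2r _ `|h|) ?normr_gt0 // -normrM mulrBl mulfVK //.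
by rewrite distrC (addrC h x).
Qed.

Lemma exp_polar_approx (e : R) : 0 < e -> exists2 d : R, 0 < d &
  forall s t : R, `|s| < d -> `|t| < d ->
    `|expR s * cos t - 1 - s| <= e * (`|s| + `|t|) /\
    `|expR s * sin t - t| <= e * (`|s| + `|t|).
Proof.
move=> e0; pose e1 := Num.min (e / 4) 1.
have e10 : 0 < e1 by rewrite lt_min ltr01 divr_gt0.
have e11 : e1 <= 1 by rewrite ge_min lexx orbT.
have e1e : e1 <= e / 4 by rewrite ge_min lexx.
have [d1 d10 H1] := is_derive_approx (is_derive_expR 0) e10.
have [d2 d20 H2] := is_derive_approx (is_derive_cos 0) e10.
have [d3 d30 H3] := is_derive_approx (is_derive_sin 0) e10.
exists (Num.min (Num.min d1 d2) (Num.min d3 (e1 / 2))).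
  by rewrite !lt_min d10 d20 d30 divr_gt0.
move=> s t; rewrite !lt_min => /andP[/andP[sd1 sd2] /andP[sd3 sd]].
move=> /andP[/andP[td1 td2] /andP[td3 td]].
have := H1 s sd1; rewrite add0r expR0 mul1r => {}H1.
have := H2 t td2; rewrite add0r cos0 sin0 oppr0 mul0r subr0 => {}H2.
have := H3 t td3; rewrite add0r cos0 sin0 subr0 mul1r => {}H3.
have s0 := normr_ge0 s; have t0 := normr_ge0 t.
have E1 : `|expR s - 1| <= 2 * `|s|.
  rewrite -[expR s - 1](subrK s); apply: le_trans (ler_normD _ _) _.
  by apply: le_trans (lerD H1 (lexx _)) _; nra.
have E2 : `|expR s| <= 2.
  rewrite -[expR s](subrK 1); apply: le_trans (ler_normD _ _) _.
  by rewrite normr1; nra.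
split.
- have -> : expR s * cos t - 1 - s = expR s * (cos t - 1) + (expR s - 1 - s).
    by ring.
  apply: le_trans (ler_normD _ _) _; rewrite normrM.
  have : `|expR s| * `|cos t - 1| <= 2 * (e1 * `|t|) by exact: ler_pM.
  by nra.
- have -> : expR s * sin t - t = expR s * (sin t - t) + (expR s - 1) * t.
    by ring.
  apply: le_trans (ler_normD _ _) _; rewrite !normrM.
  have : `|expR s| * `|sin t - t| <= 2 * (e1 * `|t|) by exact: ler_pM.
  have : `|expR s - 1| * `|t| <= e1 * `|t| by rewrite ler_wpM2r //; lra.
  by nra.
Qed.

(** The point r exp (s + i t). In these logarithmic coordinates circles become segments and the
    centre moves to s = - infinity, so that rectangles suffice. *)
Definition polar (r s t : R) : C := (r * expR s * cos t) +i* (r * expR s * sin t).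

Lemma normc_polar r s t : 0 <= r -> normc (polar r s t) = r * expR s.
Proof.
move=> r0; rewrite /polar /=.
have -> : (r * expR s * cos t) ^+ 2 + (r * expR s * sin t) ^+ 2 =
          (r * expR s) ^+ 2 by rewrite !exprMn -mulrDr cos2Dsin2 mulr1.
by rewrite sqrtr_sqr ger0_norm // mulr_ge0 // expR_ge0.
Qed.

Lemma polarD r s t s' t' : polar r (s + s') (t + t') = polar r s t
  + polar r s t * ((expR s' * cos t' - 1) +i* (expR s' * sin t')).
Proof.
rewrite /polar expRD cosD sinD; apply/eqP; rewrite eq_complex /=.
by apply/andP; split; apply/eqP; ring.
Qed.

(** Chain rule for F composed with the exponential, with derivative a w. Half of the error e is
    allotted to the expansion of the exponential (e1), half to that of F (e2). *)
Lemma cr_approx_polar (F : C -> C) r S T a :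
  is_derive (polar r S T) 1 F a ->
  cr_approx (fun s t => complex.Re (F (polar r s t)))
            (fun s t => complex.Im (F (polar r s t))) S T.
Proof.
set w := polar r S T => /is_derive_normcP HF.
exists (complex.Re (a * w)), (complex.Im (a * w)) => e e0.
have aw0 := normc_ge0 (a * w); have w0 := normc_ge0 w.
pose e1 := Num.min 1 (e / (4 * (normc (a * w) + 1))).
have e10 : 0 < e1 by rewrite lt_min ltr01 divr_gt0 // mulr_gt0 // ltr_wpDl.
have e11 : e1 <= 1 by rewrite ge_min lexx.
have e1e : e1 * (4 * (normc (a * w) + 1)) <= e.
  by rewrite -ler_pdivlMr ?mulr_gt0 // ?ltr_wpDl // ge_min lexx orbT.
have [d1 d10 H1] := exp_polar_approx e10.
pose e2 := e / (8 * (normc w + 1)).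
have e20 : 0 < e2 by rewrite divr_gt0 // mulr_gt0 // ltr_wpDl.
have e2e : e2 * (8 * (normc w + 1)) = e.
  by rewrite /e2 mulfVK // gt_eqF // mulr_gt0 // ltr_wpDl.
have [d2 d20 H2] := HF e2 e20.
exists (Num.min d1 (d2 / (8 * (normc w + 1)))).
  by rewrite lt_min d10 divr_gt0 // mulr_gt0 // ltr_wpDl.
move=> s t.
have : T + (t - T) = t by rewrite addrC subrK.
have : S + (s - S) = s by rewrite addrC subrK.
move: (s - S) (t - T) => s' t' <- <- {s t}; move: s' t' => s t.
rewrite !lt_min !ltr_pdivlMr ?mulr_gt0 // ?ltr_wpDl // => /andP[s1 s2] /andP[t1 t2].
have [K1 K2] := H1 s t s1 t1.
rewrite polarD -/w; set k := _ +i* _.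
have s0 := normr_ge0 s; have t0 := normr_ge0 t.
have kst : normc (k - (s +i* t)) <= 2 * (e1 * (`|s| + `|t|)).
  apply: le_trans (_ : `|expR s * cos t - 1 - s| + `|expR s * sin t - t| <= _); last by lra.
  by apply: le_trans (ler_normc_ReIm _) _; rewrite cReB cImB.
have nst : normc (s +i* t) <= `|s| + `|t| by exact: ler_normc_ReIm.
have nk : normc k <= 4 * (`|s| + `|t|).
  rewrite -[k](subrK (s +i* t)); apply: le_trans (ler_normcD _ _) _.
  by nra.
have wk : normc (w * k) <= (normc w + 1) * (4 * (`|s| + `|t|)).
  by rewrite normcM ler_pM ?normc_ge0 // lerDl.
have := H2 (w * k).
have /[swap]/[apply] : normc (w * k) < d2 by apply: le_lt_trans wk _; lra.
move=> H.
have {H} main : normc (F (w + w * k) - F w - (a * w) * (s +i* t)) <= e * (`|s| + `|t|).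
  have -> : F (w + w * k) - F w - a * w * (s +i* t) =
     (F (w + w * k) - F w - a * (w * k)) + (a * w) * (k - (s +i* t)) by ring.
  apply: le_trans (ler_normcD _ _) _; rewrite (normcM (a * w)).
  have A1 : normc (a * w) * normc (k - (s +i* t)) <=
            normc (a * w) * (2 * (e1 * (`|s| + `|t|))) by rewrite ler_wpM2l.
  have A2 : e2 * normc (w * k) <= e2 * ((normc w + 1) * (4 * (`|s| + `|t|))).
    by rewrite ler_wpM2l // ltW.
  have st0 : 0 <= `|s| + `|t| by rewrite addr_ge0.
  have A3 : e2 * ((normc w + 1) * (4 * (`|s| + `|t|))) = e / 2 * (`|s| + `|t|).
    by rewrite -e2e; field.
  have A4 : normc (a * w) * (2 * (e1 * (`|s| + `|t|))) <= e / 2 * (`|s| + `|t|).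
    rewrite (_ : _ * _ = (normc (a * w) * (2 * e1)) * (`|s| + `|t|)); last by ring.
    by rewrite ler_wpM2r //; nra.
  by lra.
have R1 := le_trans (ler_Re_normc _) main.
have I1 := le_trans (ler_Im_normc _) main.
split.
- apply: le_trans R1; rewrite !cReB (cReM (a * w)) /= le_eqVlt.
  by apply/orP; left; apply/eqP; congr `|_|; ring.
- apply: le_trans I1; rewrite !cImB (cImM (a * w)) /= le_eqVlt.
  by apply/orP; left; apply/eqP; congr `|_|; ring.
Qed.

Lemma cr_approx_continuous (U V : R -> R -> R) S T e :
  cr_approx U V S T -> 0 < e -> exists2 d : R, 0 < d &
    forall s t, `|s - S| < d -> `|t - T| < d ->
      `|U s t - U S T| <= e /\ `|V s t - V S T| <= e.
Proof.
move=> [a [b ab]] e0; have [d d0 H] := ab 1 ltr01.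
have c0 : 0 < `|a| + `|b| + 1 by rewrite ltr_wpDl // addr_ge0.
exists (Num.min d (e / (2 * (`|a| + `|b| + 1)))).
  by rewrite lt_min d0 divr_gt0 // mulr_gt0.
move=> s t; rewrite !lt_min !ltr_pdivlMr ?mulr_gt0 //.
move=> /andP[sd se] /andP[td te]; have [H1 H2] := H s t sd td.
have x0 := normr_ge0 (s - S); have y0 := normr_ge0 (t - T).
have bound (p q z m : R) : `|p| = `|a| \/ `|p| = `|b| -> `|q| = `|a| \/ `|q| = `|b| ->
    `|z - (m + p * (s - S) + q * (t - T))| <= 1 * (`|s - S| + `|t - T|) ->
    `|z - m| <= e.
  move=> pab qab zm; have a0 := normr_ge0 a; have b0 := normr_ge0 b.
  have -> : z - m = (z - (m + p * (s - S) + q * (t - T))) +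
    (p * (s - S) + q * (t - T)) by ring.
  apply: le_trans (ler_normD _ _) _; apply: le_trans (lerD zm (ler_normD _ _)) _.
  have pab' : `|p| <= `|a| + `|b| by case: pab => ->; lra.
  have qab' : `|q| <= `|a| + `|b| by case: qab => ->; lra.
  rewrite !normrM; have := ler_wpM2r x0 pab'; have := ler_wpM2r y0 qab'.
  by lra.
split; [apply: (bound a (- b))|apply: (bound b a)]; rewrite ?normrN; try by [left|right].
  by rewrite mulNr.
by [].
Qed.

(* The mean of [Re F] over the circle of radius [r e^s] does not depend on [s]:
   integrate [F (r e^(s + i t))] over the boundary of a rectangle of height 2 pi.
   As [s] tends to minus infinity the mean becomes at least [L]. *)
Lemma circle_Re_le (F : C -> C) (r c L : R) : 0 < r ->
  (forall w, 0 < normc w <= r -> derivable F w 1) ->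
  (forall e, 0 < e -> exists2 d : R, 0 < d & forall w,
      0 < normc w < d -> L - e <= complex.Re (F w)) ->
  (forall w, normc w = r -> complex.Re (F w) <= c) -> L <= c.
Proof.
move=> r0 dF FL Fc; apply/ler_addgt0Pr => e e0.
have [d d0 {}FL] := FL e e0.
(* Far enough to the left: r exp S < d, because exp (r / d) >= 1 + r / d. *)
pose S := - (r / d).
have rd0 : 0 < r / d by exact: divr_gt0.
have S0 : S <= 0 by rewrite oppr_le0 ltW.
have Sd : r * expR S < d.
  rewrite /S expRN -ltr_pdivlMr ?invr_gt0 ?expR_gt0 // invrK mulrC.
  rewrite -ltr_pdivrMr //; apply: lt_le_trans (expR_ge1Dx _).
  by rewrite ltrDr.
pose U s t := complex.Re (F (polar r s t)).
pose V s t := complex.Im (F (polar r s t)).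
have nE s t : normc (polar r s t) = r * expR s by rewrite normc_polar // ltW.
have cr s t : s <= 0 -> cr_approx U V s t.
  move=> s0; apply: cr_approx_polar.
  apply/derivableP/dF; rewrite nE mulr_gt0 ?expR_gt0 //=.
  by rewrite ger_pMr // -[leRHS]expR0 ler_expR.
have pi0 := pi_gt0 R.
have contU (s : R) : s <= 0 -> continuous (U s).
  move=> s0 t; apply/cvgrPdist_le => e' e'0.
  have [d' d'0 H] := cr_approx_continuous (cr s t s0) e'0.
  apply/nbhs_normP; exists d' => // t' /= tt'.
  rewrite distrC in tt'; have [|H' _] := H s t' _ tt'; last by rewrite distrC.
  by rewrite subrr normr0.
(* [continuous_primitive] wants continuity on the whole line, while F is controlled only up to
   radius r, that is for s <= 0; clamping s at 0 extends V continuously. *)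
have contV (t : R) : continuous (fun s : R => V (Num.min s 0) t).
  move=> s; apply/cvgrPdist_le => e' e'0.
  have s0 : Num.min s 0 <= 0 by rewrite ge_min lexx orbT.
  have [d' d'0 H] := cr_approx_continuous (cr _ t s0) e'0.
  apply/nbhs_normP; exists d' => // s' /= ss'.
  rewrite distrC in ss'; have [||_ H'] := H (Num.min s' 0) t; last first.
  - by rewrite distrC.
  - by rewrite subrr normr0.
  apply: le_lt_trans ss'; rewrite !minEle.
  by do 2 case: ifPn; rewrite -?ltNge => h1 h2;
    rewrite ler_norml; have := ler_norm (s' - s); have := ler_norm (s - s');
    rewrite (distrC s s') => ? ?; apply/andP; split; lra.
have /choice[PU hPU] : forall s, exists P : R -> R, forall t, 0 <= t <= 0 + 2 * pi ->
    is_derive t 1 P (U (Num.min s 0) t).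
  move=> s; apply: continuous_primitive; apply: contU.
  by rewrite ge_min lexx orbT.
have /choice[PV hPV] : forall t, exists P : R -> R, forall s, S <= s <= S + - S ->
    is_derive s 1 P (V (Num.min s 0) t).
  by move=> t; exact: continuous_primitive.
have SS : S + - S = 0 by rewrite subrr.
have hU s t : S <= s <= S + - S -> 0 <= t <= 0 + 2 * pi ->
    is_derive t 1 (PU s) (U s t).
  rewrite SS => /andP[_ s0] tt; have := hPU s t tt.
  by rewrite min_l.
have hV s t : S <= s <= S + - S -> 0 <= t <= 0 + 2 * pi ->
    is_derive s 1 (PV t) (V s t).
  move=> ss tt; have := hPV t s ss.
  by move: ss; rewrite SS => /andP[_ s0]; rewrite min_l.
have pp : 0 <= 2 * pi :> R by rewrite mulr_ge0 // ltW.
have NS : 0 <= - S by rewrite oppr_ge0.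
have := @goursat R U V PU PV S 0 (- S) (2 * pi) NS pp hU hV.
rewrite /circulation SS add0r.
have crS s t : S <= s <= 0 -> 0 <= t <= 2 * pi -> cr_approx U V s t.
  by move=> /andP[_ s0] _; exact: cr.
move=> /(_ crS).
have per s : V s (2 * pi) = V s 0.
  by rewrite /V /polar mulr_natl cos2pi sin2pi cos0 sin0.
have hVt t : 0 <= t <= 2 * pi -> forall s, S <= s <= 0 ->
    is_derive s 1 (PV t) (V s t).
  by move=> tt s ss; apply: hV; rewrite ?SS ?add0r.
have p0 : 0 <= (0 : R) <= 2 * pi by rewrite lexx.
have p2 : 0 <= 2 * (pi : R) <= 2 * (pi : R).
  by apply/andP; split.
(* The horizontal sides cancel because V has period 2 pi in t. *)
have -> : PV (2 * pi) 0 - PV (2 * pi) S = PV 0 0 - PV 0 S.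
  apply/eqP; rewrite -subr_eq0 -normr_le0 -[leRHS](mul0r (0 - S)).
  apply: (mean_value_approx S0 (hVt _ p2) (hVt _ p0)) => x xS.
  by rewrite per subrr normr0.
rewrite subrr subr0 => /eqP; rewrite subr_eq0 => /eqP E.
have hUs s : S <= s <= 0 -> forall t, 0 <= t <= 2 * pi ->
    is_derive t 1 (PU s) (U s t).
  by move=> ss t tt; apply: hU; rewrite ?SS ?add0r.
have SS0 : S <= S <= 0 by rewrite lexx.
have S00 : S <= (0 : R) <= 0 by rewrite S0 lexx.
have H1 : PU 0 (2 * pi) - PU 0 0 <= c * (2 * pi - 0).
  apply: (mean_value_le pp (hUs _ S00)) => x x2.
  by apply: Fc; rewrite nE expR0 mulr1.
have H2 : (L - e) * (2 * pi - 0) <= PU S (2 * pi) - PU S 0.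
  apply: (mean_value_ge pp (hUs _ SS0)) => x x2.
  by apply: FL; rewrite nE Sd mulr_gt0 ?expR_gt0.
rewrite -lerBlDr -(@ler_pM2r _ (2 * pi - 0)) ?subr0 ?mulr_gt0 //.
by rewrite !subr0 in H1 H2; apply: le_trans H2 _; rewrite -E.
Qed.

End Polar.

Section DiscEstimates.
Context {R : realType}.
Local Notation C := R[i].
Implicit Types (f g G : C -> C) (a b w : C).

Lemma is_derive_bounded_slope g a : is_derive (0 : C) 1 g a ->
  exists2 d : R, 0 < d & forall w, normc w < d ->
    normc (g w - g 0) <= (normc a + 1) * normc w.
Proof.
move=> /is_derive_normcP /(_ 1 ltr01) [d d0 H]; exists d => // w wd.
have := H w wd; rewrite add0r => {}H.
rewrite -[g w - g 0](subrK (a * w)); apply: le_trans (ler_normcD _ _) _.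
by rewrite normcM mulrDl mul1r addrC lerD2l; move: H; rewrite mul1r.
Qed.

(** The difference quotient of g tends to a at the centre, so [circle_Re_le] applies with L = Re (G
    0 + a) without extending the quotient to 0. This admits pole terms in the test functions
    below. *)
Lemma circle_Re_le_quotient G g a (r c : R) : 0 < r ->
  (forall w, normc w <= r -> derivable G w 1) ->
  (forall w, normc w <= r -> derivable g w 1) -> is_derive (0 : C) 1 g a ->
  (forall w, normc w = r -> complex.Re (G w + w^-1 * (g w - g 0)) <= c) ->
  complex.Re (G 0 + a) <= c.
Proof.
move=> r0 dG dg ga H.
apply: (@circle_Re_le R (fun w => G w + w^-1 * (g w - g 0)) r c _ r0 _ _ H).
- move=> w /andP[w0 wr].
  have w00 : w != 0 by rewrite -normc_gt0.
  have h1 := is_derive_invc (is_derive_idc w) w00.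
  have h2 := is_derive_addc (derivableP (dg w wr)) (is_derive_cstc w (- g 0)).
  exact (@ex_derive _ _ _ _ _ _ _ (is_derive_addc (derivableP (dG w wr)) (is_derive_mulc h1 h2))).
- move=> e e0.
  have r00 : normc (0 : C) <= r by rewrite normc0 ltW.
  have [d1 d10 H1] := is_derive_bounded_slope (derivableP (dG 0 r00)).
  have /is_derive_normcP/(_ (e / 2)) [|d2 d20 H2] := ga; first by rewrite divr_gt0.
  set A := normc _ + 1 in H1.
  have A0 : 0 < A by rewrite ltr_wpDl ?normc_ge0.
  exists (Num.min (Num.min d1 d2) (e / (2 * A))).
    by rewrite !lt_min d10 d20 divr_gt0 // mulr_gt0.
  move=> w; rewrite !lt_min ltr_pdivlMr ?mulr_gt0 //.
  move=> /andP[w0 /andP[/andP[w1 w2] w3]].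
  have {}H1 := H1 w w1; have := H2 w w2; rewrite add0r => {}H2.
  have wn0 : w != 0 by rewrite -normc_gt0.
  have E : normc (w^-1 * (g w - g 0) - a) <= e / 2.
    rewrite -(ler_pM2r w0) -normcM mulrBl mulrAC mulVf // mul1r.
    by [].
  rewrite lerBlDl -lerBlDr -cReB.
  apply: le_trans (ler_norm _) _; apply: le_trans (ler_Re_normc _) _.
  rewrite (_ : _ - _ = (G 0 - G w) + (a - w^-1 * (g w - g 0))); last by ring.
  apply: le_trans (ler_normcD _ _) _; rewrite normcB (normcB a).
  by lra.
Qed.

(** Circle estimates need holomorphy on a closed disc; they are made for radii s < r and passed to
    the limit here. *)
Lemma le_limit_radius (A B r : R) : 0 < r -> 0 <= A ->
  (forall s, 0 < s < r -> A * s <= B) -> A * r <= B.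
Proof.
move=> r0 A0 H; rewrite leNgt; apply/negP => BA.
have Ap : 0 < A.
  rewrite lt0r A0 andbT; apply/eqP => A00.
  have := H (r / 2); rewrite divr_gt0 // => /(_ _).
  by move: BA; rewrite A00 !mul0r => B0 /(_ (ltac:(lra))); lra.
have h2 : B <= A * r / 2 \/ A * r / 2 < B by case: (leP B (A * r / 2)); [left|right].
(* A radius strictly between B / A and r; the maximum with r / 2 keeps it positive when B is
   negative. *)
have := H (Num.max (r / 2) ((B / A + r) / 2)).
have BAr : B / A < r by rewrite ltr_pdivrMr // mulrC.
rewrite lt_max divr_gt0 //= gt_max => /(_ _) K.
have {K} : A * Num.max (r / 2) ((B / A + r) / 2) <= B by apply: K; apply/andP; split; lra.
rewrite mulrC -ler_pdivlMr // ge_max => /andP[_]; lra.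
Qed.

(* A half-plane map: [Re g (1 + cos) <= 0] on the circle is the real part of
   [g (2 + k w / r) + k^* r (g - g 0) / w + (g 0)^* k w / r]. *)
Lemma half_plane_derive_le g a (r : R) : 0 < r ->
  (forall w, normc w < r -> derivable g w 1) ->
  (forall w, normc w < r -> complex.Re (g w) <= 0) ->
  is_derive (0 : C) 1 g a -> r * normc a <= - 2 * complex.Re (g 0).
Proof.
move=> r0 dg Rg ga.
have [->|a0] := eqVneq a 0.
  rewrite normc0 mulr0 mulNr oppr_ge0 pmulr_rle0 //.
  by apply: Rg; rewrite normc0.
have na0 : 0 < normc a by rewrite normc_gt0.
rewrite mulrC; apply: le_limit_radius => //; first exact: ltW.
move=> s /andP[s0 sr].
(* The rotation that turns a onto the positive axis, so that the real part at the centre sees all of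
   |a|. *)
have [k ka nk] : exists2 k : C, k^*%C * a = (normc a)%:C & normc k = 1.
  exists (a / (normc a)%:C).
    rewrite cjM conjc_inv conjc_real mulrAC (mulrC a^*%C) mulcc_sqmod.
    by rewrite -normc_sqr expr2 realcM mulfK // realc_eq0 gt_eqF.
  by rewrite normcM normcV normc_real ger0_norm ?(ltW na0) // divff // gt_eqF.
pose G w := g w * (2 + (k / s%:C) * w) + ((g 0)^*%C * (k / s%:C)) * w.
pose h w := (k^*%C * s%:C) * g w.
have s00 : s%:C != 0 by rewrite realc_eq0 gt_eqF.
have := @circle_Re_le_quotient G h ((k^*%C * s%:C) * a) s 0 s0.
have -> : complex.Re (G 0 + k^*%C * s%:C * a) = 2 * complex.Re (g 0) + normc a * s.
  rewrite /G !mulr0 !addr0 mulrAC ka -realcM cReD; congr (_ + _).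
  by rewrite mulr_natr mulr2n cReD mulr_natl mulr2n.
move=> H; have {H} : 2 * complex.Re (g 0) + normc a * s <= 0.
  apply: H.
  - move=> w ws; have gw := derivableP (dg w (le_lt_trans ws sr)).
    have lin (b : C) := is_derive_scalec b (is_derive_idc w).
    exact (@ex_derive _ _ _ _ _ _ _ (is_derive_addc (is_derive_mulc gw
      (is_derive_addc (is_derive_cstc w 2) (lin _))) (lin _))).
  - move=> w ws; have gw := derivableP (dg w (le_lt_trans ws sr)).
    exact (@ex_derive _ _ _ _ _ _ _ (is_derive_scalec _ gw)).
  - move=> w ws.
    have wn0 : w != 0 by rewrite -normc_gt0 ws.
    (* On the circle the pole term thus supplies the conjugate of u = k w / s. *)
    have wV : w^-1 = w^*%C / (s%:C ^+ 2).
      apply: (mulfI wn0); rewrite mulfV // mulrA mulcc_sqmod -normc_sqr ws.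
      by rewrite expr2 realcM -expr2 divff // expf_neq0.
    pose u := k / s%:C * w.
    have uJ : u^*%C = k^*%C / s%:C * w^*%C.
      by rewrite /u !cjM conjc_inv conjc_real.
    (* The last difference is purely imaginary, and 2 + u + u^* = 2 (1 + Re u) is nonnegative since
       |u| = 1. *)
    have -> : G w + w^-1 * (h w - h 0) =
        g w * (2 + (u + u^*%C)) + ((g 0)^*%C * u - ((g 0)^*%C * u)^*%C).
      rewrite /G /h wV cjM conjcK uJ -(mulrA (g 0)^*%C) -/u -mulrBr.
      have -> : w^*%C / s%:C ^+ 2 * (k^*%C * s%:C * (g w - g 0)) =
        k^*%C / s%:C * w^*%C * (g w - g 0) by field.
      by ring.
    rewrite cReD [X in _ + X]cReB; case: ((g 0)^*%C * u) => p q /=.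
    rewrite subrr addr0 cReM.
    have nu : normc u = 1.
      rewrite /u !normcM normcV normc_real ws nk ger0_norm ?(ltW s0) // mul1r.
      by rewrite mulVf // gt_eqF.
    have := ler_Re_normc u; rewrite nu ler_norml => /andP[u1 u2].
    have := Rg w; rewrite ws => /(_ sr).
    case: u {nu uJ} u1 u2 => u v /= u1 u2.
    rewrite !addrN !addr0 mulr0 subr0 => gw.
    by nra.
by lra.
Qed.

(** The half plane estimate for g - M. The factor 4 is not sharp, but this bound only serves crude
    estimates during localization. *)
Lemma cauchy_derive_le g a (r M : R) : 0 < r ->
  (forall w, normc w < r -> derivable g w 1) ->
  (forall w, normc w < r -> normc (g w) <= M) ->
  is_derive (0 : C) 1 g a -> r * normc a <= 4 * M.
Proof.
move=> r0 dg gM ga.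
have := @half_plane_derive_le (fun w => g w + (- M)%:C) a r r0.
have bR w : normc w < r -> `|complex.Re (g w)| <= M.
  by move=> wr; apply: le_trans (ler_Re_normc _) (gM w wr).
move=> H; apply: le_trans (H _ _ _) _.
- move=> w wr.
  exact (@ex_derive _ _ _ _ _ _ _ (is_derive_addc (derivableP (dg w wr)) (is_derive_cstc w _))).
- move=> w wr; rewrite cReD /=.
  by have := bR w wr; rewrite ler_norml => /andP[]; lra.
- by rewrite -[a]addr0; exact (is_derive_addc ga (is_derive_cstc 0 _)).
- rewrite cReD /=; have := bR 0; rewrite normc0 => /(_ r0).
  by rewrite ler_norml => /andP[]; lra.
Qed.

(* Pointwise [2 r Re (a_j^* e^(- i t) g_j) <= |g_j|^2 + r^2 |a_j|^2], and the left
   hand side is, up to a null mean, the real part of a function holomorphic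
   outside 0 with value [2 r^2 |a_j|^2] there. *)
Lemma paraboloid_derive_le n f (g : 'I_n -> C -> C) (a : 'I_n -> C)
    (k c r : R) : 0 < r -> 0 <= k ->
  (forall w, normc w < r -> derivable f w 1) ->
  (forall j w, normc w < r -> derivable (g j) w 1) ->
  (forall j, is_derive (0 : C) 1 (g j) (a j)) ->
  (forall w, normc w < r ->
    complex.Re (f w) + k * \sum_j sqmod (g j w) <= c) ->
  k * (r ^+ 2 * \sum_j sqmod (a j)) <= c - complex.Re (f 0).
Proof.
move=> r0 k0 df dg ga H.
have S0 : 0 <= \sum_j sqmod (a j) by apply: sumr_ge0 => j _; exact: sqmod_ge0.
(* The square of r is reached as a product of two radii s and t, each by its own passage to the
   limit; the estimate at [Num.max s t] covers both. *)
suff main s : 0 < s < r -> k * (s ^+ 2 * \sum_j sqmod (a j)) <= c - complex.Re (f 0).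
  have -> : k * (r ^+ 2 * \sum_j sqmod (a j)) = (k * \sum_j sqmod (a j)) * r * r.
    by ring.
  have kS : 0 <= k * \sum_j sqmod (a j) by exact: mulr_ge0.
  apply: le_limit_radius => //; first by rewrite mulr_ge0 // ltW.
  move=> s /andP[s0 sr]; rewrite mulrAC; apply: le_limit_radius => //.
    by rewrite mulr_ge0 // ltW.
  move=> t /andP[t0 tr].
  apply: le_trans (main (Num.max s t) _); last by rewrite lt_max s0 gt_max sr.
  have -> : k * (\sum_j sqmod (a j)) * s * t = (k * \sum_j sqmod (a j)) * (s * t).
    by ring.
  rewrite (mulrC (Num.max s t ^+ 2)) [leRHS]mulrA ler_wpM2l // expr2.
  by rewrite ler_pM ?(ltW s0) ?(ltW t0) // le_max lexx ?orbT.
move=> /andP[s0 sr].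
pose K : C := (2 * k)%:C.
pose G w := f w + (K * \sum_j a j * (g j 0)^*%C) * w.
pose h w := \sum_j (K * (s ^+ 2)%:C * (a j)^*%C) * g j w.
have s00 : s%:C != 0 by rewrite realc_eq0 gt_eqF.
(* The value at the centre contains k s^2 sum |a_j|^2 twice, the bound on the circle only once; the
   difference is the claim. *)
have := @circle_Re_le_quotient G h (\sum_j (K * (s ^+ 2)%:C * (a j)^*%C) * a j) s
  (c + k * (s ^+ 2 * \sum_j sqmod (a j))) s0.
have -> : complex.Re (G 0 + \sum_j (K * (s ^+ 2)%:C * (a j)^*%C) * a j) =
    complex.Re (f 0) + 2 * (k * (s ^+ 2 * \sum_j sqmod (a j))).
  rewrite /G mulr0 addr0 cReD; congr (_ + _).
  rewrite cRe_sum (eq_bigr (fun j => (2 * k * s ^+ 2) * sqmod (a j))).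
    by rewrite -mulr_sumr; ring.
  move=> j _; rewrite -mulrA (mulrC (a j)^*%C) mulcc_sqmod -!realcM //.
pose cj j : C := K * (s ^+ 2)%:C * (a j)^*%C.
have dh w (b : 'I_n -> C) : (forall j, is_derive w 1 (g j) (b j)) ->
    is_derive w 1 h (\sum_j cj j * b j).
  move=> gb; exact: (@is_derive_sumc R _ (index_enum 'I_n) xpredT
    (fun j z => cj j * g j z) _ w (fun j _ => is_derive_scalec (cj j) (gb j))).
have ha := dh 0 a ga.
move=> circ.
have {circ} : complex.Re (f 0) + 2 * (k * (s ^+ 2 * \sum_j sqmod (a j))) <=
    c + k * (s ^+ 2 * \sum_j sqmod (a j)).
  apply: (circ _ _ ha).
  - move=> w ws; have fw := derivableP (df w (le_lt_trans ws sr)).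
    exact (@ex_derive _ _ _ _ _ _ _ (is_derive_addc fw
      (is_derive_scalec _ (is_derive_idc w)))).
  - move=> w ws; exact (@ex_derive _ _ _ _ _ _ _ (dh w _
      (fun j => derivableP (dg j w (le_lt_trans ws sr))))).
  - move=> w ws.
    have wn0 : w != 0 by rewrite -normc_gt0 ws.
    have wV : w^-1 = w^*%C / (s%:C ^+ 2).
      apply: (mulfI wn0); rewrite mulfV // mulrA mulcc_sqmod -normc_sqr ws.
      by rewrite expr2 realcM -expr2 divff // expf_neq0.
    have -> : G w + w^-1 * (h w - h 0) = f w + K * \sum_j
      ((a j * w)^*%C * g j w + (a j * w * (g j 0)^*%C - (a j * w * (g j 0)^*%C)^*%C)).
      rewrite /G /h -sumrB !mulr_sumr !mulr_suml -addrA -big_split /=.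
      congr (_ + _); apply: eq_bigr => j _.
      rewrite !cjM conjcK wV expr2 realcM; field.
      by [].
    rewrite cReD cRe_realM cRe_sum.
    apply: le_trans (_ : complex.Re (f w) + k * (\sum_j sqmod (g j w) +
      s ^+ 2 * \sum_j sqmod (a j)) <= _).
      rewrite lerD2l (mulrC 2) -mulrA ler_wpM2l // !mulr_sumr -big_split /=.
      apply: ler_sum => j _.
      rewrite cReD cReB cRe_cj subrr addr0.
      have -> : s ^+ 2 * sqmod (a j) = sqmod (a j * w).
        by rewrite -!normc_sqr normcM ws exprMn mulrC.
      case: (a j * w) (g j w) => [x y] [x' y']; rewrite /sqmod /=.
      by have := sqr_ge0 (x - x'); have := sqr_ge0 (y - y'); nra.
    rewrite mulrDr addrA lerD2r; apply: H; rewrite ws; exact: sr.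
by lra.
Qed.

End DiscEstimates.

(** * Localization of discs *)

Section RowVectors.
Context {R : realType} {m : nat}.
Local Notation C := R[i].
Local Notation V := 'rV[R[i]]_m.

Lemma nbhs_rVP (z : V) (P : V -> Prop) : (\forall x \near z, P x) <->
  exists2 d : R, 0 < d &
    forall x : V, (forall j, normc (x 0 j - z 0 j) < d) -> P x.
Proof.
split.
- move=> /nbhs_ballP[d /= d0 H]; exists (complex.Re d).
    by move: d0; rewrite ltcE /= => /andP[].
  move=> x xz; apply: H; split=> // i j; rewrite (ord1 i) -ball_normE /ball_ /= distrC cnormE.
  by rewrite ltcE /=; move: d0; rewrite ltcE /= => /andP[-> _] /=; exact: xz.
- move=> [d d0 H]; apply/nbhs_ballP; exists d%:C; rewrite /= ?ltcR //.
  move=> x [_ zx]; apply: H => j; have := zx 0 j.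
  by rewrite -ball_normE /ball_ /= distrC cnormE ltcR.
Qed.

Lemma derivable_rV_coord (f : C -> V) (w : C) j : derivable f w 1 ->
  is_derive w 1 (fun z => f z 0 j) (derive1 f w 0 j).
Proof.
move=> df.
have K : h^-1 *: (f (h *: 1 + w) 0 j - f w 0 j) @[h --> 0^'] --> derive1 f w 0 j.
  have := cvg_comp (fun h : C => h^-1 *: (f (h *: 1 + w) - f w))
    (fun M : V => M 0 j) df (@coord_continuous _ _ _ 0 j _).
  rewrite derive1E /derive /= => H; apply: cvg_trans H.
  by apply: near_eq_cvg; near=> h; rewrite /= !mxE.
by split; [apply/cvg_ex; exists (derive1 f w 0 j)|exact: cvg_lim].
Unshelve. all: by end_near. Qed.

Lemma is_derive_rV (f : C -> V) (w : C) (a : V) :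
  (forall j, is_derive w 1 (fun z => f z 0 j) (a 0 j)) ->
  derivable f w 1 /\ derive1 f w = a.
Proof.
move=> H.
have K : h^-1 *: (f (h *: 1 + w) - f w) @[h --> 0^'] --> a.
  move=> A /nbhs_rVP [d d0 HA].
  have /choice[e He] j : exists e : R, 0 < e /\ forall h : C, 0 < normc h < e ->
      normc ((h^-1 *: (f (h *: 1 + w) - f w)) 0 j - a 0 j) < d.
    have d2 : 0 < d / 2 by exact: divr_gt0.
    have /is_derive_normcP/(_ _ d2)[e e0 He] := H j.
    exists e; split=> // h /andP[h0 he].
    rewrite !mxE -(ltr_pM2r h0) -normcM mulrBl mulrAC mulVf -?normc_gt0 // mul1r.
    rewrite [h *: 1]mulr1 (addrC h); apply: le_lt_trans (He h he) _.
    by rewrite ltr_pM2r //; lra.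
  pose e0 := \big[Num.min/1]_j e j.
  have e00 : 0 < e0.
    by rewrite /e0; elim/big_ind: _ => // [x y x0 y0|j _];
      [rewrite lt_min x0|case: (He j)].
  have e0e j : e0 <= e j by rewrite /e0 (bigD1 j) //= ge_min lexx.
  suff : \forall h \near 0^', A (h^-1 *: (f (h *: 1 + w) - f w)) by [].
  rewrite near_withinE; apply/nbhs_normcP; exists e0 => // h hd.
  rewrite add0r => h0; apply: HA => j; apply: (He j).2.
  by rewrite normc_gt0 h0 (lt_le_trans hd).
by split; [apply/cvg_ex; exists a|rewrite derive1E; exact: cvg_lim].
Qed.

Definition sqnorm (z : V) : R := \sum_j sqmod (z 0 j).

Lemma sqnorm_ge0 (z : V) : 0 <= sqnorm z.
Proof. by apply: sumr_ge0 => j _; exact: sqmod_ge0. Qed.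

Lemma sqmod_le_sqnorm (z : V) j : sqmod (z 0 j) <= sqnorm z.
Proof.
rewrite /sqnorm (bigD1 j) //= lerDl.
by apply: sumr_ge0 => i _; exact: sqmod_ge0.
Qed.

Lemma bounded_set_normc (D : set V) : bounded_set D ->
  exists2 M : R, 0 < M & forall z, D z -> forall j, normc (z 0 j) <= M.
Proof.
move=> [M [Mr HM]].
exists (`|complex.Re M| + 2); first by rewrite ltr_wpDl.
move=> z Dz j.
have MM : M < (`|complex.Re M| + 1)%:C.
  have ME : M = (complex.Re M)%:C by rewrite RRe_real.
  by rewrite {1}ME ltcR (le_lt_trans (ler_norm _)) // ltrDl.
have zM : ball_ (fun x : V => `|x|) 0 (`|complex.Re M| + 2)%:C z.
  rewrite /ball_ /= sub0r normrN; apply: le_lt_trans (HM _ MM z Dz) _.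
  by rewrite ltcR ltrD2l (ltr_nat _ 1 2).
move: zM; rewrite -mx_norm_ball => -[_ /(_ 0 j)].
by rewrite -ball_normE /ball_ /= mxE sub0r normrN cnormE ltcR => /ltW.
Qed.

End RowVectors.

Section Segments.
Context {R : realType}.
Local Notation C := R[i].

Lemma is_derive_from_approx (f : R -> R) (x a : R) :
  (forall e : R, 0 < e -> exists2 d : R, 0 < d & forall h, `|h| < d ->
    `|f (x + h) - f x - a * h| <= e * `|h|) -> is_derive x 1 f a.
Proof.
move=> H.
have K : h^-1 *: (f (h *: 1 + x) - f x) @[h --> 0^'] --> a.
  apply/cvgrPdist_le => e e0; have [d d0 {}H] := H _ e0.
  rewrite near_withinE; apply/nbhs_normP; exists d => // h.
  rewrite /ball_ /= sub0r normrN => hd h0.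
  rewrite -(@ler_pM2r _ `|h|) ?normr_gt0 // -normrM mulrBl.
  rewrite [h *: 1]mulr1 [h^-1 *: _]mulrC mulfVK //.
  by have := H h hd; rewrite (addrC x) distrC.
by split; [apply/cvg_ex; exists a|exact: cvg_lim].
Qed.

Lemma is_derive_Re_line (g : C -> C) (w h a : C) (t : R) :
  is_derive (w + t%:C * h) 1 g a ->
  is_derive t 1 (fun s : R => complex.Re (g (w + s%:C * h))) (complex.Re (a * h)).
Proof.
move=> /is_derive_normcP ga; apply: is_derive_from_approx => e e0.
have h1 : 0 < normc h + 1 by rewrite ltr_wpDl ?normc_ge0.
have [d d0 H] := ga _ (divr_gt0 e0 h1).
exists (d / (normc h + 1)); first exact: divr_gt0.
move=> s; rewrite ltr_pdivlMr // => sd.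
have nsh : normc (s%:C * h) = `|s| * normc h by rewrite normcM normc_real.
have shd : normc (s%:C * h) < d.
  by rewrite nsh; apply: le_lt_trans sd; rewrite ler_wpM2l // lerDl.
have -> : w + (t + s)%:C * h = w + t%:C * h + s%:C * h.
  by rewrite rmorphD mulrDl addrA.
rewrite -cReB (_ : complex.Re (a * h) * s = complex.Re (a * (s%:C * h))); last first.
  by rewrite mulrCA cRe_realM mulrC.
rewrite -cReB; apply: le_trans (ler_Re_normc _) _; apply: le_trans (H _ shd) _.
rewrite nsh (_ : _ * _ = e * `|s| * (normc h / (normc h + 1))); last by ring.
rewrite ler_piMr ?mulr_ge0 ?(ltW e0) // ler_pdivrMr // mul1r lerDl.
exact: ler01.
Qed.

(** The real mean value theorem is applied to the real and the imaginary part separately (k = 1 and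
    k = - i), hence the factor 2. *)
Lemma segment_normc_le (g g' : C -> C) (w h : C) (c : R) :
  (forall t : R, 0 <= t <= 1 ->
    is_derive (w + t%:C * h) 1 g (g' (w + t%:C * h))) ->
  (forall t : R, 0 <= t <= 1 -> normc (g' (w + t%:C * h)) <= c) ->
  normc (g (w + h) - g w) <= 2 * (c * normc h).
Proof.
move=> dg gc.
have part (k : C) : normc k = 1 ->
    `|complex.Re (k * (g (w + h) - g w))| <= c * normc h.
  move=> k1.
  have d (t : R) : 0 <= t <= 1 -> is_derive t 1
      (fun s : R => complex.Re (k * g (w + s%:C * h)))
      (complex.Re (k * g' (w + t%:C * h) * h)).
    move=> tt; apply: (is_derive_Re_line (g := fun z => k * g z)).
    exact: is_derive_scalec (dg t tt).
  have b (t : R) : 0 <= t <= 1 -> `|complex.Re (k * g' (w + t%:C * h) * h)| <= c * normc h.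
    move=> tt; apply: le_trans (ler_Re_normc _) _.
    by rewrite !normcM k1 mul1r ler_wpM2r ?normc_ge0 //; exact: gc.
  have -> : complex.Re (k * (g (w + h) - g w)) =
    complex.Re (k * g (w + 1%:C * h)) - complex.Re (k * g (w + 0%:C * h)).
    by rewrite -cReB -mulrBr !mul1r mul0r addr0.
  have m1 := @mean_value_ge R _ _ 0 1 (- (c * normc h)) ler01 d.
  have m2 := @mean_value_le R _ _ 0 1 (c * normc h) ler01 d.
  rewrite subr0 !mulr1 in m1 m2; rewrite ler_norml; apply/andP; split.
    by apply: m1 => t /b; rewrite ler_norml => /andP[].
  by apply: m2 => t /b; rewrite ler_norml => /andP[].
apply: le_trans (ler_normc_ReIm _) _.
have -> : 2 * (c * normc h) = c * normc h + c * normc h by ring.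
apply: lerD; first by have := part 1; rewrite mul1r normc1; apply.
have n1 : normc (0 +i* (-1) : C) = 1.
  by rewrite /= expr0n add0r sqrrN expr1n sqrtr1.
by have := part _ n1; case: (g (w + h) - g w) => x y /=; rewrite mul0r mulN1r opprK add0r.
Qed.

(** The product of u with exp (- c t) has nonpositive derivative. *)
Lemma gronwall_le (u u' : R -> R) (c s : R) : 0 <= s -> 0 <= c ->
  (forall t, 0 <= t <= s -> is_derive t 1 u (u' t)) ->
  (forall t, 0 <= t <= s -> u' t <= c * u t) ->
  u s <= u 0 * expR (c * s).
Proof.
move=> s0 c0 du uc.
have d (t : R) : 0 <= t <= s -> is_derive t 1 (fun x => u x * expR (- c * x))
    (expR (- c * t) * (u' t - c * u t)).
  move=> tt; have ut := du t tt.
  have et : is_derive t 1 (fun x : R => expR (- c * x)) (expR (- c * t) * - c).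
    have lin : is_derive t 1 (fun x : R => - c * x) (- c * 1).
      exact: (@is_deriveZ R R R id (- c) t 1 1 (is_derive_id t 1)).
    have := @is_derive1_comp R expR (fun x => - c * x) t _ _ (is_derive_expR _) lin.
    by rewrite mulr1.
  have := is_deriveM ut et; rewrite /GRing.scale /= => H.
  apply: is_derive_eq H _ ; ring.
have := mean_value_le s0 d; move=> /(_ 0) H.
have : u s * expR (- c * s) - u 0 * expR (- c * 0) <= 0 * (s - 0).
  apply: H => t tt; rewrite pmulr_rle0 ?expR_gt0 // subr_le0; exact: uc.
rewrite mul0r mulr0 expR0 mulr1 subr_le0 mulNr expRN.
by rewrite ler_pdivrMr ?expR_gt0.
Qed.

End Segments.

(** * Discs centred near 0 stay near 0 on smaller discs *)

Section Localization.
Context {R : realType} {n : nat}.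
Local Notation C := R[i].
Local Notation V := 'rV[R[i]]_n.+1.

Lemma sqnorm_split (z : V) : sqnorm z = sqmod (z 0 ord0) + sqtan z.
Proof. by rewrite /sqnorm (bigD1 ord0). Qed.

Lemma sqtan_ge0 (z : V) : 0 <= sqtan z.
Proof. by apply: sumr_ge0 => j _; exact: sqmod_ge0. Qed.

Lemma sqtan_le_sqnorm (z : V) : sqtan z <= sqnorm z.
Proof. by rewrite sqnorm_split lerDr sqmod_ge0. Qed.

Lemma holo_discP (D : set V) (f : C -> V) (w : C) : holo_disc D f ->
  normc w < 1 -> D (f w) /\
  forall j, is_derive w 1 (fun z => f z 0 j) (derive1 f w 0 j).
Proof.
move=> hf w1; have [|df Df] := hf w; first by rewrite cnormE -[1]/(1%:C) ltcR.
by split=> // j; exact: derivable_rV_coord.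
Qed.

Lemma holo_disc_derive_le (D : set V) (M : R) (f : C -> V) (w : C) (r : R) j :
  (forall z, D z -> forall j, normc (z 0 j) <= M) -> holo_disc D f ->
  0 < r -> normc w + r <= 1 -> normc (derive1 f w 0 j) <= 4 * M / r.
Proof.
move=> DM hf r0 wr.
rewrite ler_pdivlMr // mulrC.
have inD z : normc z < r -> normc (w + 1 * z) < 1.
  move=> zr; apply: le_lt_trans (ler_normcD _ _) _; rewrite mul1r.
  by apply: lt_le_trans wr; rewrite ltrD2l.
apply: (@cauchy_derive_le R (fun z => f (w + 1 * z) 0 j)) => //.
- move=> z /inD /(holo_discP hf)[_ /(_ j) H].
  exact (@ex_derive _ _ _ _ _ _ _ (is_derive_affine (f := fun z => f z 0 j) H)).
- by move=> z /inD /(holo_discP hf)[/DM].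
- have w1 : normc (w + 1 * 0) < 1 by apply: inD; rewrite normc0.
  have [_ /(_ j) H] := holo_discP hf w1.
  have := is_derive_affine (f := fun z => f z 0 j) H.
  by rewrite mul1r mulr0 addr0.
Qed.

(** Continuity method: at the infimum t of the times where G >= b there are values at least b at or
    just after t and values at most a at or just before t, against continuity of G at t. *)
Lemma first_exit (G : R -> R) (a b : R) :
  (forall t, 0 <= t <= 1 -> forall e, 0 < e -> exists2 d : R, 0 < d &
     forall s, 0 <= s <= 1 -> `|s - t| < d -> `|G s - G t| < e) ->
  a < b -> G 0 < b ->
  (forall s, 0 <= s <= 1 -> (forall t, 0 <= t <= s -> G t < b) -> G s <= a) ->
  forall t, 0 <= t <= 1 -> G t < b.
Proof.
move=> cG ab G0 H t1 /andP[t10 t11]; rewrite ltNge; apply/negP => Gt1.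
pose B := [set t | 0 <= t <= 1 /\ b <= G t].
have B1 : B t1 by split => //; rewrite t10.
have lbB : lbound B 0 by move=> t [/andP[]].
have hB : has_inf B by split; [exists t1|exists 0].
set t := inf B.
have t0 : 0 <= t by apply: lb_le_inf => //; exists t1.
have tt1 : t <= t1 by apply: ge_inf => //; exists 0.
have tle : 0 <= t <= 1 by rewrite t0 (le_trans tt1).
have before s : 0 <= s -> s < t -> G s < b.
  move=> s0 st; rewrite ltNge; apply/negP => Gs.
  have : t <= s.
    apply: ge_inf; first by exists 0.
    by split=> //; rewrite s0 /= (le_trans (ltW st)) // (le_trans tt1).
  by rewrite leNgt st.
have e0 : 0 < (b - a) / 2 by rewrite divr_gt0 // subr_gt0.
have [d d0 cd] := cG t tle _ e0.
have [b' [b'1 Gb'] b't] := inf_adherent d0 hB.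
have tb' : t <= b' by apply: ge_inf => //; exists 0.
have := cd b' b'1; rewrite ger0_norm ?subr_ge0 // ltrBlDl => /(_ b't) K1.
(* A time slightly before t, or 0 itself when t = 0. *)
have [s [sle sd Gs]] : exists s, [/\ 0 <= s <= 1, `|s - t| < d & G s <= a].
  have [t00|tpos] := leP t 0.
    exists 0; have -> : t = 0 by apply/le_anti; rewrite t00.
    rewrite subrr normr0 lexx ler01; split=> //.
    apply: H; rewrite ?lexx ?ler01 // => s /andP[s0 s1].
    by have -> : s = 0 by apply/le_anti; rewrite s0 s1.
  exists (Num.max 0 (t - d / 2)).
  have d2 : 0 < d / 2 by exact: divr_gt0.
  have st : Num.max 0 (t - d / 2) < t by rewrite gt_max tpos ltrBlDr ltrDl.
  have s0 : 0 <= Num.max 0 (t - d / 2) by rewrite le_max lexx.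
  have s1 : Num.max 0 (t - d / 2) <= 1.
    by rewrite (le_trans (ltW st)) // (le_trans tt1).
  split; first by rewrite s0.
    rewrite distrC ger0_norm ?subr_ge0 ?(ltW st) //.
    have : t - d / 2 <= Num.max 0 (t - d / 2) by rewrite le_max lexx orbT.
    by lra.
  apply: H; first by rewrite s0.
  by move=> s /andP[s00 ss]; apply: before => //; exact: le_lt_trans st.
have K2 := cd s sle sd.
move: K1 K2; rewrite !ltr_norml => /andP[? ?] /andP[? ?]; lra.
Qed.

(** Follow u = - Re f_1 along the ray to w. While |f|^2 < eta, a disc of fixed radius c about the
    current point is mapped into Re f_1 < 0, so |f_1'| <= (2 / c) u. By Gronwall u stays below m,
    and f_1 stays small. Now phi (|f'|^2) < u < m forces |f'|^2 < eta / 4, and [first_exit] closes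
    the argument. *)
Lemma disc_localization (D : set V) (phi : R -> R) (M eta m r : R) : 0 < M ->
  (forall z, D z -> forall j, normc (z 0 j) <= M) ->
  0 < eta -> (forall z, D z -> sqnorm z < 4 * eta -> rho phi z < 0) ->
  (forall y, 0 <= y < 4 * eta -> 0 <= phi y) ->
  0 < m -> (forall y, eta / 4 <= y < 4 * eta -> m <= phi y) ->
  0 < r < 1 ->
  exists2 d : R, 0 < d & forall f, holo_disc D f -> sqnorm (f 0) < d ->
    forall w, normc w <= r -> sqnorm (f w) < eta.
Proof.
move=> M0 DM eta0 Drho phi0 m0 phim /andP[r0 r1].
(* Discs of radius p about points of modulus at most r + p remain in the unit disc, so K below
   bounds the derivatives there. *)
pose p := (1 - r) / 2.
have p0 : 0 < p by rewrite divr_gt0 // subr_gt0.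
have rp : r + p + p = 1 by rewrite /p; field.
pose K := 4 * M / p.
have K0 : 0 < K by rewrite divr_gt0 // mulr_gt0.
(* From |f (z + h)|^2 <= 2 |f z|^2 + A |h|^2; the radius c then keeps |f|^2 below 3 eta around a
   point where it is below eta. *)
pose A := 8 * K ^+ 2 * n.+1%:R.
have A0 : 0 <= A by apply: mulr_ge0 => //; apply: mulr_ge0 => //; exact: sqr_ge0.
have A1 : 0 < A + 1 by rewrite ltr_wpDl.
pose c := Num.min p (eta / (A + 1)).
have c0 : 0 < c by rewrite lt_min p0 divr_gt0.
have cp : c <= p by rewrite ge_min lexx.
have cA : A * c <= eta.
  apply: (@le_trans _ _ ((A + 1) * c)); first by rewrite ler_wpM2r ?(ltW c0) // lerDl.
  by rewrite mulrC -ler_pdivlMr // ge_min lexx orbT.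
(* The constant of the half plane estimate on a disc of radius c; E bounds the growth of u over a
   ray of parameter length 1. *)
pose k := 2 / c.
have k0 : 0 < k by exact: divr_gt0.
pose E := expR k.
have E0 : 0 < E by exact: expR_gt0.
have kE0 : 0 < k * E by exact: mulr_gt0.
have q0 : 0 < 1 + 2 * (k * E) by lra.
(* The first term gives u < m along the ray. The second bounds |f_1| by a number at most 1 and at
   most eta / 4, whose square is therefore at most eta / 4. *)
pose d1 := Num.min (m / (2 * E)) (Num.min 1 (eta / 4) / (1 + 2 * (k * E))).
have d10 : 0 < d1.
  by rewrite lt_min !divr_gt0 ?mulr_gt0 // lt_min ltr01 divr_gt0.
have dm : d1 * E < m.
  have : d1 * (2 * E) <= m by rewrite -ler_pdivlMr ?mulr_gt0 // ge_min lexx.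
  by have := mulr_gt0 d10 E0; lra.
have dq : d1 * (1 + 2 * (k * E)) <= Num.min 1 (eta / 4).
  by rewrite -ler_pdivlMr // ge_min lexx orbT.
have dq2 : (d1 * (1 + 2 * (k * E))) ^+ 2 <= eta / 4.
  move: dq; rewrite le_min => /andP[? ?].
  have : 0 <= d1 * (1 + 2 * (k * E)) by rewrite mulr_ge0 // ltW.
  by nra.
exists (d1 ^+ 2); first by rewrite exprn_gt0.
move=> f hf f0 w wr.
pose G (t : R) := sqnorm (f (t%:C * w)).
have tw (t : R) : 0 <= t <= 1 -> normc (t%:C * w) <= r.
  move=> /andP[t0 t1]; rewrite normcM normc_real ger0_norm //.
  by apply: le_trans wr; rewrite ler_piMl ?normc_ge0.
have close z h j : normc z <= r -> normc h < p ->
    normc (f (z + h) 0 j - f z 0 j) <= 2 * (K * normc h).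
  move=> zr hp.
  have th (t : R) : 0 <= t <= 1 -> normc (z + t%:C * h) < r + p.
    move=> /andP[t0 t1]; apply: le_lt_trans (ler_normcD _ _) _.
    rewrite normcM normc_real ger0_norm //; apply: ler_ltD => //.
    by apply: le_lt_trans hp; rewrite ler_piMl ?normc_ge0.
  apply: (@segment_normc_le _ (fun z => f z 0 j) (fun z => derive1 f z 0 j)) => t tt.
    have [|_ /(_ j)//] := holo_discP (w := z + t%:C * h) hf.
    by have := th t tt; lra.
  by apply: (holo_disc_derive_le _ DM) => //; have := th t tt; lra.
have sq z h : normc z <= r -> normc h < c -> sqnorm (f (z + h)) <=
    2 * sqnorm (f z) + A * normc h ^+ 2.
  move=> zr hc; rewrite /sqnorm mulr_sumr.
  have -> : A * normc h ^+ 2 = \sum_(j < n.+1) 2 * (2 * (K * normc h)) ^+ 2.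
    by rewrite sumr_const card_ord -mulr_natr /A; ring.
  rewrite -big_split /=; apply: ler_sum => j _.
  have : sqmod (f (z + h) 0 j - f z 0 j) <= (2 * (K * normc h)) ^+ 2.
    rewrite -normc_sqr ler_pXn2r ?nnegrE ?normc_ge0 //.
      exact: close (lt_le_trans hc cp).
    by apply: mulr_ge0 => //; apply: mulr_ge0; [exact: ltW|exact: normc_ge0].
  case: (f (z + h) 0 j) (f z 0 j) => [x y] [x' y'].
  rewrite /sqmod /= => ?.
  by have := sqr_ge0 (x - x' - x'); have := sqr_ge0 (y - y' - y'); nra.
have neg z : normc z < 1 -> sqnorm (f z) < 4 * eta ->
    complex.Re (f z 0 ord0) + phi (sqtan (f z)) < 0 /\ 0 <= phi (sqtan (f z)).
  move=> z1 z4; have [Dz _] := holo_discP hf z1; split; first exact: Drho.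
  by apply: phi0; rewrite sqtan_ge0 (le_lt_trans (sqtan_le_sqnorm _)).
have half z : normc z <= r -> sqnorm (f z) < eta ->
    normc (derive1 f z 0 ord0) <= k * - complex.Re (f z 0 ord0).
  move=> zr ze.
  have in1 h : normc h < c -> normc (z + 1 * h) < 1.
    move=> hc; apply: le_lt_trans (ler_normcD _ _) _; rewrite mul1r.
    by have := lt_le_trans hc cp; lra.
  have Rneg h : normc h < c -> complex.Re (f (z + 1 * h) 0 ord0) <= 0.
    move=> hc; have [|H1 H2] := neg _ (in1 h hc).
      rewrite mul1r; apply: le_lt_trans (sq z h zr hc) _.
      have hn := normc_ge0 h.
      have : A * normc h ^+ 2 <= eta.
        apply: le_trans cA; rewrite ler_wpM2l // expr2.
        apply: le_trans (_ : normc h * 1 <= _); last by rewrite mulr1 ltW.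
        by rewrite ler_wpM2l //; lra.
      by lra.
    by lra.
  have z1 : normc (z + 1 * 0) < 1 by apply: in1; rewrite normc0.
  have dz := is_derive_affine (f := fun z => f z 0 ord0) ((holo_discP hf z1).2 ord0).
  rewrite !mul1r !addr0 in dz.
  have := half_plane_derive_le c0 _ Rneg dz; rewrite mulr0 addr0 => H.
  rewrite /k mulrAC ler_pdivlMr // mulrC mulrN -mulNr; apply: H => h /in1 h1.
  exact (@ex_derive _ _ _ _ _ _ _ (is_derive_affine (f := fun z => f z 0 ord0)
    ((holo_discP hf h1).2 ord0))).
have s0d : sqmod (f 0 0 ord0) < d1 ^+ 2 by exact: le_lt_trans (sqmod_le_sqnorm _ _) f0.
have f0d : normc (f 0 0 ord0) <= d1.
  rewrite -(ler_pXn2r (n := 2)) ?nnegrE ?normc_ge0 // ?(ltW d10) //.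
  by rewrite normc_sqr ltW.
have u0d : - complex.Re (f 0 0 ord0) <= d1.
  apply: le_trans f0d; apply: le_trans (ler_Re_normc _).
  by rewrite -normrN ler_norm.
suff main : forall t, 0 <= t <= 1 -> G t < eta.
  by have := main 1; rewrite /G mul1r; apply; rewrite ler01 lexx.
have d1eta : d1 ^+ 2 <= eta / 4.
  apply: le_trans dq2; rewrite ler_pXn2r ?nnegrE ?mulr_ge0 ?(ltW d10) ?(ltW q0) //.
  by rewrite ler_peMr ?(ltW d10) //; lra.
(* The bound improves from eta to eta / 2: one quarter of eta for |f_1|^2 and one for |f'|^2. *)
apply: (@first_exit G (eta / 2)); last 1 first.
- move=> s sle Gs.
  have sub (t : R) : 0 <= t <= s -> 0 <= t <= 1.
    by case/andP: sle => _ s1 /andP[-> ts]; exact: le_trans s1.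
  have s0 : 0 <= s by case/andP: sle.
  have dline (t : R) (b : C) : 0 <= t <= 1 ->
      is_derive t 1 (fun x : R => complex.Re (b * f (0 + x%:C * w) 0 ord0))
      (complex.Re (b * derive1 f (0 + t%:C * w) 0 ord0 * w)).
    move=> tt; apply: (is_derive_Re_line (g := fun z => b * f z 0 ord0)).
    apply: is_derive_scalec; have [|_ /(_ ord0)//] := holo_discP (w := 0 + t%:C * w) hf.
    by rewrite add0r (le_lt_trans (tw t tt)).
  have uE (x : R) : complex.Re (-1 * f (0 + x%:C * w) 0 ord0) =
      - complex.Re (f (x%:C * w) 0 ord0) by rewrite mulN1r add0r cReN.
  have ut (t : R) : 0 <= t <= s -> - complex.Re (f (t%:C * w) 0 ord0) <= d1 * E.
    move=> /andP[t0 ts].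
    have sub' (t' : R) : 0 <= t' <= t -> 0 <= t' <= s.
      by move=> /andP[-> /le_trans]; exact.
    have := @gronwall_le R (fun x => complex.Re (-1 * f (0 + x%:C * w) 0 ord0))
      (fun x => complex.Re (-1 * derive1 f (0 + x%:C * w) 0 ord0 * w)) k t t0 (ltW k0).
    move=> H; have {H} := H (fun x xt => dline x (-1) (sub x (sub' x xt))).
    rewrite !uE !mul0r => H.
    have {H} : - complex.Re (f (t%:C * w) 0 ord0) <=
        - complex.Re (f 0 0 ord0) * expR (k * t).
      apply: H => x xt; rewrite uE add0r.
      apply: le_trans (ler_norm _) _; apply: le_trans (ler_Re_normc _) _.
      rewrite !normcM normcN normc1 mul1r.
      apply: le_trans (half _ (tw x (sub x (sub' x xt))) (Gs x (sub' x xt))).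
      by rewrite ler_piMr ?normc_ge0 // (le_trans wr) // ltW.
    move/le_trans; apply; apply: ler_pM => //; rewrite ?expR_ge0 //.
      rewrite oppr_ge0.
      have n01 : normc (0 : C) < 1 by rewrite normc0.
      by have [|H1 H2] := neg 0 n01; have := f0; lra.
    rewrite ler_expR ler_piMr ?(ltW k0) // (le_trans ts) //.
    by case/andP: sle.
  have dt (t : R) : 0 <= t <= s -> normc (derive1 f (t%:C * w) 0 ord0) <= k * (d1 * E).
    move=> ts; apply: le_trans (half _ (tw t (sub t ts)) (Gs t ts)) _.
    by rewrite ler_wpM2l ?(ltW k0) //; exact: ut.
  have f0s : normc (f (s%:C * w) 0 ord0) <= d1 * (1 + 2 * (k * E)).
    have := @segment_normc_le R (fun z => f z 0 ord0) (fun z => derive1 f z 0 ord0)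
       0 (s%:C * w) (k * (d1 * E)).
    have ts (t : R) : 0 <= t <= 1 -> 0 <= t * s <= s.
      by move=> /andP[t0 t1]; rewrite mulr_ge0 //= ler_piMl.
    have tsE (t : R) : 0 + t%:C * (s%:C * w) = (t * s)%:C * w.
      by rewrite add0r mulrA realcM.
    move=> H; have {H} : normc (f (0 + s%:C * w) 0 ord0 - f 0 0 ord0) <=
        2 * (k * (d1 * E) * normc (s%:C * w)).
      apply: H => t /ts tt; rewrite tsE; last exact: dt.
      have [|_ /(_ ord0)//] := holo_discP (w := (t * s)%:C * w) hf.
      by apply: le_lt_trans (tw _ (sub _ tt)) r1.
    rewrite add0r => H.
    rewrite -[f (s%:C * w) 0 ord0](subrK (f 0 0 ord0)).
    apply: le_trans (ler_normcD _ _) _.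
    have : k * (d1 * E) * normc (s%:C * w) <= k * (d1 * E) * 1.
      rewrite ler_wpM2l ?(mulr_ge0 (ltW k0) (mulr_ge0 (ltW d10) (ltW E0))) //.
      by apply: le_trans (tw s sle) (ltW r1).
    by lra.
  have Gss : G s < eta by apply: Gs; rewrite s0 lexx.
  have w1 : normc (s%:C * w) < 1 by apply: le_lt_trans (tw s sle) r1.
  have [|N1 N2] := neg _ w1; first by move: Gss; rewrite /G; lra.
  rewrite /G sqnorm_split.
  have F0 : sqmod (f (s%:C * w) 0 ord0) <= eta / 4.
    rewrite -normc_sqr; apply: le_trans dq2.
    by rewrite ler_pXn2r ?nnegrE ?normc_ge0 // (mulr_ge0 (ltW d10) (ltW q0)).
  have us := ut s; rewrite s0 lexx in us; have {}us := us isT.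
  have F1 : sqtan (f (s%:C * w)) < eta / 4.
    rewrite ltNge; apply/negP => st.
    have := phim (sqtan (f (s%:C * w))); rewrite st (le_lt_trans (sqtan_le_sqnorm _)).
      by move=> /(_ isT); lra.
    by move: Gss; rewrite /G; lra.
  by lra.
- move=> t tt e e0.
  (* A local Lipschitz constant of G: each coordinate varies at rate 2 K and has modulus at most
     M. *)
  pose B := 4 * (K * M) * n.+1%:R.
  have B0 : 0 < B.
    by apply: mulr_gt0 => //; apply: mulr_gt0 => //; apply: mulr_gt0.
  exists (Num.min p (e / B)); first by rewrite lt_min p0 divr_gt0.
  move=> s ss; rewrite lt_min => /andP[sp]; rewrite ltr_pdivlMr // => sB.
  have sE : s%:C * w = t%:C * w + (s - t)%:C * w.
    by rewrite -mulrDl -rmorphD addrC subrK.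
  have nst : normc ((s - t)%:C * w) <= `|s - t|.
    rewrite normcM normc_real ler_piMr // (le_trans wr) // ltW //.
  rewrite /G sE /sqnorm -sumrB; apply: le_lt_trans (ler_norm_sum _ _ _) _.
  apply: le_lt_trans sB.
  have -> : `|s - t| * B = \sum_(j < n.+1) 4 * (K * M) * `|s - t|.
    by rewrite sumr_const card_ord -mulr_natr /B; ring.
  apply: ler_sum => j _; apply: le_trans (sqmod_dist _ _) _.
  have cl := close (t%:C * w) ((s - t)%:C * w) j (tw t tt) (le_lt_trans nst sp).
  have [D1 _] := holo_discP hf (le_lt_trans (tw t tt) r1).
  have [D2 _] := holo_discP hf (le_lt_trans (tw s ss) r1).
  rewrite sE in D2; have {}D1 := DM _ D1 j; have {}D2 := DM _ D2 j.
  have {}cl := le_trans cl (ler_wpM2l (ler0n _ 2) (ler_wpM2l (ltW K0) nst)).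
  have -> : 4 * (K * M) * `|s - t| = 2 * (K * `|s - t|) * (M + M) by ring.
  by apply: ler_pM; rewrite ?normc_ge0 ?addr_ge0 ?normc_ge0 // lerD.
- by have := divr_gt0 eta0 (ltr0n R 2); lra.
- by rewrite /G mul0r; lra.
Qed.
End Localization.

(** * Exponentially flat functions *)

Section FlatFunctions.
Context {R : realType}.
Variable phi : R -> R.
Hypothesis hphi : exp_flat phi.
Local Notation phi' := (derive1 phi).

Lemma flat_is_derive k (x : R) :
  is_derive x 1 (derive1n k phi) (derive1n k.+1 phi x).
Proof.
rewrite derive1nS derive1E; apply/derivableP.
exact: (exp_flat_smooth hphi).
Qed.

Lemma flat_is_derive0 (x : R) : is_derive x 1 phi (phi' x).
Proof. exact: (flat_is_derive 0). Qed.

Lemma flat_is_derive1 (x : R) : is_derive x 1 phi' (derive1n 2 phi x).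
Proof. exact: (flat_is_derive 1). Qed.

Lemma flat_continuous k : continuous (derive1n k phi).
Proof.
move=> x; apply: differentiable_continuous; apply/derivable1_diffP.
by have [] := flat_is_derive k x.
Qed.

Lemma flat_at0 : phi 0 = 0.
Proof. exact: (exp_flat_zero hphi). Qed.

Lemma flat_derive_at0 : phi' 0 = 0.
Proof. exact: (exp_flat_derive0 hphi 1). Qed.

(** Induction on k for all orders l at once: every derivative vanishes at 0, so a bound on the next
    one yields one more power of y. *)
Lemma flat_power k l : exists2 c : R, 0 < c &
  forall y, 0 <= y <= 1 -> `|derive1n l phi y| <= c * y ^+ k.
Proof.
elim: k l => [|k IH] l.
  have cw (f : R -> R) : continuous f -> {within `[0, 1], continuous f}.
    exact: continuous_subspaceT.
  have [c _ Hc] := EVT_max ler01 (cw _ (@flat_continuous l)).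
  have [d _ Hd] := EVT_min ler01 (cw _ (@flat_continuous l)).
  exists (`|derive1n l phi c| + `|derive1n l phi d| + 1).
    by rewrite ltr_wpDl // addr_ge0.
  move=> y y01; rewrite expr0 mulr1 ler_norml.
  have yi : y \in `[0, 1] by rewrite in_itv.
  have := Hc y yi; have := Hd y yi.
  have := ler_norm (derive1n l phi c); have := ler_norm (- derive1n l phi d).
  have := normr_ge0 (derive1n l phi c); have := normr_ge0 (derive1n l phi d).
  by rewrite normrN; lra.
have [c c0 Hc] := IH l.+1; exists c => // y /andP[y0 y1].
have b (t : R) : 0 <= t <= y -> `|derive1n l.+1 phi t| <= c * y ^+ k.
  move=> /andP[t0 ty]; apply: le_trans (Hc t _) _; first by rewrite t0 (le_trans ty).
  by rewrite ler_wpM2l ?(ltW c0) // lerXn2r // nnegrE (le_trans t0).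
have m1 := @mean_value_le R _ _ 0 y (c * y ^+ k) y0 (fun x _ => flat_is_derive l x).
have m2 := @mean_value_ge R _ _ 0 y (- (c * y ^+ k)) y0 (fun x _ => flat_is_derive l x).
rewrite (exp_flat_derive0 hphi l) !subr0 in m1 m2.
rewrite exprSr mulrA ler_norml -mulNr; apply/andP; split.
  by apply: m2 => t /b; rewrite ler_norml => /andP[].
by apply: m1 => t /b; rewrite ler_norml => /andP[].
Qed.

Variable e0 : R.
Hypothesis e0_gt0 : 0 < e0.
Hypothesis hconv : forall x, 0 < x < e0 -> 0 < derive1n 2 phi x.

Lemma flat_convex2_ge0 x : 0 <= x < e0 -> 0 <= derive1n 2 phi x.
Proof.
move=> /andP[x0 xe]; have [->|xn0] := eqVneq x 0.
  by rewrite (exp_flat_derive0 hphi 2).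
by apply/ltW/hconv; rewrite lt0r xn0 x0.
Qed.

Lemma flat_derive_mono x y : 0 <= x -> x <= y -> y < e0 -> phi' x <= phi' y.
Proof.
move=> x0 xy ye; rewrite -subr_ge0 -[leLHS](mul0r (y - x)).
apply: (mean_value_ge xy (fun t _ => flat_is_derive1 t)) => t /andP[xt ty].
by apply: flat_convex2_ge0; rewrite (le_trans x0) // (le_lt_trans ty).
Qed.

Lemma flat_derive_ge0 y : 0 <= y < e0 -> 0 <= phi' y.
Proof. by move=> /andP[y0 ye]; rewrite -flat_derive_at0; exact: flat_derive_mono. Qed.

Lemma flat_derive_gt0 y : 0 < y < e0 -> 0 < phi' y.
Proof.
move=> /andP[y0 ye]; have := flat_is_derive1 => d.
have [|c cy E] := @MVT R phi' (derive1n 2 phi) 0 y y0 (fun x _ => d x).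
  exact: (is_derive_continuous_within (fun x _ => d x)).
rewrite flat_derive_at0 !subr0 in E; rewrite E mulr_gt0 //; apply: hconv.
by move: cy; rewrite in_itv /= => /andP[-> /lt_trans -> //].
Qed.

Lemma flat_convex x y : 0 <= x < e0 -> 0 <= y < e0 ->
  phi y + phi' y * (x - y) <= phi x.
Proof.
move=> /andP[x0 xe] /andP[y0 ye]; have [xy|/ltW yx] := leP x y.
  have := @mean_value_le R _ _ x y (phi' y) xy (fun t _ => flat_is_derive0 t).
  move=> H; have {H} : phi y - phi x <= phi' y * (y - x).
    by apply: H => t /andP[xt ty]; apply: flat_derive_mono => //; exact: le_trans xt.
  by lra.
have := @mean_value_ge R _ _ y x (phi' y) yx (fun t _ => flat_is_derive0 t).
move=> H; have {H} : phi' y * (x - y) <= phi x - phi y.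
  by apply: H => t /andP[yt tx]; apply: flat_derive_mono => //; exact: le_lt_trans xe.
by lra.
Qed.

Lemma flat_mono x y : 0 <= x -> x <= y -> y < e0 -> phi x <= phi y.
Proof.
move=> x0 xy ye; rewrite -subr_ge0 -[leLHS](mul0r (y - x)).
apply: (mean_value_ge xy (fun t _ => flat_is_derive0 t)) => t /andP[xt ty].
by apply: flat_derive_ge0; rewrite (le_trans x0) // (le_lt_trans ty).
Qed.

Lemma flat_ge0 y : 0 <= y < e0 -> 0 <= phi y.
Proof. by move=> /andP[y0 ye]; rewrite -flat_at0; exact: flat_mono. Qed.

Lemma flat_gt0 y : 0 < y < e0 -> 0 < phi y.
Proof.
move=> /andP[y0 ye]; have := flat_is_derive0 => d.
have [|c cy E] := @MVT R phi phi' 0 y y0 (fun x _ => d x).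
  exact: (is_derive_continuous_within (fun x _ => d x)).
rewrite flat_at0 !subr0 in E; rewrite E mulr_gt0 //; apply: flat_derive_gt0.
by move: cy; rewrite in_itv /= => /andP[-> /lt_trans -> //].
Qed.

Lemma flat_inverse e x : 0 < e < e0 -> 0 < x < phi e ->
  exists2 y, 0 < y < e & phi y = x.
Proof.
move=> /andP[e_gt0 ee0] /andP[x0 xe].
have [|y ye E] := @IVT R phi 0 e x (ltW e_gt0) (continuous_subspaceT (@flat_continuous 0)).
  by rewrite flat_at0 ge_min le_max (ltW x0) (ltW xe) orbT.
exists y => //; move: ye; rewrite in_itv /= => /andP[y0 ye].
apply/andP; split; rewrite lt_neqAle ?y0 ?ye andbT; apply/eqP => yE.
  by move: x0; rewrite -E -yE flat_at0 ltxx.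
by move: xe; rewrite -E yE ltxx.
Qed.

Lemma flat_ratio_small c e : 0 < c < 1 -> 0 < e -> exists2 d : R, 0 < d &
  forall y, 0 < y < d -> phi (c * y) <= e * phi y.
Proof.
move=> c01 e_gt0.
have := exp_flat_lim0 hphi c01 => /cvgrPdist_le /(_ e e_gt0).
rewrite near_withinE => /nbhs_normP[d /= d0 H].
exists (Num.min d e0); first by rewrite lt_min d0.
move=> y /andP[y0]; rewrite lt_min => /andP[yd ye].
have := H y; rewrite /ball_ /= !sub0r !normrN ger0_norm ?(ltW y0) // => /(_ yd y0).
have py : 0 < phi y by apply: flat_gt0; rewrite y0.
move=> /(le_trans (ler_norm _)); rewrite ler_pdivrMr // (mulrC y) //.
Qed.

Lemma flat_ratio_large c A : 1 < c -> exists2 d : R, 0 < d &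
  forall y, 0 < y < d -> A * phi y <= phi (c * y).
Proof.
move=> c1.
have := exp_flat_limy hphi c1 => /cvgryPge /(_ A).
rewrite near_withinE => /nbhs_normP[d /= d0 H].
exists (Num.min d e0); first by rewrite lt_min d0.
move=> y /andP[y0]; rewrite lt_min => /andP[yd ye].
have := H y; rewrite /ball_ /= !sub0r !normrN ger0_norm ?(ltW y0) // => /(_ yd y0).
have py : 0 < phi y by apply: flat_gt0; rewrite y0.
by rewrite ler_pdivlMr // (mulrC y).
Qed.

(** In the cone r^N < x / alpha, so a high power of r + 2 x is small against x, and derivatives of
    phi are bounded by arbitrarily high powers. The factor B leaves room to compare r + 2 x with Y
    later. *)
Lemma cone_flat (alpha N B e : R) l : 0 < alpha -> 0 < N -> 0 < B -> 0 < e ->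
  exists2 x0 : R, 0 < x0 & forall x r, 0 < x < x0 -> 0 <= r -> alpha * r `^ N < x ->
    B * (r + 2 * x) ^+ 2 <= 1 /\
    forall u, 0 <= u <= B * (r + 2 * x) ^+ 2 -> `|derive1n l phi u| <= e * x.
Proof.
move=> a0 N0 B0 e_gt0.
(* An integer k >= N: for r <= 1 this gives r^k <= r^N, and one further factor r is left to provide
   smallness. *)
pose k := (Num.truncn N).+1.
have Nk : N <= k.+1%:R - 1.
  by rewrite -natr1 addrK ltW // /k; apply: truncnS_gt.
have [c c0 Hc] := flat_power k l.
(* The 9 is the square of the 3 in r + 2 x <= 3 max (r, x). *)
pose A := c * (B * 9) ^+ k.
have A0 : 0 < A by rewrite mulr_gt0 // exprn_gt0 // mulr_gt0.
have aN : 0 < alpha ^-1 by rewrite invr_gt0.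
pose q := Num.min 1 (Num.min (1 / (B * 9)) (e / (A * (1 + alpha^-1)))).
have q0 : 0 < q.
  by rewrite !lt_min ltr01 !divr_gt0 // mulr_gt0 // addr_gt0.
have q1 : q <= 1 by rewrite ge_min lexx.
have qB : q * (B * 9) <= 1.
  by rewrite -ler_pdivlMr ?mulr_gt0 // !ge_min lexx ?orbT.
have qe : q * (A * (1 + alpha^-1)) <= e.
  have A1 : 0 < A * (1 + alpha^-1) by exact: mulr_gt0 A0 (addr_gt0 ltr01 aN).
  by rewrite -ler_pdivlMr // !ge_min lexx ?orbT.
exists (Num.min q (alpha * q `^ N)).
  by rewrite lt_min q0 mulr_gt0 // powR_gt0.
move=> x r /andP[x0]; rewrite lt_min => /andP[xq xa] r0 rx.
have rq : r <= q.
  rewrite leNgt; apply/negP => qr.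
  have : q `^ N <= r `^ N.
    by apply: ge0_ler_powR; rewrite ?nnegrE ?(ltW N0) ?(ltW q0) ?(ltW qr).
  by rewrite -(ler_pM2l a0); lra.
pose m := Num.max r x.
have m0 : 0 < m by rewrite lt_max x0 orbT.
have mq : m <= q by rewrite ge_max rq ltW.
have rm : r + 2 * x <= 3 * m.
  have : r <= m by rewrite le_max lexx.
  have : x <= m by rewrite le_max lexx orbT.
  by lra.
have r2 : 0 <= r + 2 * x by rewrite addr_ge0 // mulr_ge0 // ltW.
have sq : B * (r + 2 * x) ^+ 2 <= (B * 9) * m ^+ 2.
  rewrite -mulrA ler_wpM2l ?(ltW B0) //.
  have -> : 9 * m ^+ 2 = (3 * m) ^+ 2 by ring.
  by rewrite lerXn2r // nnegrE mulr_ge0 // ltW.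
have le1 : B * (r + 2 * x) ^+ 2 <= 1.
  apply: le_trans sq _; have : (B * 9) * m ^+ 2 <= (B * 9) * q.
    rewrite ler_wpM2l ?mulr_ge0 ?(ltW B0) // expr2.
    apply: le_trans (_ : m * 1 <= _); first by rewrite ler_wpM2l ?(ltW m0) // (le_trans mq).
    by rewrite mulr1.
  by rewrite [X in _ <= X -> _]mulrC; lra.
split=> // u /andP[u0 uB].
apply: le_trans (Hc u _) _; first by rewrite u0 (le_trans uB).
have uk : u ^+ k <= ((B * 9) * m ^+ 2) ^+ k.
  have u9 := le_trans uB sq.
  by rewrite lerXn2r // nnegrE // (le_trans u0).
apply: le_trans (ler_wpM2l (ltW c0) uk) _.
rewrite exprMn mulrA -/A.
have mk : (m ^+ 2) ^+ k <= m ^+ k.+1.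
  by rewrite -exprM ler_wiXn2l ?(ltW m0) ?(le_trans mq) // /k mul2n -addnn addSn ltnS leq_addl.
(* Of the k + 1 factors one is at most q; the others are bounded by x if m = x, and by r^N < x /
   alpha if m = r. *)
have mx : m ^+ k.+1 <= q * ((1 + alpha^-1) * x).
  rewrite /m; have [rxx|xr] := leP r x.
    rewrite exprSr (mulrC q) mulrDl mul1r.
    have x1 : x <= 1 by lra.
    have : x ^+ k * x <= x ^+ 1 * x.
      by rewrite ler_wpM2r ?(ltW x0) // ler_wiXn2l ?(ltW x0).
    rewrite expr1 => /le_trans; apply.
    have : x * x <= x * q by rewrite ler_wpM2l // ltW.
    have : 0 <= alpha^-1 * x * q by rewrite !mulr_ge0 // ltW.
    by lra.
  have rp : 0 < r by exact: lt_trans xr.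
  have r1 : r <= 1 by lra.
  have : r ^+ k <= r `^ N.
    rewrite -powR_mulrn // /powR gt_eqF // ler_expR.
    by rewrite ler_wnM2r ?ln_le0 //; move: Nk; rewrite -natr1 addrK.
  have rx' : r `^ N <= alpha^-1 * x by rewrite ler_pdivlMl // ltW.
  move=> /le_trans/(_ rx') K; rewrite exprSr.
  have : r ^+ k * r <= (alpha^-1 * x) * q.
    by rewrite ler_pM // exprn_ge0 // ltW.
  move/le_trans; apply.
  have : 0 <= x * q by rewrite mulr_ge0 // ltW.
  by lra.
apply: le_trans (ler_wpM2l (ltW A0) (le_trans mk mx)) _.
have -> : A * (q * ((1 + alpha^-1) * x)) = (q * (A * (1 + alpha^-1))) * x by ring.
by rewrite ler_wpM2r // ltW.
Qed.

End FlatFunctions.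

(** * The normal and tangential distances *)

Section Norms.
Context {R : realType}.
Local Notation C := R[i].

(** Cauchy-Schwarz, obtained by expanding the sum of |B a_j - A b_j|^2 >= 0, with A B = 0 treated
    apart. The predicate P lets it serve both for [enorm] and for the norm of z'. *)
Lemma minkowski_sqmod (I : finType) (P : pred I) (a b : I -> C) :
  Num.sqrt (\sum_(j | P j) sqmod (a j + b j)) <=
  Num.sqrt (\sum_(j | P j) sqmod (a j)) + Num.sqrt (\sum_(j | P j) sqmod (b j)).
Proof.
have ge0 (c : I -> C) : 0 <= \sum_(j | P j) sqmod (c j).
  by apply: sumr_ge0 => j _; exact: sqmod_ge0.
have A2 : Num.sqrt (\sum_(j | P j) sqmod (a j)) ^+ 2 = \sum_(j | P j) sqmod (a j).
  by rewrite sqr_sqrtr.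
have B2 : Num.sqrt (\sum_(j | P j) sqmod (b j)) ^+ 2 = \sum_(j | P j) sqmod (b j).
  by rewrite sqr_sqrtr.
set A := Num.sqrt _ in A2 *; set B := Num.sqrt (\sum_(j | P j) sqmod (b j)) in B2 *.
have A0 : 0 <= A by exact: sqrtr_ge0.
have B0 : 0 <= B by exact: sqrtr_ge0.
pose S := \sum_(j | P j) complex.Re (a j * (b j)^*%C).
have SE : \sum_(j | P j) sqmod (a j + b j) = A ^+ 2 + B ^+ 2 + 2 * S.
  rewrite A2 B2 /S mulr_sumr -!big_split /=; apply: eq_bigr => j _.
  by case: (a j) (b j) => [x y] [x' y']; rewrite /sqmod /=; ring.
rewrite -[leRHS]ger0_norm ?addr_ge0 // -sqrtr_sqr ler_wsqrtr // SE.
suff : S <= A * B by lra.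
have key : 0 <= 2 * (A ^+ 2 * B ^+ 2) - 2 * (A * B * S).
  apply: le_trans (ge0 (fun j => B%:C * a j - A%:C * b j)) _.
  rewrite le_eqVlt; apply/orP; left; apply/eqP.
  transitivity (B ^+ 2 * \sum_(j | P j) sqmod (a j) +
    A ^+ 2 * \sum_(j | P j) sqmod (b j) - 2 * (A * B * S)); last first.
    by rewrite -A2 -B2; ring.
  rewrite /S !mulr_sumr -big_split -sumrB /=; apply: eq_bigr => j _.
  by case: (a j) (b j) => [x y] [x' y']; rewrite /sqmod /=; ring.
have zero (c : I -> C) : \sum_(j | P j) sqmod (c j) = 0 -> forall j, P j -> c j = 0.
  move=> c0 j Pj; have := psumr_eq0P (fun i _ => sqmod_ge0 (c i)) c0 Pj.
  by rewrite -normc_sqr => /eqP; rewrite sqrf_eq0 normc_eq0 => /eqP.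
have [AB|AB] := ltP 0 (A * B).
  rewrite -(ler_pM2l AB); lra.
have : A * B == 0 by rewrite eq_le AB mulr_ge0.
rewrite mulf_eq0 => /orP[|] /eqP E.
  rewrite E mul0r /S big1 // => j Pj.
  by rewrite zero ?mul0r // -A2 E expr0n.
rewrite E mulr0 /S big1 // => j Pj.
by rewrite (zero b) ?conjc0 ?mulr0 // -B2 E expr0n.
Qed.

Lemma enormD m (z w : 'rV[C]_m) : enorm (z + w) <= enorm z + enorm w.
Proof.
rewrite /enorm (eq_bigr (fun j => sqmod (z 0 j + w 0 j))); last by move=> j _; rewrite mxE.
exact: minkowski_sqmod.
Qed.

Lemma enorm_ge0 m (z : 'rV[C]_m) : 0 <= enorm z.
Proof. exact: sqrtr_ge0. Qed.

Lemma enorm_sqr m (z : 'rV[C]_m) : enorm z ^+ 2 = sqnorm z.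
Proof. by rewrite sqr_sqrtr // sqnorm_ge0. Qed.

Lemma sqmodM (z w : C) : sqmod (z * w) = sqmod z * sqmod w.
Proof. by rewrite -!normc_sqr normcM exprMn. Qed.

Lemma enormZ m (c : C) (z : 'rV[C]_m) : enorm (c *: z) = normc c * enorm z.
Proof.
rewrite /enorm (eq_bigr (fun j => sqmod c * sqmod (z 0 j))).
  rewrite -mulr_sumr sqrtrM ?sqmod_ge0 // -normc_sqr sqrtr_sqr ger0_norm //.
  exact: normc_ge0.
by move=> j _; rewrite mxE sqmodM.
Qed.

Lemma enormN m (z : 'rV[C]_m) : enorm (- z) = enorm z.
Proof. by rewrite -scaleN1r enormZ normcN normc1 mul1r. Qed.

Lemma normc_le_enorm m (z : 'rV[C]_m) j : normc (z 0 j) <= enorm z.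
Proof.
rewrite -[leLHS]ger0_norm ?normc_ge0 // -sqrtr_sqr ler_wsqrtr // normc_sqr.
exact: sqmod_le_sqnorm.
Qed.

End Norms.

(** * The norm of z' and the boundary as zero set of rho *)

Section Tangential.
Context {R : realType} {n : nat}.
Local Notation C := R[i].
Local Notation V := 'rV[R[i]]_n.+1.
Implicit Types z w p : V.

Definition tnorm z : R := Num.sqrt (sqtan z).

Lemma tnorm_ge0 z : 0 <= tnorm z.
Proof. exact: sqrtr_ge0. Qed.

Lemma tnorm_sqr z : tnorm z ^+ 2 = sqtan z.
Proof. by rewrite sqr_sqrtr // sqtan_ge0. Qed.

Lemma tnormD z w : tnorm (z + w) <= tnorm z + tnorm w.
Proof.
rewrite /tnorm /sqtan (eq_bigr (fun j => sqmod (z 0 j + w 0 j))).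
  exact: minkowski_sqmod.
by move=> j _; rewrite mxE.
Qed.

Lemma tnormZ (c : C) z : tnorm (c *: z) = normc c * tnorm z.
Proof.
rewrite /tnorm /sqtan (eq_bigr (fun j => sqmod c * sqmod (z 0 j))).
  rewrite -mulr_sumr sqrtrM ?sqmod_ge0 // -normc_sqr sqrtr_sqr ger0_norm //.
  exact: normc_ge0.
by move=> j _; rewrite mxE sqmodM.
Qed.

Lemma tnormN z : tnorm (- z) = tnorm z.
Proof. by rewrite -scaleN1r tnormZ normcN normc1 mul1r. Qed.

Lemma tnorm_le_enorm z : tnorm z <= enorm z.
Proof. by rewrite ler_wsqrtr //; exact: sqtan_le_sqnorm. Qed.

Lemma Re0_le_enorm z : `|complex.Re (z 0 ord0)| <= enorm z.
Proof. exact: le_trans (ler_Re_normc _) (normc_le_enorm _ _). Qed.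

Lemma stdb0E : stdb 0 = delta_mx 0 ord0 :> V.
Proof. by rewrite /stdb; congr delta_mx; apply/val_inj; rewrite /= inordK. Qed.

Lemma tnorm_stdb0 : tnorm (stdb 0) = 0.
Proof.
rewrite /tnorm /sqtan big1 ?sqrtr0 // => j j0.
by rewrite stdb0E mxE (negbTE j0) andbF /sqmod /= expr0n addr0.
Qed.

Lemma inord1_neq0 : (0 < n)%N -> (inord 1 : 'I_n.+1) != ord0.
Proof. by move=> n0; rewrite -val_eqE /= inordK. Qed.

Lemma tnorm_stdb1 : (0 < n)%N -> tnorm (stdb 1) = 1.
Proof.
move=> n0; rewrite /tnorm /sqtan (bigD1 (inord 1)) ?inord1_neq0 //= big1.
  by rewrite /stdb mxE !eqxx /sqmod /= expr1n expr0n !addr0 sqrtr1.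
move=> j /andP[_ j1]; rewrite /stdb mxE (negbTE j1) andbF /sqmod /=.
by rewrite expr0n addr0.
Qed.

Lemma stdb_coord0 : (stdb 0 : V) 0 ord0 = 1.
Proof. by rewrite stdb0E mxE !eqxx. Qed.

Lemma stdb1_coord0 : (0 < n)%N -> (stdb 1 : V) 0 ord0 = 0.
Proof.
by move=> n0; rewrite /stdb mxE eq_sym (negbTE (inord1_neq0 n0)) andbF.
Qed.

Lemma addZ_stdb0_coord0 z (a : C) : (z + a *: stdb 0) 0 ord0 = z 0 ord0 + a.
Proof. by rewrite mxE [X in _ + X]mxE stdb_coord0 mulr1. Qed.

Lemma comb_coord0 (a b : C) : (0 < n)%N ->
  (a *: stdb 0 + b *: stdb 1 : V) 0 ord0 = a.
Proof.
move=> n0; rewrite addrC addZ_stdb0_coord0 mxE stdb1_coord0 //.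
by rewrite mulr0 add0r.
Qed.

Lemma Re0_qtilde z : (0 < n)%N -> complex.Re (qtilde z 0 ord0) = complex.Re (z 0 ord0).
Proof. by move=> n0; rewrite /qtilde comb_coord0. Qed.

Lemma tnorm_comb (a b : C) : (0 < n)%N -> tnorm (a *: stdb 0 + b *: stdb 1) = normc b.
Proof.
move=> n0; apply/le_anti/andP; split.
  apply: le_trans (tnormD _ _) _.
  by rewrite !tnormZ tnorm_stdb0 tnorm_stdb1 // mulr0 add0r mulr1.
have := tnormD (a *: stdb 0 + b *: stdb 1) (- (a *: stdb 0)).
rewrite addrAC subrr add0r tnormN !tnormZ tnorm_stdb0 tnorm_stdb1 //.
by rewrite mulr0 addr0 mulr1.
Qed.

Lemma tnorm_qtilde z : (0 < n)%N -> tnorm (qtilde z) = tnorm z.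
Proof.
by move=> n0; rewrite tnorm_comb // normc_real ger0_norm // sqrtr_ge0.
Qed.

Lemma coord_real_continuous (j : 'I_n.+1) :
  continuous (fun z : V => complex.Re (z 0 j)) /\
  continuous (fun z : V => complex.Im (z 0 j)).
Proof.
split=> z A /nbhs_normP[e /= e0 H]; apply/nbhs_rVP; exists e => // x xz;
  apply: H; rewrite /ball_ /=; apply: le_lt_trans (xz j).
  by rewrite -cReB normcB; exact: ler_Re_normc.
by rewrite -cImB normcB; exact: ler_Im_normc.
Qed.

Lemma sqtan_continuous : continuous (@sqtan R n).
Proof.
have sq j : continuous (fun z : V => sqmod (z 0 j)).
  have [cR cI] := coord_real_continuous j.
  have -> : (fun z : V => sqmod (z 0 j)) = (fun z : V =>
      complex.Re (z 0 j) * complex.Re (z 0 j) + complex.Im (z 0 j) * complex.Im (z 0 j)).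
    by apply/funext => z; rewrite /sqmod !expr2.
  by move=> z; exact: cvgD (cvgM (cR z) (cR z)) (cvgM (cI z) (cI z)).
rewrite /sqtan; elim: (index_enum 'I_n.+1) => [|i s IH].
  rewrite (_ : (fun z : V => _) = (fun=> 0)); first exact: cst_continuous.
  by apply/funext => z; rewrite big_nil.
rewrite (_ : (fun z : V => _) = if i != ord0 then
    fun z : V => sqmod (z 0 i) + \sum_(j <- s | j != ord0) sqmod (z 0 j)
  else fun z : V => \sum_(j <- s | j != ord0) sqmod (z 0 j)).
  by case: ifP => // _ z; exact: cvgD (sq i z) (IH z).
by apply/funext => z; rewrite big_cons; case: ifP.
Qed.

Lemma rho_continuous phi : continuous phi -> continuous (@rho R n phi).
Proof.
move=> cphi z; have cR := (coord_real_continuous ord0).1 z.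
have cS := continuous_comp (@sqtan_continuous z) (cphi (sqtan z)).
exact: cvgD cR cS.
Qed.

Lemma rho_shift phi z (a : R) :
  rho phi (z + a%:C *: stdb 0) = rho phi z + a.
Proof.
have tz : sqtan (z + a%:C *: stdb 0) = sqtan z.
  apply: eq_bigr => j j0; by rewrite stdb0E !mxE (negbTE j0) andbF mulr0 addr0.
by rewrite /rho tz addZ_stdb0_coord0 cReD addrAC.
Qed.

Lemma shift_near z (A : set V) : nbhs z A ->
  exists2 d : R, 0 < d & forall a : R, `|a| < d -> A (z + a%:C *: stdb 0).
Proof.
move=> /nbhs_rVP[d d0 H]; exists d => // a ad; apply: H => j.
rewrite stdb0E !mxE addrAC subrr add0r.
rewrite eqxx andTb; case: (j == ord0); last first.
  by rewrite mulr0 normc0; exact: le_lt_trans ad.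
by rewrite mulr1 normc_real.
Qed.

(** Along e_1 the function rho has slope 1, so each of its zeros is a limit of points where it is
    negative. *)
Lemma bd_rho phi (D : set V) p : continuous phi ->
  (\forall z \near p, D z <-> rho phi z < 0) -> bd D p <-> rho phi p = 0.
Proof.
move=> cphi Dp; have crho := @rho_continuous phi cphi p.
split=> [[clD nint]|rp].
  apply/le_anti/andP; split; rewrite leNgt; apply/negP => rp.
    have : \forall z \near p, 0 < rho phi z by exact: (cvgr_gt _ crho).
    move=> H; have [z [Dz [D1 D2]]] := clD _ (filterI Dp H).
    by move/D1: Dz => /(lt_trans D2); rewrite ltxx.
  apply: nint; have : \forall z \near p, rho phi z < 0 by exact: (cvgr_lt _ crho).
  by apply: filterS2 Dp => z [_].
split.
  move=> B Bp; have [d d0 H] := shift_near (filterI Bp Dp).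
  have d2 : 0 < d / 2 by exact: divr_gt0.
  have [|B1 D1] := H (- (d / 2)); first by rewrite normrN gtr0_norm //; lra.
  exists (p + (- (d / 2))%:C *: stdb 0); split=> //; apply/D1.
  by rewrite rho_shift rp add0r oppr_lt0.
move=> /interior_subset Dpp; have [H _] := nbhs_singleton Dp.
by move: (H Dpp); rewrite rp ltxx.
Qed.

Lemma bd_Omega phi p : continuous phi -> bd (Omega phi) p <-> rho phi p = 0.
Proof. by move=> cphi; apply: bd_rho => //; near=> z. Unshelve. all: by end_near. Qed.

(** The default value 0 is kept as an alternative: 0 is a boundary point both of D and of Omega, and
    the later estimates hold for it as well. *)
Lemma nearest_ptP m (A : set 'rV[C]_m) (x : 'rV[C]_m) :
  nearest_pt A x = 0 \/ nearest A x (nearest_pt A x).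
Proof.
rewrite /nearest_pt.
by case: (xgetP 0 [set p | nearest A x p]) => [p -> Hp|]; [right|left].
Qed.

End Tangential.

Section Affine.
Context {R : realType} {n : nat}.
Local Notation C := R[i].
Local Notation V := 'rV[R[i]]_n.+1.

Lemma line_continuous (a b : V) : continuous (fun s : R => a + s%:C *: b).
Proof.
move=> s A /nbhs_rVP[d d0 H]; apply/nbhs_normP.
have b0 : 0 < enorm b + 1 by rewrite ltr_wpDl ?enorm_ge0.
exists (d / (enorm b + 1)) => /=; first exact: divr_gt0.
move=> t; rewrite /ball_ /= ltr_pdivlMr // => st; apply: H => j.
rewrite !mxE opprD addrACA subrr add0r -mulrBl -rmorphB normcM normc_real distrC.
apply: le_lt_trans st; rewrite ler_wpM2l //.
by apply: le_trans (normc_le_enorm b j) _; rewrite lerDl.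
Qed.

Lemma affine_continuous (p : V) (F : 'M[C]_n.+1) : continuous (fun y : V => p + y *m F).
Proof.
move=> y A /nbhs_rVP[d d0 H]; apply/nbhs_rVP.
pose B := \sum_i \sum_j normc (F i j).
have B0 : 0 <= B by apply: sumr_ge0 => i _; apply: sumr_ge0 => j _; exact: normc_ge0.
have B1 : 0 < B + 1 by rewrite ltr_wpDl.
exists (d / (B + 1)); first exact: divr_gt0.
move=> x xy; apply: H => j.
have -> : (p + x *m F) 0 j - (p + y *m F) 0 j = \sum_i (x 0 i - y 0 i) * F i j.
  rewrite !mxE opprD addrACA subrr add0r -sumrB; apply: eq_bigr => i _.
  by rewrite mulrBl.
have tri (I : Type) (s : seq I) (G : I -> C) :
    normc (\sum_(i <- s) G i) <= \sum_(i <- s) normc (G i).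
  elim/big_rec2: _ => [|i a b _ ab]; first by rewrite normc0.
  by apply: le_trans (ler_normcD _ _) _; rewrite lerD2l.
apply: le_lt_trans (tri _ _ _) _.
apply: le_lt_trans (_ : d / (B + 1) * B < d); last first.
  by rewrite mulrAC ltr_pdivrMr // ltr_pM2l // ltrDl.
rewrite mulr_sumr; apply: ler_sum => i _; rewrite normcM.
apply: ler_pM; rewrite ?normc_ge0 //; first exact/ltW/xy.
by rewrite (bigD1 j) //= lerDl; apply: sumr_ge0 => k _; exact: normc_ge0.
Qed.

(** The inverse map y -> p + y F is continuous, so closure and interior of the image can be tested
    on rho composed with it. *)
Lemma bd_affine_image (phi : R -> R) (p w : V) (F : 'M[C]_n.+1) :
  continuous phi -> F \in unitmx ->
  bd ((fun w => (w - p) *m invmx F) @` Omega phi) ((w - p) *m invmx F)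
  <-> rho phi w = 0.
Proof.
move=> cphi Fu; set g := fun w : V => _.
have gK (y : V) : g (p + y *m F) = y by rewrite /g addrAC subrr add0r mulmxK.
have gKV (u : V) : p + g u *m F = u by rewrite /g mulmxKV // addrC subrK.
have inO u : (g @` Omega phi) (g u) -> rho phi u < 0.
  by move=> [v Ov E]; rewrite -(gKV u) -E gKV.
have intO u : rho phi u < 0 -> interior (g @` Omega phi) (g u).
  move=> ru; have cr : {for g u, continuous (fun y : V => rho phi (p + y *m F))}.
    exact: continuous_comp (@affine_continuous p F (g u)) (@rho_continuous _ _ _ cphi _).
  have : \forall y \near g u, rho phi (p + y *m F) < 0.
    by apply: (cvgr_lt _ cr); rewrite gKV.
  apply: filterS => y ry; exists (p + y *m F) => //; exact: gK.
split=> [[clw nint]|rw].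
- apply/le_anti/andP; split; rewrite leNgt; apply/negP => rw; last exact: nint (intO _ rw).
  have cr : {for g w, continuous (fun y : V => rho phi (p + y *m F))}.
    exact: continuous_comp (@affine_continuous p F (g w)) (@rho_continuous _ _ _ cphi _).
  have /clw[y [[v Ov <-]]] : \forall y \near g w, 0 < rho phi (p + y *m F).
    by apply: (cvgr_gt _ cr); rewrite gKV.
  by rewrite /= gKV => /(lt_trans Ov); rewrite ltxx.
- split; last by move=> /interior_subset /inO; rewrite rw ltxx.
  move=> B gB.
  have gl (a : R) : g (w + a%:C *: stdb 0) = g w + a%:C *: (stdb 0 *m invmx F).
    by rewrite /g addrAC mulmxDl scalemxAl.
  have := @line_continuous (g w) (stdb 0 *m invmx F) 0 B.
  rewrite scale0r addr0 => /(_ gB) /nbhs_normP[d /= d0 H].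
  have d2 : 0 < d / 2 by exact: divr_gt0.
  exists (g w + (- (d / 2))%:C *: (stdb 0 *m invmx F)); split.
    exists (w + (- (d / 2))%:C *: stdb 0); last exact: gl.
    by rewrite /Omega /= rho_shift rw add0r oppr_lt0.
  by apply: H; rewrite /ball_ /= sub0r opprK gtr0_norm //; lra.
Qed.

End Affine.

(** * The rotation at the foot point and its tangent line *)

Section Frame.
Context {R : realType} {n : nat}.
Hypothesis n0 : (0 < n)%N.
Local Notation C := R[i].
Local Notation V := 'rV[R[i]]_n.+1.
Variables (phi : R -> R) (p : V).
Local Notation s := (slope phi p).
Local Notation g := (enorm (grad phi p)).

Lemma enorm_grad_sqr : g ^+ 2 = 1 + s ^+ 2.
Proof.
rewrite enorm_sqr sqnorm_split -tnorm_sqr /grad.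
have -> : stdb 0 + s%:C *: stdb 1 = 1 *: stdb 0 + s%:C *: stdb 1 :> V.
  by rewrite scale1r.
rewrite tnorm_comb // comb_coord0 // normc_real real_normK ?num_real //.
by rewrite /sqmod /= expr1n expr0n addr0.
Qed.

Lemma enorm_grad_bounds : 1 <= g <= 1 + `|s|.
Proof.
have := enorm_grad_sqr; have := enorm_ge0 (grad phi p).
have := sqr_ge0 s; rewrite -[s ^+ 2](real_normK (num_real s)).
have := normr_ge0 s; move: `|s| (enorm _) => a b a0 a2 b0 ab.
by apply/andP; split; nra.
Qed.

Lemma row_frame j : row j (frame phi p) =
  match val j with
  | 0%N => (g^-1)%:C *: grad phi p
  | 1%N => (g^-1)%:C *: grad_rot phi p
  | _ => delta_mx 0 j end.
Proof.
apply/rowP => k; rewrite !mxE; by case: j => [[|[|j]] jn].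
Qed.

Lemma stdb_dot j k : (j < n.+1)%N -> (k < n.+1)%N ->
  (stdb j : V) *m (stdb k : V)^T = (j == k)%:R%:M.
Proof.
move=> jn kn; rewrite /stdb trmx_delta mul_delta_mx_cond -val_eqE /= !inordK //.
case: (j == k); last by rewrite mulr0n raddf0.
by rewrite mulr1n; apply/matrixP => a b; rewrite !ord1 !mxE.
Qed.

(** The rows are orthonormal with real entries, so the plain transpose is an inverse. *)
Lemma frame_unit : frame phi p \in unitmx.
Proof.
suff /mulmx1_unit[] : frame phi p *m (frame phi p)^T = 1%:M by [].
have gn0 : (g%:C : C) != 0.
  have /andP[g1 _] := enorm_grad_bounds.
  by rewrite realc_eq0 gt_eqF // (lt_le_trans ltr01).
have gV : (g^-1)%:C * (g^-1)%:C * (1 + s%:C * s%:C) = 1 :> C.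
  rewrite -realcM -[1]/(1%:C) -realcM -rmorphD -realcM.
  rewrite -expr2 -enorm_grad_sqr -exprMn mulVf ?expr1n //.
  by rewrite -realc_eq0.
have n1 : (1 < n.+1)%N by [].
have dots (a b c d : C) : (a *: stdb 0 + b *: stdb 1 : V) *m
    (c *: stdb 0 + d *: stdb 1 : V)^T = (a * c + b * d)%:M.
  rewrite linearD /= !linearZ /= mulmxDl !mulmxDr -!scalemxAl -!scalemxAr !scalerA.
  rewrite !stdb_dot //= !scale_scalar_mx !mulr1 !mulr0 !raddf0 addr0 add0r.
  by rewrite -raddfD.
apply/matrixP => j k.
have -> : (frame phi p *m (frame phi p)^T) j k =
    (row j (frame phi p) *m (row k (frame phi p))^T) 0 0.
  by rewrite !mxE; apply: eq_bigr => i _; rewrite !mxE.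
rewrite !row_frame [RHS]mxE.
have dE i (ilt : (i.+2 < n.+1)%N) : delta_mx 0 (Ordinal ilt) = stdb i.+2 :> V.
  by rewrite /stdb; congr delta_mx; apply/val_inj; rewrite /= inordK.
have mixr (a b : C) i : (i.+2 < n.+1)%N ->
    (a *: stdb 0 + b *: stdb 1 : V) *m (stdb i.+2 : V)^T = 0.
  move=> il; rewrite mulmxDl -!scalemxAl !stdb_dot //=.
  by rewrite !scale_scalar_mx !mulr0 !raddf0 addr0.
have mixl (a b : C) i : (i.+2 < n.+1)%N ->
    (stdb i.+2 : V) *m (a *: stdb 0 + b *: stdb 1 : V)^T = 0.
  by move=> il; rewrite -[LHS]trmxK trmx_mul trmxK mixr // trmx0.
pose G : C := (g^-1)%:C.
have r0E : G *: grad phi p = G *: stdb 0 + (G * s%:C) *: stdb 1.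
  by rewrite /grad scalerDr scalerA.
have r1E : G *: grad_rot phi p = (- (G * s%:C)) *: stdb 0 + G *: stdb 1.
  by rewrite /grad_rot scalerDr scalerA mulrN.
rewrite -/G r0E r1E.
case: j => [[|[|j]] jn]; case: k => [[|[|k]] kn];
  rewrite /= ?dE ?dots ?mixr ?mixl ?stdb_dot // !mxE /= ?mulr1n //.
- by rewrite -gV -/G; ring.
- by ring.
- by ring.
- by rewrite -gV -/G; ring.
Qed.

End Frame.

Lemma realcN (R : realType) (a : R) : (- a)%:C = - a%:C :> R[i].
Proof. exact: rmorphN. Qed.

Lemma realcD (R : realType) (a b : R) : (a + b)%:C = a%:C + b%:C :> R[i].
Proof. exact: rmorphD. Qed.

Lemma realcB (R : realType) (a b : R) : (a - b)%:C = a%:C - b%:C :> R[i].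
Proof. exact: rmorphB. Qed.

(** Stated in an abstract module, like the next identity, so that [ring] only meets the coefficients
    and no matrix is unfolded. *)
Lemma rotated_comb (K : comNzRingType) (W : lmodType K) (u v : W) (a b c d : K) :
  (- (a * d)) *: (u + b *: v) + c *: (a *: (- b *: u + v)) =
  (- (a * (d + c * b))) *: u + (a * (c - d * b)) *: v.
Proof.
rewrite !scalerDr !scalerA addrACA -!scalerDl.
by congr (_ *: _ + _ *: _); ring.
Qed.

Lemma unrotate_comb (K : comNzRingType) (W : lmodType K) (p u v : W) (a c d : K) :
  p + (- (a * d)) *: u + c *: (a *: v) - p = c *: (a *: v) + (- d) *: (a *: u).
Proof.
by rewrite -[p + _ + _]addrA [p + _]addrC addrK addrC (scalerA (- d)) mulNr (mulrC d).
Qed.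

Section TangentLine.
Context {R : realType} {n : nat}.
Hypothesis n0 : (0 < n)%N.
Local Notation C := R[i].
Local Notation V := 'rV[R[i]]_n.+1.
Variables (phi : R -> R) (p : V) (d : R).
Local Notation sl := (slope phi p).
Local Notation g := (enorm (grad phi p)).

(** The preimage of s e_2 - d e_1 under the rigid motion attached to p. With p the foot and d the
    normal distance, it runs along the line on which d^* is measured. *)
Definition tan_pt (s : R) : V :=
  (p + (- (g^-1 * d))%:C *: grad phi p) + s%:C *: ((g^-1)%:C *: grad_rot phi p).

Lemma tan_ptE s : s%:C *: stdb 1 + (- d)%:C *: stdb 0 =
  (tan_pt s - p) *m invmx (frame phi p).
Proof.
have Fu := frame_unit n0 phi p.
apply: (canRL (mulmxK Fu)); rewrite mulmxDl -!scalemxAl /tan_pt.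
have -> : (stdb 0 : V) *m frame phi p = (g^-1)%:C *: grad phi p.
  by rewrite stdb0E -rowE row_frame.
have -> : (stdb 1 : V) *m frame phi p = (g^-1)%:C *: grad_rot phi p.
  by rewrite /stdb -rowE row_frame /= inordK.
move: (grad phi p) (grad_rot phi p) (g^-1) => u v G.
rewrite !realcN realcM; symmetry.
exact: (@unrotate_comb C V p u v G%:C s%:C d%:C).
Qed.

Lemma tan_pt_comb s : tan_pt s = p + ((- (g^-1 * (d + s * sl)))%:C *: stdb 0
  + (g^-1 * (s - d * sl))%:C *: stdb 1).
Proof.
rewrite /tan_pt -addrA; apply: (congr1 (fun u => p + u)).
move: (g^-1) => G; rewrite /grad /grad_rot; move: (slope phi p) => S.
rewrite !realcN !realcM realcD realcB !realcM.
exact: (@rotated_comb C V (stdb 0) (stdb 1) G%:C S%:C s%:C d%:C).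
Qed.

End TangentLine.

(** * Comparison of d with x and of d^* with Y at one point *)

Section Distances.
Context {R : realType} {n : nat}.
Hypothesis n0 : (0 < n)%N.
Local Notation C := R[i].
Local Notation V := 'rV[R[i]]_n.+1.
Variables (phi : R -> R) (z : V) (e : R).
Local Notation x := (- complex.Re (z 0 ord0)).
Local Notation r := (tnorm z).
Hypothesis cphi : continuous phi.
Hypothesis phi0 : phi 0 = 0.
Hypothesis x0 : 0 < x.
Hypothesis e01 : 0 < e <= 1 / 8.
Hypothesis small : forall u, 0 <= u <= (r + 2 * x) ^+ 2 -> 0 <= phi u <= e * x.

Lemma enorm_stdb0 : enorm (stdb 0 : V) = 1.
Proof.
rewrite /enorm (bigD1 ord0) //= big1 => [|j j0].
  by rewrite stdb_coord0 /sqmod /= expr1n expr0n !addr0 sqrtr1.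
by rewrite stdb0E mxE (negbTE j0) andbF /sqmod /= expr0n addr0.
Qed.

(** The boundary point of Omega reached from [qtilde z] in direction e_1, a competitor for the
    distance. *)
Definition graph_pt : V := (- phi (r ^+ 2))%:C *: stdb 0 + r%:C *: stdb 1.

Lemma bd_graph_pt : bd (Omega phi) graph_pt.
Proof.
apply/bd_Omega => //; rewrite /rho comb_coord0 // -tnorm_sqr tnorm_comb //.
by rewrite normc_real ger0_norm ?tnorm_ge0 //= addrC subrr.
Qed.

Lemma r_small : 0 <= r ^+ 2 <= (r + 2 * x) ^+ 2.
Proof.
have r0 := tnorm_ge0 z; have rx : r <= r + 2 * x by have := x0; lra.
by rewrite sqr_ge0 lerXn2r // nnegrE // (le_trans r0).
Qed.

Lemma dist_graph_pt : enorm (qtilde z - graph_pt) <= x.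
Proof.
have /andP[p0 p1] := small r_small.
rewrite /qtilde /graph_pt opprD addrACA subrr addr0 -scalerBl -rmorphB enormZ.
rewrite enorm_stdb0 mulr1 normc_real opprK ler_norml.
by have /andP[] := e01; have := x0; nra.
Qed.

Lemma sqr_tnorm_small w : tnorm w <= r + 2 * x -> 0 <= sqtan (w : V) <= (r + 2 * x) ^+ 2.
Proof.
move=> wr; rewrite sqtan_ge0 -tnorm_sqr lerXn2r // nnegrE ?tnorm_ge0 //.
exact: le_trans (tnorm_ge0 _) wr.
Qed.

Lemma tnorm_close w : enorm (qtilde z - w) <= x -> tnorm (w : V) <= r + x.
Proof.
move=> qw; have -> : w = qtilde z + - (qtilde z - w) by rewrite opprB addrC subrK.
apply: le_trans (tnormD _ _) _; rewrite tnormN tnorm_qtilde // lerD2l.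
exact: le_trans (tnorm_le_enorm _) qw.
Qed.

(** Holds also for the default value 0 of the foot, because phi 0 = 0. *)
Lemma foot_spec : rho phi (foot phi z) = 0 /\ tnorm (foot phi z) <= r + x.
Proof.
rewrite /foot; have [->|[bp near_p]] := nearest_ptP (bd (Omega phi)) (qtilde z).
  have s0 : sqtan (0 : V) = 0.
    by rewrite /sqtan big1 // => j _; rewrite mxE /sqmod /= expr0n addr0.
  rewrite /rho /tnorm s0 mxE phi0 addr0 sqrtr0; split=> //.
  by rewrite addr_ge0 ?tnorm_ge0 // ltW.
split; first exact/bd_Omega.
apply: tnorm_close; exact: le_trans (near_p _ bd_graph_pt) dist_graph_pt.
Qed.

(** A boundary point w closer than (1 - e) x would have |w'| <= r + 2 x, hence Re w_1 = - phi >= - e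
    x, which already differs from - x by (1 - e) x. *)
Lemma dnor_bounds : (1 - e) * x <= dnor phi z <= x.
Proof.
have lb : lbound [set enorm (qtilde z - w) | w in bd (Omega phi)] ((1 - e) * x).
  move=> _ [w /(bd_Omega _ cphi) rw <-]; rewrite leNgt; apply/negP => lt.
  have ex0 : 0 <= e * x by have /andP[? _] := e01; rewrite mulr_ge0 // ltW.
  have lx : enorm (qtilde z - w) <= x by lra.
  have /sqr_tnorm_small/small/andP[p0 p1] : tnorm w <= r + 2 * x.
    by have := tnorm_close lx; have := x0; lra.
  have := le_lt_trans (Re0_le_enorm _) lt.
  rewrite mxE [X in _ + X]mxE cReB Re0_qtilde // ltr_norml => /andP[+ _].
  by move: rw; rewrite /rho; lra.
rewrite /dnor /edist; apply/andP; split.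
  by apply: lb_le_inf => //; exists (enorm (qtilde z - graph_pt)), graph_pt => //;
     exact: bd_graph_pt.
apply: le_trans dist_graph_pt; apply: ge_inf; first by exists ((1 - e) * x).
by exists graph_pt => //; exact: bd_graph_pt.
Qed.

Hypothesis small' : forall u, 0 <= u <= (r + 2 * x) ^+ 2 -> `|derive1 phi u| <= e * x.
Hypothesis rx1 : r + 2 * x <= 1.

Lemma slope_foot_le : `|slope phi (foot phi z)| <= 2 * (e * x).
Proof.
rewrite /slope; have [_ pr] := foot_spec; set p := foot phi z in pr *.
have pp : `|complex.Re (p 0 (inord 1))| <= tnorm p.
  rewrite -sqrtr_sqr ler_wsqrtr // /sqtan (bigD1 (inord 1)) ?inord1_neq0 //=.
  rewrite /sqmod -addrA lerDl addr_ge0 ?sqr_ge0 //.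
  by apply: sumr_ge0 => j _; exact: sqmod_ge0.
have x00 := x0; have r0 := tnorm_ge0 z.
have q1 : `|complex.Re (p 0 (inord 1))| <= r + 2 * x by lra.
have q2 : 0 <= complex.Re (p 0 (inord 1)) ^+ 2 <= (r + 2 * x) ^+ 2.
  rewrite sqr_ge0 -(real_normK (num_real (complex.Re _))).
  by rewrite lerXn2r // nnegrE //; lra.
rewrite !normrM ger0_norm // -mulrA ler_wpM2l //.
apply: le_trans (_ : 1 * (e * x) <= _); last by rewrite mul1r.
by apply: ler_pM => //; [exact: le_trans q1 rx1|exact: small'].
Qed.

(** Y stands for the solution of phi (Y^2) = x; what is needed of it is that phi is negligible
    somewhat inside radius Y (lo) and large somewhat outside (hi). *)
Variables (k Y : R).
Hypothesis k01 : 0 < k <= 1 / 4.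
Hypothesis ek : 8 * e <= k.
Hypothesis Y01 : 0 < Y <= 1.
Hypothesis rY : r + 2 * x <= e * Y.
Hypothesis lo : forall u, 0 <= u <= (Y * (1 - k / 2)) ^+ 2 -> phi u <= e * x.
Hypothesis hi : forall u, (Y * (1 + k / 2)) ^+ 2 <= u <= (2 * Y) ^+ 2 -> 4 * x <= phi u.

Lemma rho_tan_pt (p : V) (d s : R) : rho phi (tan_pt phi p d s) =
  complex.Re (p 0 ord0) - (enorm (grad phi p))^-1 * (d + s * slope phi p)
  + phi (sqtan (tan_pt phi p d s)).
Proof.
rewrite {1}/rho; congr (_ + _); rewrite tan_pt_comb mxE comb_coord0 // cReD.
by rewrite /= .
Qed.

Lemma tnorm_tan_pt (p : V) (d s : R) :
  let c := `|(enorm (grad phi p))^-1 * (s - d * slope phi p)| in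
  c - tnorm p <= tnorm (tan_pt phi p d s) <= c + tnorm p.
Proof.
rewrite /= tan_pt_comb -normc_real; set c := normc _.
have -> : c = tnorm ((- ((enorm (grad phi p))^-1 * (d + s * slope phi p)))%:C *: stdb 0
   + ((enorm (grad phi p))^-1 * (s - d * slope phi p))%:C *: stdb 1 : V).
  by rewrite tnorm_comb.
move: (_ *: _ + _) => w {c}.
have H1 := tnormD p w; have H2 := tnormD (p + w) (- p).
by rewrite addrAC subrr add0r tnormN in H2; apply/andP; split; lra.
Qed.

Lemma foot_facts :
  [/\ - (e * x) <= complex.Re (foot phi z 0 ord0) <= 0,
      `|slope phi (foot phi z)| <= e,
      1 - `|slope phi (foot phi z)| <= (enorm (grad phi (foot phi z)))^-1 <= 1 &
      dnor phi z * `|slope phi (foot phi z)| <= x].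
Proof.
have [rp tp] := foot_spec; have sl := slope_foot_le.
have /andP[g1 g2] := enorm_grad_bounds n0 phi (foot phi z).
have /andP[d1 d2] := dnor_bounds.
have x00 := x0; have r0 := tnorm_ge0 z; have rx := rx1; have /andP[e0 e1] := e01.
have x12 : x <= 1 / 2 by lra.
have /sqr_tnorm_small/small/andP[p0 p1] : tnorm (foot phi z) <= r + 2 * x by lra.
move: (slope _ _) (enorm (grad _ _)) (dnor _ _) sl g1 g2 d1 d2 => s g d sl g1 g2 d1 d2.
have s0 := normr_ge0 s; have g0 : 0 < g by lra.
have se : `|s| <= e by apply: le_trans sl _; nra.
split.
- by move: rp; rewrite /rho => rp; apply/andP; split; lra.
- exact: se.
- apply/andP; split; last by rewrite invf_le1.
  rewrite -[leRHS]mul1r ler_pdivlMr //.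
  by nra.
- apply: le_trans (_ : d * 1 <= _); last by lra.
  by apply: ler_wpM2l; [nra|lra].
Qed.

(** The tangential norm is at most s + (r + 2 x) <= (1 - k / 2) Y, so phi is at most e x there,
    while the small slope keeps Re of the first coordinate below a fixed negative multiple of x. *)
Lemma rho_tan_pt_lt0 (s : R) : 0 <= s <= (1 - k) * Y ->
  rho phi (tan_pt phi (foot phi z) (dnor phi z) s) < 0.
Proof.
move=> /andP[s0 s1]; have [/andP[_ p0] se /andP[G0 G1] dx] := foot_facts.
have [_ tp] := foot_spec; have sl := slope_foot_le.
have /andP[d1 d2] := dnor_bounds.
have x00 := x0; have /andP[e0 e1] := e01; have /andP[k0 k1] := k01.
have /andP[Y0 Y1] := Y01; have rY' := rY; have ek' := ek.
have := tnorm_tan_pt (foot phi z) (dnor phi z) s => /andP[_ t2].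
rewrite rho_tan_pt.
move: (slope _ _) (enorm (grad _ _))^-1 (dnor _ _) (tan_pt _ _ _ s) t2 sl se G0 G1 dx d1 d2
  => S G d w t2 sl se G0 G1 dx d1 d2.
have S0 := normr_ge0 S; have d0 : 0 <= d by nra.
have GG : 0 <= G by lra.
have sS : `|s - d * S| <= s + d * `|S|.
  apply: le_trans (ler_normB _ _) _.
  by rewrite normrM (ger0_norm s0) (ger0_norm d0).
have GS : `|G * (s - d * S)| <= s + x.
  rewrite normrM (ger0_norm GG); apply: le_trans (_ : 1 * `|s - d * S| <= _).
    by rewrite ler_wpM2r.
  by rewrite mul1r; lra.
have eY : e * Y <= k / 8 * Y by rewrite ler_wpM2r ?(ltW Y0) //; lra.
have kY : 0 < k * Y by exact: mulr_gt0.
have tw : tnorm w <= Y * (1 - k / 2) by lra.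
have : phi (sqtan w) <= e * x.
  apply: lo; rewrite sqtan_ge0 -tnorm_sqr lerXn2r // nnegrE ?tnorm_ge0 //.
  exact: le_trans (tnorm_ge0 _) tw.
have SS : - `|S| <= S by rewrite -normrN lerNl ler_norm.
have sY : s <= 1.
  apply: le_trans s1 _; apply: le_trans (_ : 1 * Y <= _); last by rewrite mul1r.
  by rewrite ler_wpM2r ?(ltW Y0) //; lra.
have sS1 : - (2 * (e * x)) <= s * S.
  have : s * - `|S| <= s * S by rewrite ler_wpM2l.
  have : s * `|S| <= 1 * (2 * (e * x)) by apply: ler_pM.
  by lra.
have ex : e * x <= 1 / 8 * x by rewrite ler_wpM2r // ltW.
have ex0 : 0 < e * x by exact: mulr_gt0.
have dS : x / 2 <= d + s * S by lra.
have : G * (x / 2) <= G * (d + s * S) by rewrite ler_wpM2l.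
have : 7 / 8 * (x / 2) <= G * (x / 2) by rewrite ler_wpM2r //; lra.
by lra.
Qed.

(** Here the tangential norm exceeds (1 + k / 2) Y, where phi >= 4 x; Re of the first coordinate is
    no less than - 2 x - e x. *)
Lemma rho_tan_pt_gt0 :
  0 < rho phi (tan_pt phi (foot phi z) (dnor phi z) ((1 + k) * Y)).
Proof.
have [/andP[p0 _] se /andP[G0 G1] dx] := foot_facts.
have [_ tp] := foot_spec; have sl := slope_foot_le.
have /andP[d1 d2] := dnor_bounds.
have x00 := x0; have /andP[e0 e1] := e01; have /andP[k0 k1] := k01.
have /andP[Y0 Y1] := Y01; have rY' := rY; have ek' := ek.
have := tnorm_tan_pt (foot phi z) (dnor phi z) ((1 + k) * Y) => /andP[t1 t2].
rewrite rho_tan_pt; set s := (1 + k) * Y in t1 t2 *.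
have s0 : 0 < s by rewrite mulr_gt0 //; lra.
have sY : s <= 5 / 4 * Y by rewrite ler_wpM2r ?(ltW Y0) //; lra.
have sE : s = Y + k * Y by rewrite /s mulrDl mul1r.
move: (slope _ _) (enorm (grad _ _))^-1 (dnor _ _) (tan_pt _ _ _ s) t1 t2 sl se G0 G1 dx d1 d2
  => S G d w t1 t2 sl se G0 G1 dx d1 d2.
clearbody s.
have S0 := normr_ge0 S; have d0 : 0 <= d by nra.
have GG : 0 <= G by lra.
have sS : `|s - d * S| <= s + d * `|S|.
  apply: le_trans (ler_normB _ _) _.
  by rewrite normrM (ger0_norm (ltW s0)) (ger0_norm d0).
have sS' : s - d * `|S| <= `|s - d * S|.
  apply: le_trans (ler_norm _); have : d * S <= d * `|S| by rewrite ler_wpM2l ?ler_norm.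
  by lra.
have GS : `|G * (s - d * S)| <= s + x.
  rewrite normrM (ger0_norm GG); apply: le_trans (_ : 1 * `|s - d * S| <= _).
    by rewrite ler_wpM2r.
  by rewrite mul1r; lra.
have eY : e * Y <= k / 8 * Y by rewrite ler_wpM2r ?(ltW Y0) //; lra.
have kY : 0 < k * Y by exact: mulr_gt0.
have es : e * s <= e * (5 / 4 * Y) by rewrite ler_wpM2l // ltW.
have GS' : s - e * s - x <= `|G * (s - d * S)|.
  rewrite normrM (ger0_norm GG).
  have : (1 - e) * `|s - d * S| <= G * `|s - d * S| by rewrite ler_wpM2r //; lra.
  have : (1 - e) * (s - d * `|S|) <= (1 - e) * `|s - d * S| by rewrite ler_wpM2l //; lra.
  have : 0 <= e * (d * `|S|) by rewrite mulr_ge0 ?(ltW e0) // mulr_ge0.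
  by lra.
have kY4 : k * Y <= 1 / 4 * Y by rewrite ler_wpM2r // ltW.
have tw1 : Y * (1 + k / 2) <= tnorm w by lra.
have tw2 : tnorm w <= 2 * Y by lra.
have pw : 4 * x <= phi (sqtan w).
  apply: hi; rewrite -tnorm_sqr; apply/andP; split; rewrite lerXn2r // nnegrE ?tnorm_ge0 //.
    by rewrite mulr_ge0 ?(ltW Y0) //; lra.
  by rewrite mulr_ge0 // ltW.
have sS1 : s * S <= 5 / 4 * (2 * (e * x)).
  have : s * S <= s * `|S| by rewrite ler_wpM2l ?(ltW s0) // ler_norm.
  have : s * `|S| <= 5 / 4 * (2 * (e * x)).
    by apply: ler_pM => //; [exact: ltW|lra].
  by lra.
have ex : e * x <= 1 / 8 * x by rewrite ler_wpM2r // ltW.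
have ex0 : 0 < e * x by exact: mulr_gt0.
have : G * (d + s * S) <= G * (2 * x) by rewrite ler_wpM2l //; lra.
have : G * (2 * x) <= 1 * (2 * x) by rewrite ler_wpM2r //; lra.
by lra.
Qed.

(** By the intermediate value theorem rho vanishes on the line before (1 + k) Y, and it is negative
    up to (1 - k) Y. *)
Lemma dtan_bounds : (1 - k) * Y <= dtan phi z <= (1 + k) * Y.
Proof.
have /andP[k0 k1] := k01; have /andP[Y0 Y1] := Y01.
pose h s := rho phi (tan_pt phi (foot phi z) (dnor phi z) s).
have bdE s : bd (gamma phi z @` Omega phi)
    (s%:C *: stdb 1 + (- dnor phi z)%:C *: stdb 0) <-> h s = 0.
  rewrite (tan_ptE n0 phi (foot phi z)).
  exact: (bd_affine_image (foot phi z) _ cphi (frame_unit n0 phi (foot phi z))).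
have ch : continuous h.
  move=> s; apply: (@continuous_comp _ _ _ (fun s => tan_pt phi (foot phi z) (dnor phi z) s)
    (rho phi) s); first exact: line_continuous.
  exact: rho_continuous.
have s10 : 0 <= (1 + k) * Y by rewrite mulr_ge0 ?(ltW Y0) //; lra.
have kY0 : 0 <= (1 - k) * Y by rewrite mulr_ge0 ?(ltW Y0) //; lra.
have h0 : h 0 < 0 by apply: rho_tan_pt_lt0; rewrite lexx.
have h1 : 0 < h ((1 + k) * Y) by exact: rho_tan_pt_gt0.
have [|s sI hs] := @IVT R h 0 ((1 + k) * Y) 0 s10 (continuous_subspaceT ch).
  by move: (h 0) (h _) h0 h1 => a b a0 b0; rewrite ge_min le_max (ltW a0) (ltW b0) orbT.
move: sI; rewrite in_itv /= => /andP[s0 s1].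
have sp : 0 < s.
  rewrite lt0r s0 andbT; apply/eqP => s00.
  by move: h0; rewrite -[in h 0]s00 hs ltxx.
rewrite /dtan; set A := [set s | _].
have As : A s by split => //; apply/bdE.
have lb : lbound A ((1 - k) * Y).
  move=> t [t0 /bdE ht]; rewrite leNgt; apply/negP => tk.
  have := rho_tan_pt_lt0 (s := t); rewrite (ltW t0) (ltW tk) => /(_ isT).
  by rewrite -/(h t) ht ltxx.
apply/andP; split; first by apply: lb_le_inf => //; exists s.
by apply: le_trans s1; apply: ge_inf => //; exists ((1 - k) * Y).
Qed.

End Distances.

(** * Complex tangent space *)

Section HermitianProduct.
Context {R : realType} {m : nat}.
Local Notation C := R[i].
Local Notation V := 'rV[R[i]]_m.
Implicit Types u v w : V.

Lemma dotmx_sum u v : dotmx u v = \sum_j u 0 j * (v 0 j)^*%C.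
Proof.
by rewrite dotmxE mxE; apply: eq_bigr => j _; rewrite !mxE.
Qed.

Lemma dotmxDl u v w : dotmx (u + v) w = dotmx u w + dotmx v w.
Proof.
by rewrite !dotmx_sum -big_split; apply: eq_bigr => j _; rewrite mxE mulrDl.
Qed.

Lemma dotmxZl (a : C) u w : dotmx (a *: u) w = a * dotmx u w.
Proof.
by rewrite !dotmx_sum mulr_sumr; apply: eq_bigr => j _; rewrite mxE mulrA.
Qed.

Lemma dotmxBl u v w : dotmx (u - v) w = dotmx u w - dotmx v w.
Proof. by rewrite dotmxDl -scaleN1r dotmxZl mulN1r. Qed.

Lemma dotmx_conj u v : dotmx v u = (dotmx u v)^*%C.
Proof.
rewrite !dotmx_sum rmorph_sum; apply: eq_bigr => j _.
by rewrite rmorphM /= conjcK mulrC.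
Qed.

Lemma dotmxx u : dotmx u u = (sqnorm u)%:C.
Proof.
rewrite dotmx_sum /sqnorm rmorph_sum; apply: eq_bigr => j _.
exact: mulcc_sqmod.
Qed.

Lemma dotmx_delta_l (a : C) j u : dotmx (a *: delta_mx 0 j) u = a * (u 0 j)^*%C.
Proof.
rewrite dotmxZl dotmx_sum (bigD1 j) //= big1 => [|i ij].
  by rewrite mxE !eqxx mul1r addr0.
by rewrite mxE (negbTE ij) andbF mul0r.
Qed.

End HermitianProduct.

(** * Linearity of directional derivatives of smooth functions *)

Section DirectionalDerivatives.
Context {R : realType} {m : nat}.
Local Notation C := R[i].
Local Notation V := 'rV[R[i]]_m.
Variables (U : set V) (f : V -> R).
Hypothesis oU : open U.
Hypothesis sf : smooth_on U f.

Lemma rderiv_is_derive (v p : V) : U p ->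
  is_derive (0 : R) 1 (fun t : R => f (p + t%:C *: v)) (rderiv v f p).
Proof.
move=> Up; have [_ /(_ v) d] := sf [::] Up.
by rewrite /rderiv derive1E; exact/derivableP.
Qed.

Lemma rderivE (v p : V) (a : R) :
  is_derive (0 : R) 1 (fun t : R => f (p + t%:C *: v)) a -> rderiv v f p = a.
Proof. by move=> H; rewrite /rderiv derive1E; exact: derive_val. Qed.

Lemma rderivN (v p : V) : U p -> rderiv (- v) f p = - rderiv v f p.
Proof.
move=> Up; apply: rderivE; apply: is_derive_from_approx => e e0.
have [d d0 H] := is_derive_approx (rderiv_is_derive v Up) e0.
exists d => // h hd; have := H (- h); rewrite normrN => /(_ hd).
by rewrite sub0r add0r !scale0r !addr0 mulrN mulNr realcN scaleNr scalerN.
Qed.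

Lemma segment_is_derive (w q : V) (s : R) : U (q + s%:C *: w) ->
  is_derive s 1 (fun t : R => f (q + t%:C *: w)) (rderiv w f (q + s%:C *: w)).
Proof.
move=> Us; apply: is_derive_from_approx => e e0.
have [d d0 H] := is_derive_approx (rderiv_is_derive w Us) e0.
exists d; first exact: d0.
move=> h hd; have := H h hd; rewrite add0r scale0r addr0.
by rewrite realcD scalerDl addrA.
Qed.

(** Move first along v and then along w: the second increment is compared, by the mean value
    theorem, with the derivative at p, using continuity of [rderiv w f]. *)
Lemma rderivD (v w p : V) (a : R) : U p ->
  rderiv (v + a%:C *: w) f p = rderiv v f p + a * rderiv w f p.
Proof.
move=> Up; apply: rderivE; apply: is_derive_from_approx => e e0.
have e2 : 0 < e / 2 by exact: divr_gt0.
have [d d0 H] := is_derive_approx (rderiv_is_derive v Up) e2.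
have a1 : 0 < `|a| + 1 by rewrite ltr_wpDl.
have [cw _] := sf [:: w] Up.
have /nbhs_rVP[c c0 Hc] : \forall z \near p, U z /\
    `|rderiv w f z - rderiv w f p| <= e / 2 / (`|a| + 1).
  have ea : 0 < e / 2 / (`|a| + 1) by exact: divr_gt0.
  have K : \forall z \near p, `|rderiv w f z - rderiv w f p| <= e / 2 / (`|a| + 1).
    have /nbhs_rVP[c c0 Hc] : \forall z \near p, ball (rderiv w f p)
        (e / 2 / (`|a| + 1)) (rderiv w f z) by apply: cw; exact: nbhsx_ballx.
    apply/nbhs_rVP; exists c => // y /Hc; rewrite -ball_normE /ball_ /= distrC.
    exact: ltW.
  have UU : nbhs p U by apply: open_nbhs_nbhs.
  exact: filterI UU K.
pose B := enorm v + `|a| * enorm w + 1.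
have B0 : 0 < B by rewrite ltr_wpDl // addr_ge0 ?mulr_ge0 ?enorm_ge0.
exists (Num.min d (c / B)); first by rewrite lt_min d0 divr_gt0.
move=> t; rewrite lt_min ltr_pdivlMr // => /andP[td tc].
have near (s : R) : `|s| <= `|t * a| -> U (p + t%:C *: v + s%:C *: w) /\
    `|rderiv w f (p + t%:C *: v + s%:C *: w) - rderiv w f p| <= e / 2 / (`|a| + 1).
  move=> sta; apply: Hc => j.
  rewrite !mxE -[p 0 j + _ + _]addrA [p 0 j + _]addrC addrK.
  apply: le_lt_trans (ler_normcD _ _) _; rewrite !normcM !normc_real.
  apply: le_lt_trans tc; rewrite /B.
  have v1 : `|t| * normc (v 0 j) <= `|t| * enorm v by rewrite ler_wpM2l ?normc_le_enorm.
  have w1 : `|s| * normc (w 0 j) <= `|t * a| * enorm w.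
    by apply: ler_pM; rewrite ?normc_ge0 ?normc_le_enorm.
  by rewrite normrM in w1; have := normr_ge0 t; lra.
have {}H := H t td.
rewrite !add0r scale0r addr0 in H *.
have -> : p + t%:C *: (v + a%:C *: w) = p + t%:C *: v + (t * a)%:C *: w.
  by rewrite scalerDr scalerA -rmorphM addrA.
pose F (s : R) := f (p + t%:C *: v + s%:C *: w).
have F0 : f (p + t%:C *: v) = F 0 by rewrite /F scale0r addr0.
have dF (s : R) : `|s| <= `|t * a| ->
    is_derive s 1 F (rderiv w f (p + t%:C *: v + s%:C *: w)).
  by move=> /near[Us _]; exact: segment_is_derive.
have lin (s : R) : is_derive s 1 (fun x : R => rderiv w f p * x) (rderiv w f p * 1).
  exact: (@is_deriveZ R R R id (rderiv w f p) s 1 1 (is_derive_id s 1)).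
have K : `|(F (t * a) - F 0) - rderiv w f p * (t * a)| <=
    e / 2 / (`|a| + 1) * `|t * a|.
  have [ta|ta] := leP 0 (t * a).
    have b s : 0 <= s <= t * a -> `|s| <= `|t * a|.
      by move=> /andP[s0 s1]; rewrite !ger0_norm.
    have := mean_value_approx ta (fun s ss => dF s (b s ss)) (fun s _ => lin s).
    move=> /(_ (e / 2 / (`|a| + 1))); rewrite mulr0 !subr0 (ger0_norm ta).
    apply; move=> s /b /near[_]; by rewrite mulr1.
  have b s : t * a <= s <= 0 -> `|s| <= `|t * a|.
    by move=> /andP[s0 s1]; rewrite !ler0_norm ?lerN2 // ltW.
  have := mean_value_approx (ltW ta) (fun s ss => dF s (b s ss)) (fun s _ => lin s).
  move=> /(_ (e / 2 / (`|a| + 1))); rewrite mulr0 !sub0r (ltr0_norm ta).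
  move=> H1; rewrite -normrN (_ : - (F (t * a) - F 0 - rderiv w f p * (t * a)) =
      F 0 - F (t * a) - - (rderiv w f p * (t * a))).
    by apply: H1 => s /b /near[_]; rewrite mulr1.
  by ring.
have K2 : e / 2 / (`|a| + 1) * `|t * a| <= e / 2 * `|t|.
  rewrite normrM (_ : _ * _ = e / 2 * `|t| * (`|a| / (`|a| + 1))); last by ring.
  apply: ler_piMr; first exact: mulr_ge0 (ltW e2) (normr_ge0 t).
  by rewrite ler_pdivrMr // mul1r lerDl ler01.
rewrite scale0r addr0.
rewrite (_ : _ - _ - _ = (F (t * a) - F 0 - rderiv w f p * (t * a)) +
    (f (p + t%:C *: v) - f p - rderiv v f p * t)); last by rewrite F0 /F; ring.
by apply: le_trans (ler_normD _ _) _; lra.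
Qed.

End DirectionalDerivatives.

(** Subtracting (l v + e) u from v puts it on the negative side of l, so L v <= (l v + e) L u for
    every e > 0; applying the limit also to - v gives equality. *)
Lemma half_space_proportional (R : realType) (V : lmodType R[i]) (L l : V -> R) (u : V) :
  (forall v (a : R), L (v + a%:C *: u) = L v + a * L u) ->
  (forall v (a : R), l (v + a%:C *: u) = l v + a) ->
  (forall v, L (- v) = - L v) -> (forall v, l (- v) = - l v) ->
  (forall v, l v < 0 -> L v <= 0) -> forall v, L v = L u * l v.
Proof.
move=> LD lD LN lN neg.
have le v : L v <= l v * L u.
  have key (e : R) : 0 < e -> L v <= (l v + e) * L u.
    move=> e0; have := neg (v + (- (l v + e))%:C *: u).
    rewrite lD LD (_ : l v + _ = - e); last by ring.
    by rewrite oppr_lt0 => /(_ e0); lra.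
  have [u0|u0] := leP (L u) 0; first by have := key 1 ltr01; lra.
  rewrite leNgt; apply/negP => H.
  have e0 : 0 < (L v - l v * L u) / (2 * L u).
    by rewrite divr_gt0 ?mulr_gt0 // subr_gt0.
  have := key _ e0; rewrite mulrDl.
  rewrite (_ : (L v - l v * L u) / (2 * L u) * L u = (L v - l v * L u) / 2).
    by lra.
  by field; rewrite gt_eqF.
move=> v; apply/le_anti/andP; split; first by rewrite mulrC.
by have := le (- v); rewrite LN lN; lra.
Qed.

Section TangentSpace.
Context {R : realType} {n : nat}.
Local Notation C := R[i].
Local Notation V := 'rV[R[i]]_n.+1.
Variable phi : R -> R.
Hypothesis dphi : forall x : R, is_derive x 1 phi (derive1 phi x).

(** The vector N that represents the differential of rho: d rho (v) = Re <v, N>. The complex tangent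
    space will be its Hermitian orthogonal. *)
Definition conormal (p : V) : V :=
  \row_j (if j == ord0 then 1 else (2 * derive1 phi (sqtan p))%:C * p 0 j).

Lemma rho_directional (p v : V) :
  is_derive (0 : R) 1 (fun t : R => rho phi (p + t%:C *: v))
    (complex.Re (dotmx v (conormal p))).
Proof.
pose A := \sum_(j < n.+1 | j != ord0) complex.Re (v 0 j * (p 0 j)^*%C).
have sqE (t : R) : sqtan (p + t%:C *: v) =
    sqtan p + (2 * A) * t + sqtan v * (t * t).
  rewrite /sqtan /A mulr_sumr !mulr_suml -!big_split; apply: eq_bigr => j _.
  rewrite !mxE; case: (v 0 j) (p 0 j) => [x y] [x' y']; rewrite /sqmod /=; ring.
have ds : is_derive (0 : R) 1 (fun t : R => sqtan (p + t%:C *: v)) (2 * A).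
  apply: is_derive_from_approx => e e0.
  have B0 : 0 < sqtan v + 1 by rewrite ltr_wpDl ?sqtan_ge0.
  exists (e / (sqtan v + 1)); first exact: divr_gt0.
  move=> h; rewrite ltr_pdivlMr // => hd; rewrite !sqE add0r !mulr0 !addr0.
  rewrite (_ : _ - _ - _ = (sqtan v * h) * h); last by ring.
  rewrite normrM ler_wpM2r // normrM (ger0_norm (sqtan_ge0 v)).
  by have := normr_ge0 h; lra.
have dR : is_derive (0 : R) 1 (fun t : R => complex.Re ((p + t%:C *: v) 0 ord0))
    (complex.Re (v 0 ord0)).
  apply: is_derive_from_approx => e e0; exists 1 => // h _.
  rewrite !mxE !cReD !cRe_realM add0r mul0r addr0.
  rewrite (_ : _ - _ - _ = 0) ?normr0 ?mulr_ge0 ?(ltW e0) //; ring.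
have := is_derive1_comp (dphi _) ds => dc.
have -> : complex.Re (dotmx v (conormal p)) = complex.Re (v 0 ord0) +
    derive1 phi (sqtan (p + 0%:C *: v)) * (2 * A).
  rewrite scale0r addr0 dotmx_sum (bigD1 ord0) //= cReD; congr (_ + _).
    by rewrite mxE eqxx conjc1 mulr1.
  rewrite cRe_sum /A !mulr_sumr; apply: eq_bigr => j j0.
  rewrite mxE (negbTE j0) cjM conjc_real mulrCA cRe_realM; ring.
exact: is_deriveD dR dc.
Qed.

Variables (D U : set V) (p : V).
Hypothesis oD : open D.
Hypothesis Up : nbhs p U.
Hypothesis DU : D `&` U = [set z | U z /\ rho phi z < 0].
Hypothesis bp : bd D p.

Lemma bd_not_in : ~ D p.
Proof. by move=> Dp; apply: bp.2; apply: open_nbhs_nbhs. Qed.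

Lemma rho_bd : rho phi p = 0.
Proof.
have cphi : continuous phi.
  move=> x; apply: differentiable_continuous; apply/derivable1_diffP.
  by have [] := dphi x.
apply/(bd_rho (D := D)) => //.
apply: filterS Up => z Uz; split=> [Dz|rz].
  have : (D `&` U) z by [].
  by rewrite DU => -[].
have : [set z | U z /\ rho phi z < 0] z by [].
by rewrite -DU => -[].
Qed.

Lemma inward_in_D (v : V) : complex.Re (dotmx v (conormal p)) < 0 ->
  exists2 d : R, 0 < d & forall t : R, 0 < t < d -> D (p + t%:C *: v).
Proof.
move=> v0; have e0 : 0 < - complex.Re (dotmx v (conormal p)) / 2.
  by rewrite divr_gt0 // oppr_gt0.
have [d d0 H] := is_derive_approx (rho_directional p v) e0.
have := @line_continuous R n p v 0 U; rewrite scale0r addr0 => /(_ Up).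
move=> /nbhs_normP[c /= c0 Hc].
exists (Num.min d c); first by rewrite lt_min d0.
move=> t /andP[t0]; rewrite lt_min => /andP[td tc].
have Ut : U (p + t%:C *: v).
  by apply: Hc; rewrite /ball_ /= sub0r normrN gtr0_norm.
suff : (D `&` U) (p + t%:C *: v) by case.
rewrite DU; split=> //.
have := H t; rewrite gtr0_norm // add0r scale0r addr0 rho_bd => /(_ td).
by rewrite ler_norml => /andP[_]; nra.
Qed.

(** Directions in which rho decreases enter D, where f < 0, while f p >= 0; hence df <= 0 on them
    and df is a multiple of d rho. The multiple is nonzero since df is nonzero at p. *)
Lemma rderiv_proportional (W : set V) (f : V -> R) : local_defining D p W f ->
  exists2 c : R, c != 0 & forall v, rderiv v f p = c * complex.Re (dotmx v (conormal p)).
Proof.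
move=> [oW Wp sf DW nz].
have fp : 0 <= f p.
  rewrite leNgt; apply/negP => fp; apply: bd_not_in.
  have : [set z | W z /\ f z < 0] p by [].
  by rewrite -DW => -[].
pose L v := rderiv v f p.
have Lneg v : complex.Re (dotmx v (conormal p)) < 0 -> L v <= 0.
  move=> /inward_in_D[d d0 Hd]; rewrite leNgt; apply/negP => Lv.
  have Lv2 : 0 < L v / 2 by exact: divr_gt0.
  have [e e0 He] := is_derive_approx (rderiv_is_derive sf v Wp) Lv2.
  have := @line_continuous R n p v 0 W; rewrite scale0r addr0.
  have WW : nbhs p W by apply: open_nbhs_nbhs.
  move=> /(_ WW) /nbhs_normP[c /= c0 Hc].
  pose t := Num.min (Num.min d e) c / 2.
  have m0 : 0 < Num.min (Num.min d e) c by rewrite !lt_min d0 e0.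
  have t0 : 0 < t by exact: divr_gt0.
  have tm : t < Num.min (Num.min d e) c by rewrite /t; lra.
  have : t < Num.min (Num.min d e) c by [].
  rewrite !lt_min => /andP[/andP[td te] tc].
  have Wt : W (p + t%:C *: v).
    by apply: Hc; rewrite /ball_ /= sub0r normrN gtr0_norm.
  have : (D `&` W) (p + t%:C *: v) by split=> //; apply: Hd; rewrite t0.
  rewrite DW => -[_ ft].
  have := He t; rewrite gtr0_norm // add0r scale0r addr0 => /(_ te).
  by rewrite ler_norml -/(L v) => /andP[+ _]; nra.
have [u0 Ru0] : exists u0 : V, complex.Re (dotmx u0 (conormal p)) = 1.
  exists (1 *: delta_mx 0 ord0); rewrite dotmx_delta_l mxE eqxx conjc1 mulr1 //.
pose l v := complex.Re (dotmx v (conormal p)).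
have LD v (a : R) : L (v + a%:C *: u0) = L v + a * L u0.
  exact: (rderivD oW sf).
have lD v (a : R) : l (v + a%:C *: u0) = l v + a.
  rewrite /l dotmxDl dotmxZl; move: (dotmx v _) => y.
  rewrite cReD; congr (_ + _).
  rewrite cRe_realM.
  by rewrite Ru0 mulr1.
have eqL : forall v, L v = L u0 * l v.
  apply: (@half_space_proportional _ _ L l u0) => // v.
    exact: (rderivN sf).
  by rewrite /l -[- v]scaleN1r dotmxZl mulN1r cReN.
exists (L u0) => //.
apply/eqP => L0; have [v /eqP] := nz p Wp bp.
by rewrite -/(L v) eqL L0 mul0r.
Qed.

(** Proportionality, evaluated on e_j and i e_j, gives df / dz_j = (c / 2) times the conjugate of
    N_j. *)
Lemma dform_conormal (W : set V) (f : V -> R) (v : V) : local_defining D p W f ->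
  (dform f p v = 0 <-> dotmx v (conormal p) = 0).
Proof.
move=> /rderiv_proportional[c c0 Hc].
have dzE j : dz j (fun w => (f w)%:C) p = (c / 2)%:C * (conormal p 0 j)^*%C.
  have cd w : cderiv w (fun w => (f w)%:C) p = (rderiv w f p)%:C.
    rewrite /cderiv /=; congr (_ +i* _).
    by rewrite /rderiv derive1E derive_cst.
  rewrite /dz !cd !Hc -[delta_mx 0 j]scale1r scalerA !dotmx_delta_l.
  rewrite mulr1 mul1r; case: (conormal p 0 j) => x y.
  by apply/eqP; rewrite eq_complex /=; apply/andP; split; apply/eqP; field.
have -> : dform f p v = (c / 2)%:C * dotmx v (conormal p).
  rewrite /dform dotmx_sum mulr_sumr; apply: eq_bigr => j _.
  by rewrite dzE -mulrA (mulrC (v 0 j)).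
have c2 : (c / 2)%:C != 0 :> C by rewrite realc_eq0 mulf_neq0 // invr_neq0.
by split=> [/eqP|->]; rewrite ?mulr0 // mulf_eq0 (negbTE c2) => /eqP.
Qed.

Hypothesis hdef : exists W f, local_defining D p W f.

Lemma ctangentE v : ctangent D p v <-> dotmx v (conormal p) = 0.
Proof.
split=> [[W [f [ld fv]]]|dv]; first exact/(dform_conormal v ld).
have [W [f ld]] := hdef; exists W, f; split=> //.
exact/(dform_conormal v ld).
Qed.

Lemma sqnorm_conormal : sqnorm (conormal p) = 1 + tnorm (conormal p) ^+ 2.
Proof.
rewrite sqnorm_split tnorm_sqr mxE eqxx /sqmod /= expr1n expr0n addr0 //.
Qed.

(** Removing the projection on N gives a tangent vector of the required kind; the difference of two
    such vectors is tangent and orthogonal to the tangent space, so the one selected by [xget] is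
    this one. *)
Lemma nor_partE (xi : V) : nor_part D p xi =
  (dotmx xi (conormal p) / (sqnorm (conormal p))%:C) *: conormal p.
Proof.
set N := conormal p; set c := _ / _.
have N0 : (sqnorm N)%:C != 0 :> C.
  rewrite realc_eq0 sqnorm_conormal gt_eqF // ltr_wpDr ?sqr_ge0 //.
have cN : dotmx (xi - c *: N) N = 0.
  by rewrite dotmxBl dotmxZl dotmxx /c mulfVK // subrr.
have perp w : ctangent D p w -> dotmx (c *: N) w = 0.
  move=> /ctangentE wN; rewrite dotmxZl dotmx_conj wN conjc0 mulr0 //.
rewrite /nor_part /tan_part; set A := [set v | _].
have [] : A (xget 0 A).
  apply: xgetPex; exists (xi - c *: N); split; first exact/ctangentE.
  by move=> w Tw; rewrite opprB addrC subrK; exact: perp.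
move: (xget 0 A) => v Tv pv.
have Tu : ctangent D p (xi - c *: N - v).
  apply/ctangentE; rewrite dotmxBl cN sub0r.
  by have /ctangentE -> := Tv; rewrite oppr0.
have uu : dotmx (xi - c *: N - v) (xi - c *: N - v) = 0.
  by rewrite [X in dotmx X _]addrAC dotmxBl perp // subr0; exact: pv.
have : xi - c *: N - v = 0.
  apply/eqP; apply: contraT => /dotmx_is_dotmx.
  by rewrite uu ltxx.
by move=> /eqP; rewrite subr_eq0 => /eqP <-; rewrite opprB addrC subrK.
Qed.

Lemma tan_partE (xi : V) : tan_part D p xi = xi - nor_part D p xi.
Proof. by rewrite /nor_part opprB addrC subrK. Qed.

Lemma enorm_le_split (z : V) : enorm z <= normc (z 0 ord0) + tnorm z.
Proof.
rewrite -[leRHS]ger0_norm ?addr_ge0 ?normc_ge0 ?tnorm_ge0 // -sqrtr_sqr ler_wsqrtr //.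
rewrite -/(sqnorm z) sqnorm_split -tnorm_sqr -normc_sqr.
by have := mulr_ge0 (normc_ge0 (z 0 ord0)) (tnorm_ge0 z); rewrite sqrrD; lra.
Qed.

Lemma tnorm_conormal : tnorm (conormal p) = `|2 * derive1 phi (sqtan p)| * tnorm p.
Proof.
rewrite -normc_real -tnormZ /tnorm; congr Num.sqrt; apply: eq_bigr => j j0.
by rewrite !mxE (negbTE j0).
Qed.

(** N differs from e_1 by its tangential part, of norm delta. A termwise bound of the inner product
    costs (n + 1) delta |xi|, the normalization one more, and such an error occurs twice. *)
Lemma parts_close (xi : V) : tnorm (conormal p) <= 1 ->
  let K := 2 * n.+2%:R * tnorm (conormal p) * enorm xi in
  `|enorm (nor_part D p xi) - normc (xi 0 ord0)| <= K /\
  `|enorm (tan_part D p xi) - tnorm xi| <= K.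
Proof.
move=> d1 K; rewrite tan_partE nor_partE.
set N := conormal p in d1 K *; set del := tnorm N in d1 K *.
set c := _ / _; set e := enorm xi in K *.
have e0 : 0 <= e by exact: enorm_ge0.
have del0 : 0 <= del by exact: tnorm_ge0.
pose tau := \sum_(j < n.+1 | j != ord0) xi 0 j * (N 0 j)^*%C.
have etaE : dotmx xi N = xi 0 ord0 + tau.
  by rewrite dotmx_sum (bigD1 ord0) //= mxE eqxx conjc1 mulr1.
have tri (I : Type) (s : seq I) (P : pred I) (G : I -> C) :
    normc (\sum_(i <- s | P i) G i) <= \sum_(i <- s | P i) normc (G i).
  elim/big_rec2: _ => [|i a b _ ab]; first by rewrite normc0.
  by apply: le_trans (ler_normcD _ _) _; rewrite lerD2l.
have normcJ (w : C) : normc w^*%C = normc w by case: w => a b; rewrite /= sqrrN.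
have tau_le : normc tau <= n.+1%:R * (e * del).
  apply: le_trans (tri _ _ _ _) _.
  apply: le_trans (_ : \sum_(j < n.+1 | j != ord0) e * del <= _).
    apply: ler_sum => j j0; rewrite normcM normcJ.
    apply: ler_pM; rewrite ?normc_ge0 ?normc_le_enorm //.
    rewrite -[leLHS]ger0_norm ?normc_ge0 // -sqrtr_sqr ler_wsqrtr // normc_sqr.
    rewrite /sqtan (bigD1 j) //= lerDl.
    by apply: sumr_ge0 => i _; exact: sqmod_ge0.
  rewrite sumr_const -[leLHS]mulr_natl; apply: ler_wpM2r; first exact: mulr_ge0.
  by rewrite ler_nat -[leqRHS]card_ord max_card.
have a_le : normc (xi 0 ord0) <= e by exact: normc_le_enorm.
have sE : sqnorm N = 1 + del ^+ 2 by exact: sqnorm_conormal.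
have s1 : 1 <= sqnorm N by rewrite sE lerDl sqr_ge0.
have s0 : 0 < sqnorm N by exact: lt_le_trans s1.
have sC : (sqnorm N)%:C != 0 :> C by rewrite realc_eq0 gt_eqF.
have nV (w : C) : normc (w / (sqnorm N)%:C) <= normc w.
  rewrite normcM normcV normc_real ger0_norm ?(ltW s0) //.
  by rewrite ler_piMr ?normc_ge0 // invf_le1.
have nS : n.+2%:R = n.+1%:R + 1 :> R by rewrite -natr1.
have n1 : 0 <= n.+1%:R :> R by [].
have c_le : normc c <= n.+2%:R * e.
  apply: le_trans (nV _) _; rewrite etaE; apply: le_trans (ler_normcD _ _) _.
  have : n.+1%:R * (e * del) <= n.+1%:R * e.
    by rewrite ler_wpM2l // ler_piMr.
  by rewrite nS; lra.
have ca_le : normc (c - xi 0 ord0) <= n.+2%:R * (e * del).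
  have -> : c - xi 0 ord0 = (tau - xi 0 ord0 * (del ^+ 2)%:C) / (sqnorm N)%:C.
    by apply: (mulIf sC); rewrite mulrBl /c !mulfVK // etaE sE realcD; ring.
  apply: le_trans (nV _) _; apply: le_trans (ler_normcB _ _) _.
  rewrite normcM normc_real ger0_norm ?sqr_ge0 //.
  have : normc (xi 0 ord0) * del ^+ 2 <= e * del.
    by rewrite ler_pM ?normc_ge0 ?sqr_ge0 // expr2 ler_piMr.
  by rewrite nS mulrDl mul1r; lra.
have ca : `|normc c - normc (xi 0 ord0)| <= n.+2%:R * (e * del).
  apply: le_trans ca_le; rewrite ler_norml; apply/andP; split.
    by have := ler_normcD (xi 0 ord0 - c) c; rewrite subrK (normcB (xi 0 ord0)); lra.
  by have := ler_normcD (c - xi 0 ord0) (xi 0 ord0); rewrite subrK; lra.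
have KE : K = n.+2%:R * (e * del) + n.+2%:R * (e * del) by rewrite /K; ring.
have cd : normc c * del <= n.+2%:R * (e * del) by rewrite mulrA ler_wpM2r.
have c0 := normc_ge0 c.
split.
- rewrite enormZ.
  have N2 : enorm N ^+ 2 = 1 + del ^+ 2 by rewrite enorm_sqr.
  have N0 := enorm_ge0 N.
  have [N1 Nd] : 1 <= enorm N /\ enorm N <= 1 + del by split; nra.
  have -> : normc c * enorm N - normc (xi 0 ord0) =
     normc c * (enorm N - 1) + (normc c - normc (xi 0 ord0)) by ring.
  apply: le_trans (ler_normD _ _) _; rewrite KE lerD //.
  rewrite normrM (ger0_norm c0) ger0_norm ?subr_ge0 //.
  by apply: le_trans cd; rewrite ler_wpM2l // lerBlDl.
- have t1 := tnormD xi (- (c *: N)).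
  have t2 := tnormD (xi - c *: N) (c *: N).
  rewrite subrK tnormN !tnormZ -/del in t1 t2.
  have t3 := enorm_le_split (xi - c *: N).
  have t4 := tnorm_le_enorm (xi - c *: N).
  have z0 : (xi - c *: N) 0 ord0 = xi 0 ord0 - c.
    by rewrite !mxE eqxx mulr1.
  rewrite z0 normcB in t3.
  by rewrite KE ler_norml; apply/andP; split; lra.
Qed.

End TangentSpace.

(** * Bounds for the Kobayashi metric *)

Section KobayashiBounds.
Context {R : realType} {n : nat}.
Local Notation C := R[i].
Local Notation V := 'rV[R[i]]_n.+1.
Implicit Types (D : set V) (z xi : V).

Definition kobayashi_set D z xi : set R :=
  [set a : R | 0 < a /\ exists f,
     [/\ holo_disc D f, f 0 = z & derive1 f 0 = (a^-1)%:C *: xi]].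

Lemma sqtan_lift z : sqtan z = \sum_(j < n) sqmod (z 0 (lift ord0 j)).
Proof.
have := sqnorm_split z; rewrite /sqnorm big_ord_recl => /addrI ->.
by [].
Qed.

Lemma disc_derive_le (D : set V) (phi : R -> R) (e0 eta r y a : R) (f : C -> V) (z xi : V) :
  exp_flat phi -> (forall x, 0 < x < e0 -> 0 < derive1n 2 phi x) ->
  eta <= e0 -> (forall z, D z -> sqnorm z < eta -> rho phi z < 0) ->
  0 < r < 1 -> 0 < y < e0 -> phi y = - complex.Re (z 0 ord0) -> 0 < a ->
  holo_disc D f -> f 0 = z -> derive1 f 0 = (a^-1)%:C *: xi ->
  (forall w, normc w <= r -> sqnorm (f w) < eta) ->
  r * normc (xi 0 ord0) <= a * (2 * - complex.Re (z 0 ord0)) /\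
  r * tnorm xi <= a * Num.sqrt y.
Proof.
move=> hphi hconv etae Drho /andP[r0 r1] y0 py a0 hf f0 df loc.
have e00 : 0 < e0 by case/andP: y0 => y0; exact: lt_trans.
have rneg w : normc w < r -> rho phi (f w) < 0 /\ 0 <= sqtan (f w) < e0.
  move=> wr; have w1 : normc w < 1 by exact: lt_trans r1.
  have lw := loc w (ltW wr).
  split; first by apply: Drho => //; case: (holo_discP hf w1).
  by rewrite sqtan_ge0 (le_lt_trans (sqtan_le_sqnorm _)) // (lt_le_trans lw).
have dw (w : C) j : normc w < r -> derivable (fun u : C => f u 0 j) w 1.
  move=> wr; have w1 : normc w < 1 by exact: lt_trans r1.
  have [_ /(_ j) H] := holo_discP hf w1.
  exact (@ex_derive _ _ _ _ _ _ _ H).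
have d0 j : is_derive (0 : C) 1 (fun u : C => f u 0 j) ((a^-1)%:C * xi 0 j).
  have w1 : normc (0 : C) < 1 by rewrite normc0.
  by have [_ /(_ j)] := holo_discP hf w1; rewrite df mxE.
have na : normc ((a^-1)%:C : C) = a^-1.
  by rewrite normc_real ger0_norm // invr_ge0 ltW.
split.
- have := @half_plane_derive_le R (fun u : C => f u 0 ord0) _ r r0 (fun w => dw w ord0) _ (d0 ord0).
  rewrite f0 normcM na => H.
  rewrite -ler_pdivrMl //.
  rewrite (_ : a^-1 * (r * _) = r * (a^-1 * normc (xi 0 ord0))); last by rewrite mulrCA.
  rewrite mulrN -mulNr; apply: H => w wr.
  have [H1 H2] := rneg w wr; have := flat_ge0 hphi hconv H2.
  by move: H1; rewrite /rho; lra.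
- have kp := flat_derive_gt0 hphi hconv y0.
  have y0' : 0 <= y < e0 by case/andP: y0 => /ltW -> ->.
  (* The tangent to phi at y yields Re f_1 + k |f'|^2 <= k y - phi y; since Re f_1 (0) = - phi y,
     the right hand side of the estimate becomes k y, and k > 0 cancels. *)
  pose k := derive1 phi y.
  have := @paraboloid_derive_le R n (fun u : C => f u 0 ord0)
    (fun j (u : C) => f u 0 (lift ord0 j)) (fun j => (a^-1)%:C * xi 0 (lift ord0 j))
    k (k * y - phi y) r r0 (ltW kp) (fun w => dw w ord0)
    (fun j w => dw w (lift ord0 j)) (fun j => d0 (lift ord0 j)).
  rewrite f0 py => H.
  have {H} : k * (r ^+ 2 * \sum_(j < n) sqmod ((a^-1)%:C * xi 0 (lift ord0 j))) <=
    k * y - - complex.Re (z 0 ord0) - complex.Re (z 0 ord0).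
    apply: H => w wr; rewrite -sqtan_lift.
    have [H1 H2] := rneg w wr; have := flat_convex hphi hconv H2 y0'.
    by move: H1; rewrite /rho -py -/k; lra.
  rewrite (_ : k * y - _ - _ = k * y); last by ring.
  rewrite ler_pM2l // => H.
  have {H} : (r * a^-1 * tnorm xi) ^+ 2 <= y.
    have E : \sum_(j < n) sqmod ((a^-1)%:C * xi 0 (lift ord0 j)) = a^-1 ^+ 2 * sqtan xi.
      rewrite sqtan_lift mulr_sumr; apply: eq_bigr => j _.
      by rewrite sqmodM -normc_sqr na.
    by rewrite !exprMn tnorm_sqr -mulrA -E.
  move=> H; rewrite -ler_pdivrMl //.
  rewrite (_ : a^-1 * _ = r * a^-1 * tnorm xi); last by ring.
  rewrite -[leLHS]ger0_norm; last first.
    exact: mulr_ge0 (divr_ge0 (ltW r0) (ltW a0)) (tnorm_ge0 xi).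
  by rewrite -sqrtr_sqr ler_wsqrtr.
Qed.

(** With m = b w one has |1 + A m|^2 - |A + m|^2 = (1 - A^2) (1 - |m|^2). *)
Lemma moebius_disc (A : R) (b w : C) : 0 <= A < 1 -> normc b <= 1 -> normc w < 1 ->
  1 + A%:C * b * w != 0 /\
  normc (A%:C + b * w) < normc (1 + A%:C * b * w).
Proof.
move=> /andP[A0 A1] b1 w1; rewrite -mulrA; set m := b * w.
have m1 : sqmod m < 1.
  rewrite /m sqmodM -!normc_sqr.
  have := normc_ge0 b; have := normc_ge0 w => w0 b0.
  by rewrite -exprMn expr_lt1 // ?mulr_ge0 //; nra.
have H : normc (A%:C + m) < normc (1 + A%:C * m).
  rewrite -(ltr_pXn2r (n := 2)) ?nnegrE ?normc_ge0 // !normc_sqr.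
  have A2 : 0 < 1 - A ^+ 2 by rewrite subr_gt0 expr_lt1.
  have := mulr_gt0 A2 (_ : 0 < 1 - sqmod m); rewrite subr_gt0 => /(_ m1).
  by case: m {m1} => x y; rewrite /sqmod /= => ?; lra.
split=> //; rewrite -normc_gt0; exact: le_lt_trans (normc_ge0 _) H.
Qed.

(* The first coordinate is a Moebius map into the disc of radius [K] centred at
   [z_1 - (K - x1)], which lies in [Re < Re z_1 + x1]; the others are affine. *)
Lemma disc_exists (D : set V) (phi : R -> R) (eta a x1 K S : R) (z xi : V) :
  (forall u : V, sqnorm u < eta -> rho phi u < 0 -> D u) ->
  0 < a -> 0 < x1 <= K ->
  tnorm z + tnorm xi / a <= S ->
  (forall u, 0 <= u <= S ^+ 2 -> phi u <= - complex.Re (z 0 ord0) - x1) ->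
  (normc (z 0 ord0) + 2 * K) ^+ 2 + S ^+ 2 < eta ->
  normc (xi 0 ord0) <= a * (2 * x1 - x1 ^+ 2 / K) ->
  kobayashi_set D z xi a.
Proof.
move=> inD a0 /andP[x10 x1K] tS phiS small xi0.
have K0 : 0 < K by exact: lt_le_trans x1K.
(* Chosen so that the centre is mapped to z_1; the derivative there is then K (1 - A^2) b, and K (1
   - A^2) is the q below. *)
pose A := (K - x1) / K.
have A01 : 0 <= A < 1.
  by rewrite divr_ge0 ?subr_ge0 ?(ltW K0) //= ltr_pdivrMr // mul1r gtrBl.
have q0 : 0 < 2 * x1 - x1 ^+ 2 / K.
  have : x1 ^+ 2 / K <= x1 by rewrite ler_pdivrMr // expr2 ler_wpM2l // ltW.
  by lra.
pose q := 2 * x1 - x1 ^+ 2 / K.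
have qE : q = K * (1 - A ^+ 2).
  by rewrite /q /A; field; rewrite gt_eqF.
(* Makes the derivative at 0 equal to xi_1 / a; the hypothesis on xi_1 says exactly that |b| <=
   1. *)
pose b : C := (a * q)^-1%:C * xi 0 ord0.
have b1 : normc b <= 1.
  rewrite normcM normc_real ger0_norm ?invr_ge0 ?mulr_ge0 ?(ltW a0) ?(ltW q0) //.
  by rewrite mulrC ler_pdivrMr ?mulr_gt0 // mul1r.
pose c := z 0 ord0 - (K * A)%:C.
pose g (w : C) : C := c + K%:C * ((A%:C + b * w) * (1 + A%:C * b * w)^-1).
have gd (w : C) : normc w < 1 -> is_derive w 1 g
   (0 + K%:C * ((A%:C + b * w) * (- (1 + A%:C * b * w) ^- 2 * (0 + A%:C * b * 1)) +
     (1 + A%:C * b * w)^-1 * (0 + b * 1))).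
  move=> w1; have [nz _] := moebius_disc A01 b1 w1.
  have lin (u : C) := is_derive_scalec u (is_derive_idc w).
  have h1 := is_derive_addc (is_derive_cstc w A%:C) (lin b).
  have h2 := is_derive_addc (is_derive_cstc w 1) (lin (A%:C * b)).
  have h3 := is_derive_invc h2 nz.
  exact (is_derive_addc (is_derive_cstc w c) (is_derive_scalec K%:C (is_derive_mulc h1 h3))).
pose f (w : C) : V := \row_j if j == ord0 then g w else z 0 j + ((a^-1)%:C * xi 0 j) * w.
have f00 w : f w 0 ord0 = g w by rewrite mxE eqxx.
have fj w j : j != ord0 -> f w 0 j = z 0 j + ((a^-1)%:C * xi 0 j) * w.
  by move=> j0; rewrite mxE (negbTE j0).
pose f' (w : C) : V := \row_j if j == ord0 then
   (0 + K%:C * ((A%:C + b * w) * (- (1 + A%:C * b * w) ^- 2 * (0 + A%:C * b * 1)) +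
     (1 + A%:C * b * w)^-1 * (0 + b * 1))) else (0 + ((a^-1)%:C * xi 0 j) * 1).
have fd (w : C) : normc w < 1 -> derivable f w 1 /\ derive1 f w = f' w.
  move=> w1; apply: is_derive_rV => j; rewrite /f' mxE.
  case: ifPn => [/eqP->|j0].
    rewrite (_ : (fun u : C => f u 0 ord0) = g); first exact: gd.
    by apply/funext => u; rewrite f00.
  rewrite (_ : (fun u : C => f u 0 j) = fun u : C => z 0 j + ((a^-1)%:C * xi 0 j) * u).
    exact (is_derive_addc (is_derive_cstc w _) (is_derive_scalec _ (is_derive_idc w))).
  by apply/funext => u; rewrite fj.
split=> //; exists f; split.
- move=> w; rewrite cnormE -[1]/(1%:C) ltcR => w1; split; first by case: (fd w w1).
  have [nz ml] := moebius_disc A01 b1 w1.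
  set h := (A%:C + b * w) * (1 + A%:C * b * w)^-1.
  have h1 : normc h < 1.
    by rewrite normcM normcV ltr_pdivrMr ?mul1r // normc_gt0.
  have gE : g w = c + K%:C * h by [].
  have tf : tnorm (f w) <= S.
    apply: le_trans tS.
    rewrite (_ : tnorm (f w) = tnorm (z + (w * (a^-1)%:C) *: xi)); last first.
      rewrite /tnorm; congr Num.sqrt; apply: eq_bigr => j j0.
      by rewrite fj // !mxE; congr (sqmod (_ + _)); rewrite mulrC mulrA.
    apply: le_trans (tnormD _ _) _; rewrite lerD2l tnormZ normcM normc_real.
    rewrite ger0_norm ?invr_ge0 ?(ltW a0) // mulrAC mulrC.
    rewrite [leRHS]mulrC ler_wpM2l ?invr_ge0 ?(ltW a0) //.
    by rewrite ler_piMl ?tnorm_ge0 // ltW.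
  have t0 := tnorm_ge0 (f w).
  have tf2 : 0 <= sqtan (f w) <= S ^+ 2.
    by rewrite sqtan_ge0 -tnorm_sqr lerXn2r // nnegrE // (le_trans t0).
  have Kh : normc (K%:C * h) <= K.
    by rewrite normcM normc_real ger0_norm ?(ltW K0) // ler_piMr ?(ltW K0) // ltW.
  have KA : K * A = K - x1 by rewrite /A mulrCA mulfV ?mulr1 // gt_eqF.
  have ng : normc (g w) <= normc (z 0 ord0) + 2 * K.
    rewrite gE /c; apply: le_trans (ler_normcD _ _) _.
    have := ler_normcB (z 0 ord0) (K * A)%:C; rewrite normc_real KA ger0_norm ?subr_ge0 //.
    by lra.
  apply: inD.
    rewrite sqnorm_split f00 -normc_sqr; apply: le_lt_trans small.
    case/andP: tf2 => _ tf2; apply: lerD => //.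
    by rewrite lerXn2r ?nnegrE ?normc_ge0 // (le_trans (normc_ge0 _) ng).
  rewrite /rho f00 gE cReD cRe_realM /c cReB /= KA.
  have := phiS _ tf2; have := ler_Re_normc h => hR.
  have Rh : complex.Re h < 1 by rewrite (le_lt_trans (ler_norm _)) // (le_lt_trans hR).
  have : K * complex.Re h < K * 1 by rewrite ltr_pM2l.
  by lra.
- apply/rowP => j; have [->|j0] := eqVneq j ord0.
    rewrite f00 /g /c !mulr0 !addr0 invr1 mulr1 realcM subrK //.
  by rewrite fj // mulr0 addr0.
- have n01 : normc (0 : C) < 1 by rewrite normc0.
  have [_ ->] := fd 0 n01; apply/rowP => j; rewrite !mxE.
  have [->|j0] := eqVneq j ord0; last by rewrite add0r mulr1.
  rewrite !mulr0 !addr0 !add0r !mulr1 expr1n invr1 mulN1r mul1r mulrN mulrA.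
  rewrite -realcM -expr2 (_ : _ + b = (1 - A ^+ 2)%:C * b); last first.
    by rewrite realcB mulrBl mul1r addrC.
  rewrite mulrA -realcM -qE /b mulrA -realcM; congr (_%:C * _).
  by rewrite invfM mulrCA mulfV ?mulr1 // gt_eqF.
Qed.

End KobayashiBounds.

(** * Asymptotics *)

Section Scales.
Context {R : realType}.
Variables (phi : R -> R) (e0 : R).
Hypotheses (hphi : exp_flat phi) (e00 : 0 < e0)
  (hconv : forall x, 0 < x < e0 -> 0 < derive1n 2 phi x).

(** Y^2 is the inverse image of x under phi. The bounds up to Y (1 - k / 2) and from Y (1 + k / 2)
    on are the two limits in the definition of exponential flatness, extended by monotonicity; 4
    ymax < e0 keeps (2 Y)^2 where phi increases. *)
Lemma cone_scale (alpha N e k ymax : R) : 0 < alpha -> 0 < N ->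
  0 < e < 1 -> 0 < k <= 1 -> 0 < ymax -> ymax <= 1 -> 4 * ymax < e0 ->
  exists2 x0, 0 < x0 & forall x r : R, 0 < x < x0 -> 0 <= r -> alpha * r `^ N < x ->
  exists Y, [/\ 0 < Y, Y ^+ 2 < ymax, phi (Y ^+ 2) = x, r + 2 * x <= e * Y &
    [/\ forall u : R, 0 <= u <= (r + 2 * x) ^+ 2 -> 0 <= phi u <= e * x,
        forall u : R, 0 <= u <= (r + 2 * x) ^+ 2 -> `|derive1 phi u| <= e * x,
        forall u : R, 0 <= u <= (Y * (1 - k / 2)) ^+ 2 -> phi u <= e * x &
        forall u : R, (Y * (1 + k / 2)) ^+ 2 <= u <= (2 * Y) ^+ 2 -> 4 * x <= phi u]].
Proof.
move=> al0 N0 /andP[ep e1] /andP[k0 k1] ym0 ym1 yme.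
pose cs := (1 - k / 2) ^+ 2; pose cl := (1 + k / 2) ^+ 2.
have cs01 : 0 < cs < 1.
  by rewrite exprn_gt0 ?expr_lt1 //=; lra.
have cl1 : 1 < cl by rewrite expr_gt1 //; lra.
have [d1 d10 H1] := flat_ratio_small hphi e00 hconv cs01 ep.
have [d2 d20 H2] := flat_ratio_large hphi e00 hconv 4 cl1.
pose t := Num.min ymax (Num.min d1 d2) / 2.
have m0 : 0 < Num.min ymax (Num.min d1 d2) by rewrite !lt_min ym0 d10.
have [ty t1 t2] : [/\ t < ymax, t < d1 & t < d2].
  have : Num.min ymax (Num.min d1 d2) <= Num.min ymax (Num.min d1 d2) by [].
  by rewrite {2}/Num.min -/t; split; (apply: (@lt_le_trans _ _ (Num.min ymax (Num.min d1 d2)));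
    [rewrite /t ltr_pdivrMr //; lra | rewrite !ge_min lexx ?orbT]).
have t0 : 0 < t by rewrite /t divr_gt0.
have t0e : 0 < t < e0 by rewrite t0 /=; lra.
have pt0 := flat_gt0 hphi hconv t0e.
(* With B = e^-2 in [cone_flat], r + 2 x > e Y would put Y^2 in the range where phi <= e x, although
   phi (Y^2) = x. *)
have B0 : 0 < e ^- 2 by rewrite invr_gt0 exprn_gt0.
have [x1 x10 F0] := cone_flat hphi 0 al0 N0 B0 ep.
have [x2 x20 F1] := cone_flat hphi 1 al0 N0 B0 ep.
exists (Num.min (phi t) (Num.min x1 x2)); first by rewrite !lt_min pt0 x10.
move=> x r; rewrite !lt_min => /andP[x0 /and3P[xt xx1 xx2]] r0 cn.
have [|y /andP[y0 yt] py] := flat_inverse hphi t0e (x := x); first by rewrite x0.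
have sY : Num.sqrt y ^+ 2 = y by rewrite sqr_sqrtr // ltW.
have [_ {}F0] := F0 x r (introT andP (conj x0 xx1)) r0 cn.
have [_ {}F1] := F1 x r (introT andP (conj x0 xx2)) r0 cn.
have {}F0 (u : R) : 0 <= u <= e ^- 2 * (r + 2 * x) ^+ 2 -> `|phi u| <= e * x := F0 u.
have {}F1 (u : R) : 0 <= u <= e ^- 2 * (r + 2 * x) ^+ 2 -> `|derive1 phi u| <= e * x := F1 u.
have rx0 : 0 <= r + 2 * x by lra.
have Y0 : 0 < Num.sqrt y by rewrite sqrtr_gt0.
have rY : r + 2 * x <= e * Num.sqrt y.
  rewrite leNgt; apply/negP => h.
  have : y <= e ^- 2 * (r + 2 * x) ^+ 2.
    rewrite ler_pdivlMl ?exprn_gt0 // -sY -exprMn lerXn2r ?nnegrE //; last exact: ltW.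
    by rewrite mulr_ge0 // ltW.
  move=> yB; have := F0 y; rewrite (ltW y0) yB py /= ger0_norm ?(ltW x0) // => /(_ erefl).
  by rewrite leNgt gtr_pMl // e1.
have lB : (r + 2 * x) ^+ 2 <= e ^- 2 * (r + 2 * x) ^+ 2.
  rewrite ler_peMl ?sqr_ge0 // invf_ge1 ?exprn_gt0 // expr_le1 ?ltW //.
have ly : (r + 2 * x) ^+ 2 <= y.
  rewrite -[leRHS]sY lerXn2r ?nnegrE ?sqrtr_ge0 //.
  by apply: le_trans rY _; rewrite ler_piMl ?sqrtr_ge0 // ltW.
exists (Num.sqrt y); rewrite !exprMn sY -/cs -/cl; split=> //; first by lra.
split=> u /andP[u0 u1].
- have ue : 0 <= u < e0 by rewrite u0 /=; lra.
  rewrite (flat_ge0 hphi hconv ue) /=; apply: le_trans (ler_norm _) (F0 u _).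
  by rewrite u0 (le_trans u1).
- by apply: (F1 u); rewrite u0 (le_trans u1).
- have yd : 0 < y < d1 by rewrite y0 (lt_trans yt).
  have := H1 y yd; rewrite py; apply: le_trans.
  have cy : y * cs < e0.
    by case/andP: cs01 => _ c1; have := mulr_gt0 y0 (_ : 0 < 1 - cs); rewrite subr_gt0 => /(_ c1); lra.
  by rewrite mulrC (flat_mono hphi hconv u0 u1 cy).
- have yd : 0 < y < d2 by rewrite y0 (lt_trans yt).
  have := H2 y yd; rewrite py => /le_trans; apply.
  have ue : u < e0 by apply: le_lt_trans u1 _; rewrite (_ : (2 : R) ^+ 2 = 4) ?expr2; lra.
  have c0 : 0 <= y * cl by rewrite mulr_ge0 ?(ltW y0) // sqr_ge0.
  by rewrite mulrC (flat_mono hphi hconv c0 u0 ue).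
Qed.

End Scales.

Section Quotient.
Context {R : realType}.

(** Error bookkeeping; 40 e <= 1 absorbs the terms quadratic in e. For the lower bound it suffices
    to treat the quotient that attains the maximum X. *)
Lemma max_quotient_close (A B X x d Y t e nu tau : R) :
  0 < e -> 40 * e <= 1 -> 0 <= A -> 0 <= B -> 0 < x -> 0 < Y ->
  X = Num.max (A / (2 * x)) (B / Y) -> 0 < X ->
  (1 - e) * x <= d <= x -> (1 - 8 * e) * Y <= t <= (1 + 8 * e) * Y ->
  `|nu - A| <= e * (X * x) -> `|tau - B| <= e * (X * Y) / 2 ->
  (1 - 10 * e) * X <= Num.max (nu / (2 * d)) (tau / t) <= (1 + 12 * e) * X.
Proof.
move=> e0 e1 A0 B0 x0 Y0 XE X0 /andP[d1 d2] /andP[t1 t2] nA tB.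
have d0 : 0 < d by apply: lt_le_trans d1; rewrite mulr_gt0 //; lra.
have t0 : 0 < t by apply: lt_le_trans t1; rewrite mulr_gt0 //; lra.
have AX : A <= X * (2 * x).
  by rewrite -ler_pdivrMr ?mulr_gt0 // XE le_max lexx.
have BX : B <= X * Y by rewrite -ler_pdivrMr // XE le_max lexx orbT.
have Xx : 0 < X * x by rewrite mulr_gt0.
have XY : 0 < X * Y by rewrite mulr_gt0.
have eXx : 0 < e * (X * x) by rewrite mulr_gt0.
have eXY : 0 < e * (X * Y) by rewrite mulr_gt0.
have eeXx : 0 < e * (e * (X * x)) by rewrite mulr_gt0.
have eeXY : 0 < e * (e * (X * Y)) by rewrite mulr_gt0.
have e2x : 40 * (e * (e * (X * x))) <= e * (X * x).
  by have := ler_wpM2r (ltW eXx) e1; lra.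
have e2Y : 40 * (e * (e * (X * Y))) <= e * (X * Y).
  by have := ler_wpM2r (ltW eXY) e1; lra.
move: nA tB; rewrite !ler_distl => /andP[n1 n2] /andP[b1 b2].
apply/andP; split; last first.
  rewrite ge_max !ler_pdivrMr ?mulr_gt0 //; apply/andP; split.
    have h : 0 < (1 + 12 * e) * X by rewrite mulr_gt0 //; lra.
    have := ler_wpM2l (ltW h) d1; lra.
  have h : 0 < (1 + 12 * e) * X by rewrite mulr_gt0 //; lra.
  have := ler_wpM2l (ltW h) t1; lra.
rewrite le_max !ler_pdivlMr ?mulr_gt0 //.
have h : 0 < (1 - 10 * e) * X by rewrite mulr_gt0 //; lra.
have hd := ler_wpM2l (ltW h) d2; have ht := ler_wpM2l (ltW h) t2.
have [AB|AB] := leP (A / (2 * x)) (B / Y).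
  have XB : X * Y = B by rewrite XE max_r // divfK // gt_eqF.
  by apply/orP; right; lra.
have XA : X * (2 * x) = A by rewrite XE max_l ?ltW // divfK // gt_eqF // mulr_gt0.
by apply/orP; left; lra.
Qed.

Lemma quotient_close1 (K M X e : R) : 0 < e -> 40 * e <= 1 -> 0 < X ->
  (1 - e) * X <= K <= (1 + 10 * e) * X ->
  (1 - 10 * e) * X <= M <= (1 + 12 * e) * X -> `|K / M - 1| <= 40 * e.
Proof.
move=> e0 e1 X0 /andP[K1 K2] /andP[M1 M2].
have M0 : 0 < M by apply: lt_le_trans M1; rewrite mulr_gt0 //; lra.
have eX : 0 < e * X by rewrite mulr_gt0.
have e2 := ler_wpM2r (ltW eX) e1.
rewrite ler_distl ler_pdivlMr // ler_pdivrMr //; apply/andP; split.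
  have h : 0 <= 1 - 40 * e by lra.
  have := ler_wpM2l h M2; have := mulr_gt0 e0 eX; lra.
have h : 0 <= 1 + 40 * e by lra.
have := ler_wpM2l h M1; lra.
Qed.

End Quotient.

(** * Two-sided estimate of the metric near the flat point *)

Section MetricEstimate.
Context {R : realType} {n : nat}.
Local Notation C := R[i].
Local Notation V := 'rV[R[i]]_n.+1.

(** The quantity X, to which both the Kobayashi metric and the denominator are compared. *)
Definition model_metric (xi : V) (x Y : R) : R :=
  Num.max (normc (xi 0 ord0) / (2 * x)) (tnorm xi / Y).

Lemma model_metric_le (xi : V) (x Y : R) : 0 < x -> 0 < Y ->
  normc (xi 0 ord0) <= model_metric xi x Y * (2 * x) /\ tnorm xi <= model_metric xi x Y * Y.
Proof.
move=> x0 Y0; rewrite -!ler_pdivrMr ?mulr_gt0 //.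
by rewrite !le_max !lexx orbT.
Qed.

Lemma enorm_eq0 (m : nat) (xi : 'rV[R[i]]_m) : enorm xi = 0 -> xi = 0.
Proof.
move=> h; apply/rowP => j; rewrite mxE; apply/eqP; rewrite -normc_eq0 eq_le normc_ge0 andbT.
by rewrite -h normc_le_enorm.
Qed.

Lemma model_metric_gt0 (xi : V) (x Y : R) : 0 < x -> 0 < Y -> xi != 0 ->
  0 < model_metric xi x Y.
Proof.
move=> x0 Y0; apply: contra_neqT; rewrite -leNgt => X0.
have [h1 h2] := model_metric_le xi x0 Y0.
apply: enorm_eq0; apply/eqP; rewrite eq_le enorm_ge0 andbT.
apply: le_trans (enorm_le_split xi) _.
have a := mulr_le0_ge0 X0 (ltW x0); have b := mulr_le0_ge0 X0 (ltW Y0).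
lra.
Qed.

Variables (D U : set V) (phi : R -> R) (e0 : R).
Hypotheses (n0 : (0 < n)%N) (oD : open D) (bD : bounded_set D) (bd0 : bd D 0).
Hypothesis hdef : forall p, bd D p -> exists W f, local_defining D p W f.
Hypotheses (hphi : exp_flat phi) (e00 : 0 < e0)
  (hconv : forall x, 0 < x < e0 -> 0 < derive1n 2 phi x).
Hypotheses (U0 : nbhs (0 : V) U) (DU : D `&` U = [set z | U z /\ rho phi z < 0]).

Lemma near_U : exists2 d : R, 0 < d & forall p : V, enorm p < d -> nbhs p U.
Proof.
have /nbhs_rVP[d d0 H] := nbhs_interior U0.
exists d; first exact: d0.
move=> p pd; suff Up : interior U p by exact: Up.
apply: H => j.
have E : (0 : V) 0 j = 0 by rewrite mxE.
by rewrite E subr0 (le_lt_trans (normc_le_enorm p j)).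
Qed.

Lemma D_rho z : U z -> D z <-> rho phi z < 0.
Proof.
move=> Uz; have : (D `&` U) z = (U z /\ rho phi z < 0) by rewrite DU.
by rewrite /setI /= => H; split=> h; [have : U z /\ rho phi z < 0 by rewrite -H|
  have : D z /\ U z by rewrite H]; case.
Qed.

Lemma phi_continuous : continuous phi.
Proof. exact (@flat_continuous R phi hphi 0%N). Qed.

(* If there is no nearest point then [nearest_pt] is 0, which is also a boundary
   point near [z]; so existence and uniqueness are not at issue. *)
Lemma nearest_bd_close : exists2 d : R, 0 < d & forall z, enorm z < d -> D z ->
  0 <= phi (sqtan z) ->
  let p := nearest_pt (bd D) z in
  [/\ bd D p, nbhs p U & tnorm p <= tnorm z - complex.Re (z 0 ord0)].
Proof.
have [d d0 H] := near_U; exists (d / 2); first by rewrite divr_gt0.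
move=> z zd Dz phiz p.
have Uz : nbhs z U by apply: H; lra.
have rz : rho phi z < 0 by apply/D_rho => //; exact: nbhs_singleton.
have x0 : 0 < - complex.Re (z 0 ord0) by move: rz; rewrite /rho; lra.
rewrite /p {p}; set p := nearest_pt _ _.
have : p = 0 \/ nearest (bd D) z p by exact: nearest_ptP.
case=> [->|[bp pmin]].
  split=> //; rewrite (_ : tnorm 0 = 0); last first.
    by rewrite -(scale0r z) tnormZ normc0 mul0r.
  by have := tnorm_ge0 z; lra.
have xle := le_trans (ler_norm (- complex.Re (z 0 ord0))) (_ : _ <= enorm z).
rewrite normrN in xle; have {}xle := xle (Re0_le_enorm z).
(* A competitor on the boundary: push z along e_1 until rho vanishes, a distance a <= x. *)
pose a := - rho phi z; pose w := z + a%:C *: stdb 0.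
have a0 : 0 <= a <= - complex.Re (z 0 ord0) by rewrite /a /rho in rz *; lra.
have na : enorm (a%:C *: stdb 0 : V) = a.
  by rewrite enormZ enorm_stdb0 mulr1 normc_real ger0_norm //; case/andP: a0.
have Uw : nbhs w U.
  by apply: H; apply: le_lt_trans (enormD _ _) _; rewrite na; lra.
have bw : bd D w.
  apply/(bd_rho (phi := phi) (D := D)).
  - exact: phi_continuous.
  - by apply: filterS Uw => u; exact: D_rho.
  - by rewrite rho_shift /a addrN.
have zp : enorm (z - p) <= - complex.Re (z 0 ord0).
  apply: le_trans (pmin _ bw) _.
  by rewrite /w opprD addrA subrr add0r enormN na; lra.
have pE : p = z + (p - z) by rewrite addrC subrK.
split; first exact: bp.
- apply: H; rewrite pE.
  apply: le_lt_trans (enormD _ _) _; rewrite -[enorm (p - z)]enormN opprB; lra.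
- rewrite pE; apply: le_trans (tnormD _ _) _; rewrite lerD2l.
  by apply: le_trans (tnorm_le_enorm _) _; rewrite -enormN opprB.
Qed.

(** Localization on the disc of radius 1 - e is what costs the factor 1 - e. The lower bound m for
    phi away from 0 is phi (eta / 4), by monotonicity. *)
Lemma kobayashi_set_ge (e eta : R) : 0 < e < 1 -> 0 < eta -> 4 * eta <= e0 ->
  (forall z, sqnorm z < 4 * eta -> U z) ->
  exists2 d, 0 < d & forall z xi y a, sqnorm z < d -> 0 < y < e0 ->
    phi y = - complex.Re (z 0 ord0) -> kobayashi_set D z xi a ->
    (1 - e) * model_metric xi (- complex.Re (z 0 ord0)) (Num.sqrt y) <= a.
Proof.
move=> /andP[e_0 e1] eta0 eta1 etaU.
have [M M0 DM] := bounded_set_normc bD.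
have Drho (z : V) : D z -> sqnorm z < 4 * eta -> rho phi z < 0.
  by move=> Dz /etaU Uz; apply/(D_rho Uz).
have q4 : 0 < eta / 4 < e0 by rewrite divr_gt0 //=; lra.
have phi0' (y : R) : 0 <= y < 4 * eta -> 0 <= phi y.
  by move=> /andP[y0 y1]; apply: (flat_ge0 hphi hconv); rewrite y0 (lt_le_trans y1).
have phim (y : R) : eta / 4 <= y < 4 * eta -> phi (eta / 4) <= phi y.
  move=> /andP[y0 y1]; have ye : y < e0 by apply: lt_le_trans eta1.
  by case/andP: q4 => /ltW q0 _; exact: (flat_mono hphi hconv q0 y0 ye).
have r01 : 0 < 1 - e < 1 by lra.
have [d d0 H] := @disc_localization R n D phi M eta (phi (eta / 4)) (1 - e) M0 DM eta0
  (fun z Dz => Drho z Dz) phi0' (flat_gt0 hphi hconv q4) phim r01.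
exists d; first exact: d0.
move=> z xi y a zd y0 py [a0 [f [hf fz df]]].
have loc : forall w, normc w <= 1 - e -> sqnorm (f w) < eta.
  by apply: H => //; rewrite fz.
have x0 : 0 < - complex.Re (z 0 ord0) by rewrite -py (flat_gt0 hphi hconv y0).
have etae : eta <= e0 by lra.
have Drho' (u : V) : D u -> sqnorm u < eta -> rho phi u < 0.
  by move=> Du ue; apply: Drho => //; lra.
have [h1 h2] := disc_derive_le hphi hconv etae Drho' r01 y0 py a0 hf fz df loc.
have Y0 : 0 < Num.sqrt y by rewrite sqrtr_gt0; case/andP: y0.
rewrite mulrC -ler_pdivlMr; last by lra.
have ie : 0 < 1 - e by lra.
rewrite ge_max !ler_pdivrMr ?mulr_gt0 // mulrAC ler_pdivlMr // mulrC h1 /=.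
by rewrite mulrAC ler_pdivlMr // mulrC.
Qed.

(** [disc_exists] with x1 = (1 - e) x, which leaves e x for phi, and S = (1 - 4 e) Y. The factor 1 +
    10 e suffices because (1 + 10 e) (2 - 3 e) >= 2 for the first coordinate and (1 + 10 e) (1 - 5
    e) >= 1 for the others. *)
Lemma kobayashi_set_model (e eta Y : R) (z xi : V) : 0 < e -> 40 * e <= 1 ->
  0 < eta <= 1 -> (forall z, sqnorm z < eta -> U z) ->
  let x := - complex.Re (z 0 ord0) in
  0 < x -> normc (z 0 ord0) <= e * eta / 4 -> 0 < Y -> Y ^+ 2 < eta / 4 ->
  tnorm z <= e * Y ->
  (forall u, 0 <= u <= (Y * (1 - 8 * e / 2)) ^+ 2 -> phi u <= e * x) ->
  xi != 0 ->
  kobayashi_set D z xi ((1 + 10 * e) * model_metric xi x Y).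
Proof.
move=> e_0 e1 /andP[eta0 eta1] etaU x x0 zx Y0 Ye rY lo xi0.
have X0 := model_metric_gt0 x0 Y0 xi0.
have [h1 h2] := model_metric_le xi x0 Y0.
set X := model_metric xi x Y in X0 h1 h2 *.
have a0 : 0 < (1 + 10 * e) * X by rewrite mulr_gt0 //; lra.
have xz : x <= normc (z 0 ord0).
  by apply: le_trans (ler_Re_normc _); rewrite -normrN ler_norm.
have K0 : 0 < eta / 4 by rewrite divr_gt0.
have eK : 0 < e * eta by rewrite mulr_gt0.
have eK1 := ler_wpM2r (ltW eta0) e1.
apply: (@disc_exists R n D phi eta _ ((1 - e) * x) (eta / 4) (Y * (1 - 8 * e / 2))).
- move=> u ue ru; apply/D_rho => //; exact: etaU.
- exact: a0.
- have := mulr_gt0 e_0 x0; have := mulr_gt0 (_ : 0 < 1 - e) x0; rewrite subr_gt0.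
  have e11 : e < 1 by lra.
  by move=> /(_ e11) -> ?; lra.
- have : tnorm xi / ((1 + 10 * e) * X) <= Y * (1 - 5 * e).
    rewrite ler_pdivrMr //; apply: le_trans h2 _.
    have XY := mulr_gt0 X0 Y0; have eXY := mulr_gt0 e_0 XY.
    have := ler_wpM2r (ltW eXY) e1; lra.
  by lra.
- by move=> u /lo; rewrite -/x; lra.
- have t1 : (1 - 8 * e / 2) ^+ 2 <= 1 by rewrite expr_le1 //; lra.
  have t2 := ler_wpM2l (sqr_ge0 Y) t1; rewrite mulr1 -exprMn in t2.
  have : (normc (z 0 ord0) + 2 * (eta / 4)) ^+ 2 <= (3 * eta / 4) ^+ 2.
    have := normc_ge0 (z 0 ord0) => nz.
    by rewrite lerXn2r ?nnegrE //; lra.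
  have := ler_wpM2l (ltW eta0) eta1; lra.
- apply: le_trans h1 _.
  have xK : x ^+ 2 / (eta / 4) <= e * x.
    rewrite ler_pdivrMr // expr2 mulrAC ler_wpM2r ?(ltW x0) //; lra.
  have s1 : ((1 - e) * x) ^+ 2 / (eta / 4) <= e * x.
    apply: le_trans xK; rewrite ler_wpM2r ?invr_ge0 ?(ltW K0) // exprMn ler_piMl ?sqr_ge0 //.
    by rewrite expr_le1 //; lra.
  have s2 := ler_wpM2l (ltW a0) s1.
  have Xx := mulr_gt0 X0 x0; have eXx := mulr_gt0 e_0 Xx.
  have := ler_wpM2r (ltW eXx) e1; lra.
Qed.

Lemma kobayashi_quotient_close (alpha N e : R) (xi : V) : 0 < alpha -> 0 < N ->
  0 < e -> 40 * e <= 1 -> 8 * n.+2%:R * e <= 1 -> xi != 0 ->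
  exists2 d, 0 < d & forall z, enorm z < d -> D z -> cone alpha N z ->
    `|kobayashi D z xi /
      Num.max (enorm (nor_part D (nearest_pt (bd D) z) xi) / (2 * dnor phi z))
              (enorm (tan_part D (nearest_pt (bd D) z) xi) / dtan phi z) - 1| <= 40 * e.
Proof.
move=> al0 N0 e_0 e1 en xi0.
have [dU dU0 HU] := near_U.
(* The set |z|^2 < 4 eta then lies in U, and phi is convex on [0, 4 eta). *)
pose eta := Num.min 1 (Num.min (e0 / 4) (dU ^+ 2 / 4)).
have eta0 : 0 < eta by rewrite !lt_min ltr01 !divr_gt0 // exprn_gt0.
have [eta1 etae etad] : [/\ eta <= 1, eta <= e0 / 4 & eta <= dU ^+ 2 / 4].
  by split; rewrite !ge_min lexx ?orbT.
have etaU (z : V) : sqnorm z < 4 * eta -> U z.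
  move=> ze; apply: nbhs_singleton; apply: HU.
  rewrite -(ltr_pXn2r (n := 2)) ?nnegrE ?enorm_ge0 ?(ltW dU0) // enorm_sqr.
  by apply: lt_le_trans ze _; lra.
have e01 : 0 < e < 1 by rewrite e_0 /=; lra.
have k01 : 0 < 8 * e <= 1 by lra.
have y0 : 0 < eta / 4 by rewrite divr_gt0.
have y1 : eta / 4 <= 1 by lra.
have ye : 4 * (eta / 4) < e0 by lra.
have [d1 d10 H1] := cone_scale hphi e00 hconv al0 N0 e01 k01 y0 y1 ye.
have e4 : 4 * eta <= e0 by lra.
have [d2 d20 H2] := kobayashi_set_ge e01 eta0 e4 etaU.
have [d3 d30 H3] := nearest_bd_close.
have d40 : 0 < e * eta / 4 by rewrite divr_gt0 // mulr_gt0.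
exists (Num.min d1 (Num.min d2 (Num.min d3 (Num.min (e * eta / 4) (Num.min e0 (Num.min 1 dU)))))).
  by rewrite !lt_min d10 d20 d30 d40 e00 ltr01.
move=> z; rewrite !lt_min => /and5P[z1 z2 z3 z4 /and3P[ze0 z_1 zU]] Dz cz.
set p := nearest_pt (bd D) z.
have Uz : U z by apply: nbhs_singleton; exact: HU.
have rz : rho phi z < 0 by apply/D_rho.
have sz : sqnorm z <= enorm z.
  by rewrite -enorm_sqr expr2 ler_piMl ?enorm_ge0 // ltW.
have tz : 0 <= sqtan z < e0.
  by rewrite sqtan_ge0 /=; apply: le_lt_trans ze0; exact: le_trans (sqtan_le_sqnorm z) sz.
have pz := flat_ge0 hphi hconv tz.
pose x := - complex.Re (z 0 ord0).
have x0 : 0 < x by move: rz; rewrite /rho /x; lra.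
have xz : x <= enorm z by apply: le_trans (Re0_le_enorm z); rewrite -normrN ler_norm.
have x01 : 0 < x < d1 by rewrite x0 (le_lt_trans xz).
have cx : alpha * tnorm z `^ N < x by move: cz; rewrite /cone /= /x -/(tnorm z); lra.
have [Y [Y0 Ye pY rY [small small' lo hi]]] := H1 x (tnorm z) x01 (tnorm_ge0 z) cx.
have Y1 : Y < 1.
  rewrite -(ltr_pXn2r (n := 2)) ?nnegrE ?ler01 ?(ltW Y0) // expr1n.
  by apply: lt_le_trans Ye _; lra.
have e_1 : e <= 1 by case/andP: e01 => _ /ltW.
have eY : e * Y <= 1 := mulr_ile1 (ltW e_0) (ltW Y0) e_1 (ltW Y1).
have rx1 : tnorm z + 2 * x <= 1 by lra.
have r0 := tnorm_ge0 z.
have cphi := phi_continuous.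
have e18 : 0 < e <= 1 / 8 by lra.
have k14 : 0 < 8 * e <= 1 / 4 by lra.
have Y01 : 0 < Y <= 1 by rewrite Y0 ltW.
have dn := dnor_bounds n0 cphi x0 e18 small.
(* The choice k = 8 e is the smallest that [dtan_bounds] allows. *)
have dt := dtan_bounds n0 cphi (flat_at0 hphi) x0 e18 small small' rx1 k14 (lexx _) Y01 rY lo hi.
have [bp Up tp] := H3 z z3 Dz pz.
rewrite -/p in bp Up tp.
have {}tp : tnorm p <= tnorm z + x := tp.
have X0 := model_metric_gt0 x0 Y0 xi0.
have [h1 h2] := model_metric_le xi x0 Y0.
set X := model_metric xi x Y in X0 h1 h2.
(* Both factors matter: the error K must be small against X x for the normal part and against X Y
   for the tangential one. The x comes from phi', the Y from |p'|, and the spare e absorbs 8 (n +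
   2). *)
have tc : tnorm (conormal phi p) <= 2 * e * x * (e * Y).
  rewrite tnorm_conormal ler_pM ?tnorm_ge0 //; last by lra.
  rewrite normrM ger0_norm // -mulrA ler_pM2l //; apply: small'.
  rewrite sqtan_ge0 -tnorm_sqr lerXn2r ?nnegrE ?tnorm_ge0 //; lra.
have tc1 : tnorm (conormal phi p) <= 1.
  apply: le_trans tc _; rewrite mulr_ile1 ?mulr_ge0 ?(ltW e_0) ?(ltW x0) ?(ltW Y0) //.
  have := ler_wpM2r (ltW x0) e_1; lra.
have [pc1 pc2] := parts_close (flat_is_derive0 hphi) oD Up DU bp (hdef bp) xi tc1.
set K := 2 * _ * _ * _ in pc1 pc2.
have Xx := mulr_gt0 X0 x0; have XY := mulr_gt0 X0 Y0.
have KX : K <= e * (X * x * Y).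
  have nx : enorm xi <= X * 2.
    apply: le_trans (enorm_le_split xi) _.
    have XX : X * (2 * x + Y) <= X * 2 by rewrite ler_pM2l //; lra.
    by lra.
  have A0 : 0 <= 2 * n.+2%:R :> R by rewrite mulr_ge0.
  rewrite /K -mulrA; apply: (@le_trans _ _ (2 * n.+2%:R * (2 * e * x * (e * Y) * (X * 2)))).
    by rewrite ler_wpM2l // ler_pM ?tnorm_ge0 ?enorm_ge0.
  have := ler_wpM2r (ltW (mulr_gt0 e_0 (mulr_gt0 Xx Y0))) en; lra.
have K1 : K <= e * (X * x).
  by apply: le_trans KX _; rewrite ler_pM2l // ler_piMr ?(ltW Xx) ?(ltW Y1).
have K2 : K <= e * (X * Y) / 2.
  apply: le_trans KX _; rewrite -[leRHS]mulrA ler_pM2l // mulrAC ler_pM2l //; lra.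
have nm : (1 - 10 * e) * X <= Num.max (enorm (nor_part D p xi) / (2 * dnor phi z))
     (enorm (tan_part D p xi) / dtan phi z) <= (1 + 12 * e) * X.
  exact: (max_quotient_close e_0 e1 (normc_ge0 _) (tnorm_ge0 xi) x0 Y0 erefl X0 dn dt
    (le_trans pc1 K1) (le_trans pc2 K2)).
apply: (quotient_close1 e_0 e1 X0 _ nm).
have lbX (a : R) : kobayashi_set D z xi a -> (1 - e) * X <= a.
  have ye0 : 0 < Y ^+ 2 < e0 by rewrite exprn_gt0 //=; lra.
  move=> /(H2 z xi (Y ^+ 2) a (le_lt_trans sz z2) ye0 pY).
  by rewrite sqrtr_sqr ger0_norm // ltW.
have inX : kobayashi_set D z xi ((1 + 10 * e) * X).
  have eta01 : 0 < eta <= 1 by rewrite eta0.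
  apply: (@kobayashi_set_model e eta Y z xi e_0 e1 eta01) => //.
  - by move=> u ue; apply: etaU; lra.
  - by apply: ltW; apply: le_lt_trans z4; exact: normc_le_enorm.
  - by lra.
rewrite /kobayashi -/(kobayashi_set D z xi); apply/andP; split.
  by apply: lb_le_inf; [exists ((1 + 10 * e) * X) | move=> a; exact: lbX].
by apply: ge_inf => //; exists ((1 - e) * X) => a; exact: lbX.
Qed.

End MetricEstimate.

(** Coordinates below d / (m + 1) give |z|^2 <= m d^2 / (m + 1)^2 < d^2; the m + 1 also covers m =
    0. *)
Lemma nbhs0_enorm (R : realType) (m : nat) (d : R) : 0 < d ->
  nbhs (0 : 'rV[R[i]]_m) [set z | enorm z < d].
Proof.
move=> d0; apply/nbhs_rVP.
have m0 : 0 < m.+1%:R :> R by [].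
exists (d / m.+1%:R); first exact: divr_gt0.
move=> z zd; rewrite /= -(ltr_pXn2r (n := 2)) ?nnegrE ?enorm_ge0 ?(ltW d0) // enorm_sqr.
have : sqnorm z <= \sum_(j < m) (d / m.+1%:R) ^+ 2.
  apply: ler_sum => j _; rewrite -normc_sqr lerXn2r ?nnegrE ?normc_ge0 //.
    exact: divr_ge0 (ltW d0) (ltW m0).
  by have := zd j; rewrite mxE subr0 => /ltW.
move=> /le_lt_trans; apply.
rewrite sumr_const card_ord -[_ *+ m]mulr_natr expr_div_n mulrAC ltr_pdivrMr ?exprn_gt0 //.
rewrite ltr_pM2l ?exprn_gt0 // -natrX ltr_nat.
by rewrite (@leq_trans m.+1) // -{1}[m.+1]muln1 -mulnn leq_mul2l.
Qed.

Theorem theorem1p5 (R : realType) (n : nat) (hn : (0 < n)%N)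
    (alpha N : R) (halpha : 0 < alpha) (hN : 0 < N)
    (D : set 'rV[R[i]]_n.+1)
    (hD : smooth_bounded_domain D) (hpsc : pseudoconvex D) (hbd : bd D 0)
    (phi : R -> R) (hflat : exp_flat_point D phi)
    (q : R -> 'rV[R[i]]_n.+1) (hq : cone_curve D alpha N q)
    (xi : 'rV[R[i]]_n.+1) (hxi : xi != 0) :
  let xiN t := nor_part D (nearest_pt (bd D) (q t)) xi in
  let xiT t := tan_part D (nearest_pt (bd D) (q t)) xi in
  kobayashi D (q t) xi /
    Num.max (enorm (xiN t) / (2 * dnor phi (q t)))
            (enorm (xiT t) / dtan phi (q t))
  @[t --> 0^'+] --> (1 : R).
Proof.
move=> xiN xiT.
case: hD => oD _ _ bD hdef.
case: hflat => hphi [U U0 DU].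
case: (exp_flat_convex hphi) => e0 e00 hconv.
case: hq => [[t0 t00 [_ _ qD]] q0].
apply/cvgrPdist_lt => eps eps0.
have A0 : 0 < 8 * n.+2%:R :> R by rewrite mulr_gt0.
(* The final error 40 e is then at most eps / 2, which makes the inequality with eps strict. *)
pose e := Num.min (eps / 80) (Num.min 40^-1 (8 * n.+2%:R)^-1).
have e_0 : 0 < e by rewrite !lt_min divr_gt0 // !invr_gt0 A0 ltr0Sn.
have [e1 e2 e3] : [/\ e <= eps / 80, e <= 40^-1 & e <= (8 * n.+2%:R)^-1].
  by split; rewrite !ge_min lexx ?orbT.
have e40 : 40 * e <= 1 by lra.
have en : 8 * n.+2%:R * e <= 1 by rewrite -ler_pdivlMl // mulr1.
have [d d0 H] := kobayashi_quotient_close hn oD bD hbd hdef hphi e00 hconv U0 DU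
  halpha hN e_0 e40 en hxi.
have near1 : \forall t \near 0^'+, enorm (q t) < d.
  exact: (q0 _ (nbhs0_enorm n.+1 d0)).
have near2 : \forall t \near 0^'+, 0 < t < t0.
  near=> t; apply/andP; split; first by near: t; exact: nbhs_right_gt.
  by near: t; exact: nbhs_right_lt.
near=> t.
have td : enorm (q t) < d by near: t.
have [Dq cq] : D (q t) /\ cone alpha N (q t) by apply: qD; near: t.
rewrite distrC; apply: le_lt_trans (H (q t) td Dq cq) _; lra.
Unshelve. all: by end_near.
Qed.
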